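(* Let $(X,F,\mathfrak m)$ be a forward-complete measured Finsler manifold (possibly with boundary) satisfying the $\mathsf{CD}(0,N)$ condition for some $N>1$ and having Euclidean volume growth, i.e. $\mathsf{AVR}_X>0$. Then for every bounded Borel subset $E\subset X$ it holds $$\mathsf P(E)\;\ge\; N\,\omega_N^{\frac1N}\,\mathsf{AVR}_X^{\frac1N}\,\mathfrak m(E)^{\frac{N-1}{N}} .$$ Moreover, this inequality is sharp: the constant $N\omega_N^{1/N}\mathsf{AVR}_X^{1/N}$ cannot be replaced by a larger one.
   Context: Manifolds may have a (Lipschitz) boundary. A Finsler structure on a connected $n$-dimensional manifold $X$ is a function $F:TX\to[0,\infty)$ that is $C^\infty$ outside the zero section, satisfies $F(cv)=cF(v)$ for all $c>0$, vanishes only on zero vectors, and is such that $F^2$ is strictly convex on each $T_xX$; in general $F(v)\ne F(-v)$. A measured Finsler manifold $(X,F,\mathfrak m)$ is a connected manifold $X$ with a Finsler structure $F$ and a measure $\mathfrak m$ having a smooth positive density in local coordinates. The (non-symmetric) distance $\mathsf d(x,y)$ is the infimum of $\int_0^1F(\dot\eta)\,dt$ over $C^1$ curves $\eta$ with $\eta_0=x$, $\eta_1=y$. Forward balls: $B^+(x,r)=\{y:\mathsf d(x,y)<r\}$; backward balls: $B^-(x,r)=\{y:\mathsf d(y,x)<r\}$. A set is bounded if it is contained in some forward ball and in some backward ball. $X$ is forward-complete if every sequence $(x_k)$ such that $\forall\epsilon>0\,\exists M\,\forall n>m>M:\ \mathsf d(x_m,x_n)\le\epsilon$ converges. Slope of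 a locally Lipschitz function: $|\partial u|(x)=\limsup_{y\to x}\frac{(u(x)-u(y))^+}{\mathsf d(x,y)}$. Perimeter of a Borel set $E$: $\mathsf P(E)=\inf\{\liminf_n\int_X|\partial u_n|\,d\mathfrak m:\ u_n\in \mathrm{Lip}_{loc}(X),\ u_n\to\mathbf 1_E\text{ in }L^1_{loc}(X)\}$. $\mathsf{CD}(0,N)$ (with $N\in[\dim X,\infty)$): for all $N'\ge N$ and all $\mathfrak m$-absolutely continuous probability measures $\mu_0,\mu_1$ with finite second moment (i.e. $\int(\mathsf d(o,x)+\mathsf d(x,o))^2\mu_i(dx)<\infty$), the unique $W_2$-geodesic $(\mu_t)_{t\in[0,1]}$ from $\mu_0$ to $\mu_1$ (where $W_2(\mu,\nu)^2=\inf_\pi\int\mathsf d(x,y)^2\,d\pi$ over couplings $\pi$, and geodesic means $W_2(\mu_t,\mu_s)=(s-t)W_2(\mu_0,\mu_1)$ for $0\le t\le s\le1$) satisfies $S_{N'}(\mu_t)\le(1-t)S_{N'}(\mu_0)+tS_{N'}(\mu_1)$, where $S_{N'}(\mu)=-\int\rho^{1-1/N'}d\mathfrak m$ and $\rho$ is the density of the absolutely continuous part of $\mu$ with respect to $\mathfrak m$. $\omega_N=\pi^{N/2}/\Gamma(N/2+1)$. The asymptotic volume ratio is $\mathsf{AVR}_X=\lim_{r\to\infty}\frac{\mathfrak m(B^+(x,r))}{\omega_Nr^N}$; under $\mathsf{CD}(0,N)$ the limit exists (Bishop--Gromov monotonicity) and does not depend on $x\in X$. *)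

(* Defs.v *)
From HB Require Import structures.
From mathcomp Require Import all_boot all_order all_algebra.
From mathcomp Require Import all_classical all_reals all_analysis.
Import Order.TTheory GRing.Theory Num.Theory.
Import numFieldNormedType.Exports.

Set Implicit Arguments.
Unset Strict Implicit.
Unset Printing Implicit Defensive.

Local Open Scope classical_set_scope.
Local Open Scope ring_scope.

Section Calculus.
Context {R : realType}.

Section Smoothness.
Context {V W : normedModType R}.
Implicit Types (S U : set V) (f g : V -> W).

(* Meant for open U: all iterated directional derivatives of f up to order k
   exist and are continuous on U. *)
Fixpoint Ck (k : nat) U f : Prop :=
  (forall x, U x -> {for x, continuous f}) /\
  match k with
  | 0%N => True
  | k'.+1 => forall v, (forall x, U x -> derivable f x v) /\
                       Ck k' U (fun x => 'D_v f x)
  end.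

(* On an arbitrary set S, a function is C^k (resp. smooth) if near each point
   of S it has a C^k (resp. smooth) extension to an open set. *)
Definition Ck_on (k : nat) S f : Prop :=
  forall x, S x -> exists U g,
    [/\ open_nbhs x U, Ck k U g & forall y, U y -> S y -> g y = f y].

Definition smooth_on S f : Prop :=
  forall x, S x -> exists U g,
    [/\ open_nbhs x U, forall k, Ck k U g & forall y, U y -> S y -> g y = f y].

(* w is the derivative at x in the direction v of f : S -> W, computed on a
   C^1 extension of f. It does not depend on the extension when S is locally
   contained in the closure of its interior, as is the case of images of charts
   and of intervals. *)
Definition derivative_on S f (x v : V) (w : W) : Prop :=
  exists U g, [/\ open_nbhs x U, Ck 1 U g,
    forall y, U y -> S y -> g y = f y & 'D_v g x = w].

End Smoothness.

(* Near p, the set S is either everything or the region above the graph of a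
   Lipschitz function over the hyperplane orthogonal to some e != 0; a function
   on that hyperplane is encoded as a function on R^n invariant along e. *)
Definition lipschitz_domain_at n (S : set 'rV[R]_n) (p : 'rV[R]_n) : Prop :=
  exists U, open_nbhs p U /\
   (U `<=` S \/
    exists (e : 'rV[R]_n) (f : 'rV[R]_n -> R) (k : R),
      [/\ e != 0,
          forall y z, `|f y - f z| <= k * `|y - z|,
          forall y t, f (y + t *: e) = f y
        & forall y, U y -> (S y <-> f y <= (y *m e^T) 0 0)]).

(* Integral over R^n of a nonnegative Borel function against Lebesgue measure,
   as an iterated integral (Tonelli). *)
Fixpoint lebesgue_int n : ('rV[R]_n -> \bar R) -> \bar R :=
  match n with
  | 0%N => fun f => f 0
  | n'.+1 => fun f => (\int[@lebesgue_measure R]_t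
      lebesgue_int (fun v : 'rV[R]_n' => f (row_mx (const_mx t : 'M[R]_(1, 1)) v)))%E
  end.

Definition Gamma (s : R) : R :=
  \int[@lebesgue_measure R]_(x in `]0, +oo[) (x `^ (s - 1) * expR (- x)).

Definition omega (N : R) : R := pi `^ (N / 2) / Gamma (N / 2 + 1).

End Calculus.

(* Connected smooth n-manifolds with (possibly empty) Lipschitz boundary,
   given by an atlas indexed by [chart]; [coord_inv c] is the inverse of the
   coordinate map [coord c] on its image and is irrelevant elsewhere. *)
Record manifold (R : realType) (n : nat) := Manifold {
  points :> ptopologicalType ;
  chart : Type ;
  cdom : chart -> set points ;
  coord : chart -> points -> 'rV[R]_n ;
  coord_inv : chart -> 'rV[R]_n -> points ;
  manifold_hausdorff : hausdorff_space points ;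
  manifold_second_countable : @second_countable points ;
  manifold_connected : connected [set: points] ;
  cdom_open : forall c, open (cdom c) ;
  cdom_cover : forall x, exists c, cdom c x ;
  coordK : forall c x, cdom c x -> coord_inv c (coord c x) = x ;
  coord_continuous : forall c x, cdom c x -> {for x, continuous (coord c)} ;
  coord_inv_continuous :
    forall c, {within coord c @` cdom c, continuous (coord_inv c)} ;
  coord_image : forall c p, (coord c @` cdom c) p ->
    lipschitz_domain_at (coord c @` cdom c) p ;
  transition_smooth : forall c c',
    smooth_on (coord c @` (cdom c `&` cdom c')) (coord c' \o coord_inv c) }.

Arguments cdom {R n m} c _ : rename.
Arguments coord {R n m} c _ : rename.
Arguments coord_inv {R n m} c _ : rename.

(* [finsler c x v] is F at the tangent vector of T_x X whose components in the
   chart c are v; [finsler_compat] says that it depends only on that vector. *)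
Record finsler_manifold (R : realType) (n : nat) := FinslerManifold {
  base :> manifold R n ;
  finsler : chart base -> base -> 'rV[R]_n -> R ;
  finsler_compat : forall c c' x v w, cdom c x -> cdom c' x ->
    derivative_on (coord c @` (cdom c `&` cdom c'))
      (coord c' \o coord_inv c) (coord c x) v w ->
    finsler c' x w = finsler c x v ;
  finsler_ge0 : forall c x v, cdom c x -> 0 <= finsler c x v ;
  finsler_smooth : forall c,
    smooth_on [set pv : 'rV[R]_n * 'rV[R]_n |
                (coord c @` cdom c) pv.1 /\ pv.2 != 0]
      (fun pv => finsler c (coord_inv c pv.1) pv.2 : R^o) ;
  finsler_homo : forall c x a v, cdom c x -> 0 < a ->
    finsler c x (a *: v) = a * finsler c x v ;
  finsler_eq0 : forall c x v, cdom c x -> finsler c x v = 0 -> v = 0 ;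
  finsler_strictly_convex : forall c x v w t, cdom c x -> v != w ->
    0 < t < 1 ->
    finsler c x ((1 - t) *: v + t *: w) ^+ 2 <
      (1 - t) * finsler c x v ^+ 2 + t * finsler c x w ^+ 2 }.

Notation borel X := (g_sigma_algebraType (@open X)).

Record measured_finsler (R : realType) (n : nat) := MeasuredFinsler {
  space :> finsler_manifold R n ;
  vol : {measure set (borel space) -> \bar R} ;
  vol_density : chart space -> 'rV[R]_n -> R ;
  vol_density_gt0 : forall c p,
    (coord c @` cdom c) p -> 0 < vol_density c p ;
  vol_density_smooth : forall c,
    smooth_on (coord c @` cdom c) (vol_density c : 'rV[R]_n -> R^o) ;
  volE : forall c (A : set (borel space)), measurable A -> A `<=` cdom c ->
    vol A = lebesgue_int
      (fun p => (\1_(coord c @` A) p * vol_density c p)%:E) }.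

Section Distance.
Context {R : realType} {n : nat} (X : finsler_manifold R n).

Definition chart_times (eta : R -> X) (c : chart X) : set R^o :=
  [set t | 0 <= t <= 1 /\ cdom c (eta t)].

Definition C1_curve (eta : R -> X) : Prop :=
  {within `[0, 1], continuous eta} /\
  forall c, Ck_on 1 (chart_times eta c) (coord c \o eta).

(* s is F of the velocity of eta at time t. *)
Definition speed (eta : R -> X) (t s : R) : Prop :=
  exists c v, [/\ cdom c (eta t),
    derivative_on (chart_times eta c) (coord c \o eta) t 1 v
    & s = finsler c (eta t) v].

(* The infimum is over a nonempty set since X is connected, so the default
   value of [inf] plays no role. *)
Definition dist (x y : X) : R :=
  inf [set L | exists (eta : R -> X) (s : R -> R),
    [/\ C1_curve eta, eta 0 = x, eta 1 = y,
        forall t, 0 <= t <= 1 -> speed eta t (s t)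
      & L = \int[@lebesgue_measure R]_(t in `[0, 1]) s t]].

Definition fball (x : X) (r : R) : set X := [set y | dist x y < r].
Definition bball (x : X) (r : R) : set X := [set y | dist y x < r].

Definition dist_bounded (E : set X) : Prop :=
  (exists x r, E `<=` fball x r) /\ (exists x r, E `<=` bball x r).

Definition forward_complete : Prop :=
  forall x_ : nat -> X,
    (forall eps, 0 < eps -> exists M, forall p q, (M < p)%N -> (p < q)%N ->
       dist (x_ p) (x_ q) <= eps) ->
    exists x : X, x_ @ \oo --> x.

Definition loc_lipschitz (u : X -> R) : Prop :=
  forall x : X, exists U L, nbhs x U /\
    forall y z, U y -> U z -> `|u y - u z| <= L * dist y z.

Definition slope (u : X -> R) (x : X) : \bar R :=
  limf_esup (fun y => (Num.max (u x - u y) 0 / dist x y)%:E) x^'.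

End Distance.

Section Volume.
Context {R : realType} {n : nat} (X : measured_finsler R n).
Local Open Scope ereal_scope.

Definition cvg_L1loc (u : nat -> X -> R) (f : X -> R) : Prop :=
  forall K : set X, compact K ->
    \int[vol X]_(x in K) `|u k x - f x|%:E @[k --> \oo] --> 0.

Definition perimeter (E : set X) : \bar R :=
  ereal_inf [set limn_einf (fun k => \int[vol X]_x slope (u k) x) |
    u in [set u : nat -> X -> R |
           (forall k, loc_lipschitz (u k)) /\ cvg_L1loc u \1_E]].

(* Under CD(0,N) the limit exists and does not depend on x. *)
Definition AVR (N : R) (x : X) : \bar R :=
  lim ((vol X (fball x r) * ((omega N * r `^ N)^-1)%:E) @[r --> +oo%R]).

Local Notation prob := (probability (borel X) R).

Definition same_law (mu nu : prob) : Prop :=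
  forall A : set (borel X), measurable A -> mu A = nu A.

Definition finite_second_moment (mu : prob) : Prop :=
  exists o : X, \int[mu]_x ((dist o x + dist x o) ^+ 2)%:E < +oo.

Definition coupling (mu nu : prob)
    (pi : probability (borel X * borel X)%type R) : Prop :=
  forall A : set (borel X), measurable A ->
    pi (A `*` setT) = mu A /\ pi (setT `*` A) = nu A.

Definition W2 (mu nu : prob) : \bar R :=
  (ereal_inf [set \int[pi]_z ((dist (z.1 : X) (z.2 : X)) ^+ 2)%:E |
               pi in coupling mu nu]) `^ 2^-1.

Definition W2_geodesic (mu0 mu1 : prob) (mu : R -> prob) : Prop :=
  [/\ same_law (mu 0%R) mu0, same_law (mu 1%R) mu1
    & forall t s : R, (0 <= t)%R -> (t <= s)%R -> (s <= 1)%R ->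
        W2 (mu t) (mu s) = (s - t)%:E * W2 mu0 mu1].

(* Lebesgue decomposition: rho is the density of the absolutely continuous part
   of mu, the singular part being concentrated on the null set Z. *)
Definition is_ac_density (mu : prob) (rho : borel X -> R) : Prop :=
  [/\ measurable_fun setT rho, forall x, (0 <= rho x)%R
    & exists Z : set (borel X), [/\ measurable Z, vol X Z = 0
      & forall A, measurable A ->
          mu A = \int[vol X]_(x in A) (rho x)%:E + mu (A `&` Z)]].

Definition ac_density (mu : prob) : borel X -> R :=
  xget (cst 0%R) [set rho | is_ac_density mu rho].

Definition renyi_entropy (N : R) (mu : prob) : \bar R :=
  - \int[vol X]_x (ac_density mu x `^ (1 - N^-1))%:E.

(* The existence and uniqueness of the geodesic, implicit in speaking of the
   W_2-geodesic from mu0 to mu1, are spelled out. *)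
Definition CD0 (N : R) : Prop :=
  (n%:R <= N)%R /\
  forall mu0 mu1 : prob, mu0 `<< vol X -> mu1 `<< vol X ->
    finite_second_moment mu0 -> finite_second_moment mu1 ->
    exists mu : R -> prob,
      [/\ W2_geodesic mu0 mu1 mu,
          forall nu, W2_geodesic mu0 mu1 nu ->
            forall t : R, (0 <= t <= 1)%R -> same_law (nu t) (mu t)
        & forall (N' t : R), (N <= N')%R -> (0 <= t <= 1)%R ->
            renyi_entropy N' (mu t) <=
              (1 - t)%:E * renyi_entropy N' mu0 + t%:E * renyi_entropy N' mu1].

Definition isoperimetric_inequality (N : R) (C : \bar R) : Prop :=
  forall E : set (borel X), measurable E -> dist_bounded E ->
    C * (vol X E `^ ((N - 1) / N)) <= perimeter E.

End Volume.

(* Main.v *)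
(* The curvature condition, applied to the uniform measures of A and B, gives the
   Brunn-Minkowski inequality because the intermediate measure mu_s gives no mass
   to points x with d(A, x) much larger than s times the largest distance from A
   to B. For B a large ball centred at o this reads, in the limit,
     vol(A_e)^(1/N) >= vol(A)^(1/N) + e (omega_N AVR)^(1/N),
   A_e being the forward e-neighbourhood of A. Given a competitor u, truncate it to
   values in [0, 1] and bounded support: each superlevel set {u > t} contains the
   e-neighbourhood of the one of the erosion x |-> inf {u(y) : d(x, y) < e}. Adding
   up over the levels t and letting e tend to 0 bounds the integral of |du| from
   below, with neither a coarea formula nor differentiability of u.
   Conversely, a larger constant, tested on balls, would make vol(B_r)^(1/N) grow
   at a linear rate faster than (omega_N AVR)^(1/N). *)
Require Import Defs.
From HB Require Import structures.
From mathcomp Require Import all_boot all_order all_algebra.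
From mathcomp Require Import all_classical all_reals all_analysis.
From mathcomp Require Import measurable_realfun.
From mathcomp Require Import ring lra.
(* vector.coord would otherwise shadow the coordinate maps. *)
Import Defs.
Import Order.TTheory GRing.Theory Num.Theory.
Import numFieldNormedType.Exports.

Set Implicit Arguments.
Unset Strict Implicit.
Unset Printing Implicit Defensive.

Local Open Scope classical_set_scope.
Local Open Scope ring_scope.

(** * Calculus along curves *)

(** No minimizing curve and no optimal plan is ever produced: everything is done with infima and
    nearly optimal competitors. [dist] is an infimum over C^1 curves, whose concatenations have
    corners; lengths are therefore carried by curves that come to rest at both ends ([reach]), which
    makes them additive and lets a curve be cut at a prescribed length. At a boundary point a
    segment of a chart may leave its image, hence the detour in [local_reach]. Asymmetry is absorbed
    by compactness: forward completeness makes forward balls precompact, which gives them finite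
    volume and bounds the distances back to their centre. [W2] being an infimum, concentration is
    shown with nearly optimal plans, glued at the price of an arbitrarily small error in the middle
    point. The slope is a limsup with no uniformity in the point; its supremum over a fixed scale d
    is measurable and controls erosions of radius e <= d, and dominated convergence on a compact set
    lets d tend to 0. Finiteness of [AVR] has to be proved as well; it follows from the volume
    expansion itself. *)

Section Derivatives.
Context {R : realType}.

(** Multiplying the difference quotient by h removes the puncture: the estimate is trivial at h = 0
    and lives on a full neighbourhood. Derivative rules for maps known only through directional
    derivatives are checked in this form. *)
Lemma is_derive_epsP (V W : normedModType R) (f : V -> W) (a v : V) (l : W) :
  is_derive a v f l <->
  forall e : R, 0 < e -> \forall h \near (0 : R),
    `|f (h *: v + a) - f a - h *: l| <= e * `|h|.
Proof.
split.
  move=> [df Dl] e e0.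
  have : (fun h : R => h^-1 *: ((f \o shift a) (h *: v) - f a)) @ 0^' --> l.
    by rewrite -Dl; exact: df.
  move/cvgrPdist_le => /(_ e e0).
  rewrite near_withinE => H; near=> h.
  have [->|h0] := eqVneq h 0.
    by rewrite scale0r add0r !scale0r !subrr !normr0 mulr0.
  have Hh : `|l - h^-1 *: (f (h *: v + a) - f a)| <= e by exact: (near H h).
  rewrite -(scalerKV h0 (f (h *: v + a) - f a)) -scalerBr normrZ mulrC.
  by rewrite distrC ler_wpM2r.
move=> H.
have L : (fun h : R => h^-1 *: ((f \o shift a) (h *: v) - f a)) @ 0^' --> l.
  apply/cvgrPdist_le => e e0.
  rewrite near_withinE; near=> h => h0.
  have Hh : `|f (h *: v + a) - f a - h *: l| <= e * `|h| by near: h; exact: H.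
  rewrite /= -(@ler_pM2l _ `|h|) ?normr_gt0// -normrZ scalerBr scalerKV//.
  by rewrite distrC mulrC.
by split; [apply/cvg_ex; exists l|exact: cvg_lim].
Unshelve. all: by end_near. Qed.

Lemma normr_coord_le n (v : 'rV[R]_n) i : `|v 0 i| <= `|v|.
Proof.
rewrite [leRHS]/Num.norm/= mx_normrE.
exact: (le_bigmax _ (fun ij => `|v ij.1 ij.2|) (0, i)).
Qed.

Lemma normr_rV_le n (v : 'rV[R]_n) M : 0 <= M ->
  (forall i, `|v 0 i| <= M) -> `|v| <= M.
Proof.
move=> M0 vM; rewrite [leLHS]/Num.norm/= mx_normrE.
by apply: bigmax_le => // -[i j] _ /=; rewrite (ord1 i).
Qed.

Lemma is_derive_coord n (f : R^o -> 'rV[R]_n) t l i :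
  is_derive t (1 : R^o) f l ->
  is_derive t (1 : R^o) (fun s => f s 0 i : R^o) (l 0 i).
Proof.
move=> /is_derive_epsP H; apply/is_derive_epsP => e e0.
near=> h.
have : `|f (h *: 1 + t) - f t - h *: l| <= e * `|h| by near: h; exact: H.
by apply: le_trans; have := normr_coord_le (f (h *: 1 + t) - f t - h *: l) i; rewrite !mxE.
Unshelve. all: by end_near. Qed.

Lemma is_derive_continuous (W : normedModType R) (f : R^o -> W) t l :
  is_derive t (1 : R^o) f l -> {for t, continuous f}.
Proof.
move=> [df _]; apply: differentiable_continuous.
exact/derivable1_diffP.
Qed.

Lemma mean_value_le n (f df : R^o -> 'rV[R]_n) (a b M : R) : a <= b ->
  (forall t, a <= t <= b -> is_derive t (1 : R^o) f (df t)) ->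
  (forall t, a <= t <= b -> `|df t| <= M) -> `|f b - f a| <= M * (b - a).
Proof.
move=> ab fdf dfM.
have M0 : 0 <= M by apply: le_trans (dfM a _); rewrite ?normr_ge0// lexx.
apply: normr_rV_le; first by rewrite mulr_ge0// subr_ge0.
move=> i.
have H t : a <= t <= b -> is_derive t (1:R^o) (fun s => f s 0 i : R^o) (df t 0 i).
  by move=> /fdf; exact: is_derive_coord.
have [| |c cab] := @MVT_segment R (fun s => f s 0 i) (fun s => df s 0 i) a b ab.
- by move=> x; rewrite in_itv/= => /andP[ax xb]; apply: H; rewrite !ltW.
- apply: derivable_within_continuous => x; rewrite in_itv/= => /H.
  by move=> [].
- rewrite !mxE => ->; rewrite normrM ler_pM//.
    apply: le_trans (normr_coord_le _ _) _; apply: dfM.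
    by move: cab; rewrite in_itv.
  by rewrite ger0_norm// subr_ge0.
Qed.

Lemma is_derive_line (V W : normedModType R) (f : V -> W) (a v : V) (t : R^o) :
  derivable f (a + t *: v) v ->
  is_derive t (1 : R^o) (fun s : R^o => f (a + s *: v)) ('D_v f (a + t *: v)).
Proof.
move=> /derivableP/is_derive_epsP H; apply/is_derive_epsP => e e0.
apply: filterS (H _ e0) => h.
by rewrite -[h *: 1]/(h * 1) mulr1 scalerDl addrCA.
Qed.

Lemma is_derive_scale_dir (V W : normedModType R) (f : V -> W) (a v : V) l (c : R) :
  is_derive a v f l -> is_derive a (c *: v) f (c *: l).
Proof.
have [->|c0] := eqVneq c 0; first by rewrite !scale0r => _; exact: is_derive0.
move=> /is_derive_epsP H; apply/is_derive_epsP => e e0.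
have /H : 0 < e / `|c| by rewrite divr_gt0// normr_gt0.
have cc : (c * h) @[h --> (0:R)] --> (0:R).
  by rewrite -[X in _ --> X](mulr0 c); apply: cvgM; [exact: cvg_cst|exact: cvg_id].
move/cc => H1; near=> h.
have : `|f ((c * h) *: v + a) - f a - (c * h) *: l| <= e / `|c| * `|c * h|.
  by near: h; exact: H1.
by rewrite normrM mulrA divfK ?normr_eq0// (mulrC c h) -!scalerA.
Unshelve. all: by end_near. Qed.

(** Continuity bounds the partial derivatives near p. A ball of the sup norm is a box, so one can go
    from z to y inside it by changing one coordinate at a time ([w k] takes its first k coordinates
    from y) and apply the mean value inequality n times. *)
Lemma Ck1_lipschitz n m U (g : 'rV[R]_n -> 'rV[R]_m) p : open U -> U p ->
  Ck 1 U g ->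
  exists r L : R, [/\ 0 < r, 0 <= L, ball p r `<=` U &
    forall y z, ball p r y -> ball p r z -> `|g y - g z| <= L * `|y - z|].
Proof.
move=> oU Up [gc gd].
have key : \forall q \near p, U q /\
    forall i : 'I_n, `|'D_(delta_mx 0 i) g q| <= `|'D_(delta_mx 0 i) g p| + 1.
  apply: filterI; first exact: open_nbhs_nbhs.
  apply: (@filter_forall _ _ (fun (i : 'I_n) q =>
    `|'D_(delta_mx 0 i) g q| <= `|'D_(delta_mx 0 i) g p| + 1) (nbhs p) (nbhs_filter p)) => i.
  have [_ [+ _]] := gd (delta_mx 0 i).
  move=> /(_ _ Up) /cvgrPdist_le /(_ 1 ltr01); apply: filterS => q Hq.
  rewrite -lerBlDl; apply: le_trans Hq; rewrite distrC.
  exact: lerB_dist.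
move: key => /nbhs_ballP[r /= r0 Hr].
pose M := \sum_i (`|'D_(delta_mx 0 i) g p| + 1).
have DM q i : ball p r q -> `|'D_(delta_mx 0 i) g q| <= M.
  move=> /Hr[_ /(_ i)] /le_trans; apply.
  by rewrite /M (bigD1 i)//= lerDl sumr_ge0// => j _; rewrite addr_ge0.
have ballc q : ball p r q <-> forall i, `|p 0 i - q 0 i| < r.
  rewrite mx_norm_ball /ball_/=; split => [pq i|pq].
    have := normr_coord_le (p - q) i.
    by rewrite !mxE => /le_lt_trans; apply.
  rewrite /Num.norm/= mx_normrE; apply: bigmax_lt => // -[i j] _ /=.
  by rewrite (ord1 i) !mxE.
exists r, (n%:R * M); split => //.
- by rewrite mulr_ge0// sumr_ge0.
- by move=> q /Hr[].
move=> y z /ballc py /ballc pz.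
pose w (k : nat) : 'rV[R]_n := \row_i (if (i < k)%N then y 0 i else z 0 i).
have w0 : w 0%N = z by apply/rowP => i; rewrite mxE ltn0.
have wn : w n = y by apply/rowP => i; rewrite mxE ltn_ord.
have M0 : 0 <= M by rewrite sumr_ge0.
have step (k : 'I_n) : `|g (w k.+1) - g (w k)| <= M * `|y - z|.
  pose c := y 0 k - z 0 k.
  pose l (t : R^o) := w k + t *: (c *: delta_mx 0 k).
  have wl1 : w k.+1 = l 1.
    apply/rowP => i; rewrite /l !mxE/= ltnS leq_eqVlt mul1r.
    rewrite -[X in X || _]/(i == k) eq_sym; case: eqVneq => [<-|ik] /=.
      by rewrite ltnn mulr1 /c addrC subrK.
    by rewrite mulr0 addr0.
  have wl0 : w k = l 0 by rewrite /l scale0r addr0.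
  have lb t : 0 <= t <= 1 -> ball p r (l t).
    move=> t01; apply/ballc => i; rewrite /l !mxE/=.
    case: (eqVneq i k) => [->|ik]/=; last first.
      by rewrite !mulr0 addr0; case: ifP.
    rewrite ltnn mulr1 /c.
    have := py k; have := pz k; rewrite !ltr_norml => /andP[? ?] /andP[? ?].
    move: t01 => /andP[t0 t1].
    have [->|tn1] := eqVneq t 1; first by apply/andP; split; lra.
    have t1' : 0 < 1 - t by rewrite subr_gt0 lt_neqAle tn1.
    set a := z 0 k in pz *; set b := y 0 k in py *; set x := p 0 k.
    have h1 : 0 < (1 - t) * (r - (x - a)) by rewrite mulr_gt0// subr_gt0.
    have h2 : 0 < (1 - t) * (x - a + r) by rewrite mulr_gt0// -ltrBlDr sub0r.
    have h3 : 0 <= t * (r - (x - b)) by rewrite mulr_ge0// subr_ge0 ltW.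
    have h4 : 0 <= t * (x - b + r) by rewrite mulr_ge0// -lerBlDr sub0r ltW.
    by apply/andP; split; lra.
  have lB : `|g (l 1) - g (l 0)| <= (`|c| * M) * (1 - 0).
    apply: (@mean_value_le _ (g \o l) (fun t => c *: 'D_(delta_mx 0 k) g (l t))) => //.
      move=> t /lb/Hr[Ut _].
      have H : derivable g (l t) (c *: delta_mx 0 k).
        by have [+ _] := gd (c *: delta_mx 0 k); exact.
      have := is_derive_line H.
      suff -> : 'D_(c *: delta_mx 0 k) g (l t) = c *: 'D_(delta_mx 0 k) g (l t) by [].
      apply: derive_val; apply: is_derive_scale_dir; apply: derivableP.
      exact: ((gd (delta_mx 0 k)).1 _ Ut).
    by move=> t /lb bt; rewrite normrZ ler_wpM2l// DM.
  rewrite wl1 wl0; apply: le_trans lB _.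
  rewrite subr0 mulr1 mulrC ler_wpM2l//.
  by have := normr_coord_le (y - z) k; rewrite !mxE.
rewrite -[in leLHS]wn -[in leLHS]w0 -(telescope_sumr (fun k => g (w k)))//.
rewrite big_mkord.
apply: le_trans (ler_norm_sum _ _ _) _.
apply: le_trans (ler_sum _ (fun i _ => step i)) _.
by rewrite -mulrA mulr_natl sumr_const card_ord.
Qed.

(* Only the direction q' enters the difference quotient, up to an error that
   the Lipschitz bound absorbs; no Frechet differentiability is needed. *)
Lemma is_derive_comp_curve n m U (g : 'rV[R]_n -> 'rV[R]_m)
    (q : R^o -> 'rV[R]_n) (t : R^o) v :
  open U -> U (q t) -> Ck 1 U g -> is_derive t (1 : R^o) q v ->
  is_derive t (1 : R^o) (g \o q) ('D_v g (q t)).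
Proof.
move=> oU Uq gC dq.
have [r [L [r0 L0 rU gL]]] := Ck1_lipschitz oU Uq gC.
have [_ gd] := gC; have [/(_ _ Uq)/derivableP/is_derive_epsP Hv _] := gd v.
have /is_derive_epsP Hq := dq.
have qc := is_derive_continuous dq.
apply/is_derive_epsP => e e0.
have e1 : 0 < e / 2 by rewrite divr_gt0.
have e2 : 0 < e / 2 / (L + 1) by rewrite divr_gt0// ltr_wpDl.
have bq : \forall h \near (0:R), ball (q t) r (q (h *: (1:R^o) + t)).
  have sc : (h *: (1:R^o) + t) @[h --> (0:R)] --> t.
    rewrite -[X in _ --> X]add0r; apply: cvgD; last exact: cvg_cst.
    rewrite -[X in _ --> X](scale0r (1:R^o)); apply: cvgZl; exact: cvg_id.
  have := cvg_comp _ _ sc qc; apply; exact: nbhsx_ballx.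
have bv : \forall h \near (0:R), ball (q t) r (h *: v + q t).
  have sc : (h *: v + q t) @[h --> (0:R)] --> q t.
    rewrite -[X in _ --> X]add0r; apply: cvgD; last exact: cvg_cst.
    rewrite -[X in _ --> X](scale0r v); apply: cvgZl; exact: cvg_id.
  apply: sc; exact: nbhsx_ballx.
have {}Hv := Hv _ e1; have {}Hq := Hq _ e2.
near=> h.
have A1 : `|g (h *: v + q t) - g (q t) - h *: 'D_v g (q t)| <= e / 2 * `|h|.
  by near: h; exact: Hv.
have A2 : `|q (h *: 1 + t) - q t - h *: v| <= e / 2 / (L + 1) * `|h|.
  by near: h; exact: Hq.
have A3 : `|g (q (h *: 1 + t)) - g (h *: v + q t)| <=
    L * `|q (h *: 1 + t) - (h *: v + q t)|.
  by apply: gL; near: h; [exact: bq|exact: bv].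
have A4 : L * `|q (h *: 1 + t) - (h *: v + q t)| <= e / 2 * `|h|.
  rewrite opprD addrA addrAC in A2 *.
  have h0 : 0 <= e / 2 * `|h| by rewrite mulr_ge0// ltW.
  apply: (le_trans (ler_wpM2l L0 A2)).
  rewrite (_ : _ * (_ * _) = e / 2 * `|h| * (L / (L + 1))); last by ring.
  rewrite ler_piMr// ler_pdivrMr ?mul1r ?lerDl// ltr_wpDl//.
rewrite /= (_ : _ - _ - _ = (g (q (h *: 1 + t)) - g (h *: v + q t)) +
  (g (h *: v + q t) - g (q t) - h *: 'D_v g (q t))); last first.
  by rewrite !addrA subrK.
apply: (le_trans (ler_normD _ _)).
rewrite [e in _ <= e * _]splitr mulrDl lerD//.
exact: le_trans A3 A4.
Unshelve. all: by end_near. Qed.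

(** [Ck] gives continuity in the point for each fixed direction. The Lipschitz bound on g makes
    ['D_a g y] Lipschitz in a, uniformly for y near p, and the two facts combine. *)
Lemma derive_jointly_continuous n m U (g : 'rV[R]_n -> 'rV[R]_m) T (F : set_system T)
    {FF : Filter F} (q w : T -> 'rV[R]_n) p v :
  open U -> U p -> Ck 1 U g -> q t @[t --> F] --> p -> w t @[t --> F] --> v ->
  'D_(w t) g (q t) @[t --> F] --> 'D_v g p.
Proof.
move=> oU Up gC qp wv.
have [r [L [r0 L0 rU gL]]] := Ck1_lipschitz oU Up gC.
have [_ gd] := gC.
have rearrange (ga gb gy da db : 'rV[R]_m) :
    da - db = (gb - gy - db) + ((ga - gb) - (ga - gy - da)).
  by apply/rowP => i; rewrite !mxE; ring.
have DL y a b : ball p r y -> `|'D_a g y - 'D_b g y| <= L * `|a - b|.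
  move=> py.
  have Uy : U y by exact: rU.
  have /derivableP/is_derive_epsP Ha : derivable g y a by have [+ _] := gd a; exact.
  have /derivableP/is_derive_epsP Hb : derivable g y b by have [+ _] := gd b; exact.
  apply/ler_addgt0Pr => e e0.
  have e1 : 0 < e / 2 by rewrite divr_gt0.
  have bb c : \forall h \near (0:R), ball p r (h *: c + y).
    have sc : (h *: c + y) @[h --> (0:R)] --> y.
      rewrite -[X in _ --> X]add0r; apply: cvgD; last exact: cvg_cst.
      rewrite -[X in _ --> X](scale0r c); apply: cvgZl; exact: cvg_id.
    apply: sc; apply: open_nbhs_nbhs; split => //; exact: ball_open.
  have {}Ha := Ha _ e1; have {}Hb := Hb _ e1.
  have ba := bb a; have {}bb := bb b.
  suff : \forall h \near (0:R)^', `|'D_a g y - 'D_b g y| <= L * `|a - b| + e.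
    by move=> /filter_ex[].
  rewrite near_withinE; near=> h => h0.
  have A1 : `|g (h *: a + y) - g y - h *: 'D_a g y| <= e / 2 * `|h| by exact: (near Ha h).
  have A2 : `|g (h *: b + y) - g y - h *: 'D_b g y| <= e / 2 * `|h| by exact: (near Hb h).
  have A3 : `|g (h *: a + y) - g (h *: b + y)| <= L * `|(h *: a + y) - (h *: b + y)|.
    by apply: gL; [exact: (near ba h)|exact: (near bb h)].
  rewrite -(@ler_pM2l _ `|h|) ?normr_gt0// -normrZ.
  have -> : h *: ('D_a g y - 'D_b g y) =
     (g (h *: b + y) - g y - h *: 'D_b g y) + ((g (h *: a + y) - g (h *: b + y)) -
     (g (h *: a + y) - g y - h *: 'D_a g y)).
    by rewrite scalerBr; exact: rearrange.
  move: A3; rewrite opprD addrACA subrr addr0 -scalerBr normrZ => A3.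
  apply: (le_trans (ler_normD _ _)).
  rewrite (_ : `|h| * _ = e / 2 * `|h| + (L * (`|h| * `|a - b|) + e / 2 * `|h|)); last by field.
  rewrite lerD//; apply: (le_trans (ler_normB _ _)).
  exact: (lerD A3 A1).
apply/cvgrPdist_le => e e0.
have e1 : 0 < e / 2 by rewrite divr_gt0.
have e2 : 0 < e / 2 / (L + 1) by rewrite divr_gt0// ltr_wpDl.
have [_ [+ _]] := gd v => /(_ _ Up) Dc.
have c1 : 'D_v g (q t) @[t --> F] --> 'D_v g p by exact: cvg_comp qp Dc.
move/cvgrPdist_le : c1 => /(_ _ e1) c1.
move/cvgrPdist_le : wv => /(_ _ e2) c2.
have c3 : \forall t \near F, ball p r (q t) by apply: qp; exact: nbhsx_ballx.
near=> t.
have A1 : `|'D_v g p - 'D_v g (q t)| <= e / 2 by near: t.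
have A2 : `|v - w t| <= e / 2 / (L + 1) by near: t.
have A3 : ball p r (q t) by near: t.
rewrite -[X in `|X|](subrKA ('D_v g (q t))).
apply: (le_trans (ler_normD _ _)); rewrite [leRHS]splitr; apply: (lerD A1).
apply: (le_trans (DL _ _ _ A3)).
apply: (le_trans (ler_wpM2l L0 A2)).
rewrite (_ : L * _ = e / 2 * (L / (L + 1))); last by ring.
by rewrite ler_piMr//; [exact: ltW|rewrite ler_pdivrMr ?mul1r ?lerDl// ltr_wpDl].
Unshelve. all: by end_near. Qed.

End Derivatives.

(** * One-sided uniqueness of derivatives and smooth reparametrizations *)

Section Reparametrization.
Context {R : realType}.

Lemma cvg_near T U (F : set_system T) (G : set_system U) (f : T -> U) (P : U -> Prop) :
  f t @[t --> F] --> G -> (\forall y \near G, P y) -> \forall t \near F, P (f t).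
Proof. by move=> h; exact: h. Qed.

Lemma is_derive_comp_real (V : normedModType R) (f : R^o -> V) (psi : R^o -> R^o) u l d :
  is_derive (psi u) (1 : R^o) f l -> is_derive u (1 : R^o) psi d ->
  is_derive u (1 : R^o) (f \o psi) ((d : R) *: l).
Proof.
move=> [df <-] [dp <-].
have Df : differentiable f (psi u) by exact/derivable1_diffP.
have Dp : differentiable psi u by exact/derivable1_diffP.
have Dc : differentiable (f \o psi) u by exact: differentiable_comp.
split; first exact/derivable1_diffP.
rewrite (deriveE _ Dc) (diff_comp Dp Df) /= (deriveE _ Df) (deriveE _ Dp).
by rewrite -linearZ/= /GRing.scale/= mulr1.
Qed.

(** At an endpoint the two functions agree on one side only. The increment h points inside [0, 1],
    to the right if u <= 1/2 and to the left otherwise, and either side determines a two-sided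
    derivative. *)
Lemma is_derive_unique01 (V : normedModType R) (f g : R^o -> V) (u : R) l l' :
  0 <= u <= 1 -> is_derive u (1 : R^o) f l -> is_derive u (1 : R^o) g l' ->
  (\forall t \near u, 0 <= t <= 1 -> f t = g t) -> l = l'.
Proof.
move=> /andP[u0 u1] df dg fg.
have : is_derive u (1 : R^o) (f - g) (l - l') by apply: is_deriveB.
move=> /is_derive_epsP H.
apply/eqP; rewrite -subr_eq0 -normr_le0; apply/ler_addgt0Pr => e e0; rewrite add0r.
have {}H := H _ e0.
have fgu : f u = g u by apply: (nbhs_singleton fg); rewrite u0.
have {}fg : \forall h \near (0:R), 0 <= h + u <= 1 -> f (h + u) = g (h + u).
  have sc : (h + u) @[h --> (0:R)] --> u.
    rewrite -[X in _ --> X]add0r; apply: cvgD; [exact: cvg_id|exact: cvg_cst].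
  exact: sc _ fg.
have [r /= r0 Hr] : nbhs (0:R) [set h : R | 
    (`|(f - g) (h *: (1:R^o) + u) - (f - g) u - h *: (l - l')| <= e * `|h|) /\
    (0 <= h + u <= 1 -> f (h + u) = g (h + u))].
  exact: filterI H fg.
pose k := Num.min (r / 2) (1 / 2).
have k0 : 0 < k by rewrite lt_min !divr_gt0.
have kr : k < r by rewrite gt_min ltr_pdivrMr// mulr_natr mulr2n ltrDl r0.
have k1 : k <= 1 / 2 by rewrite ge_min lexx orbT.
have [h [h0 hr hu]] : exists h, [/\ h != 0, `|h| < r & 0 <= h + u <= 1].
  have [uh|uh] := leP u (1/2).
    by exists k; rewrite (gtr0_norm k0) gt_eqF//; split => //; apply/andP; split; lra.
  exists (- k); rewrite normrN (gtr0_norm k0) oppr_eq0 gt_eqF//.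
  by split => //; apply/andP; split; lra.
have [] := Hr h; first by rewrite /ball_/= sub0r normrN.
rewrite -[h *: 1]/(h * 1) mulr1 => A /(_ hu) B.
move: A; rewrite !fctE B fgu !subrr sub0r normrN normrZ mulrC.
by rewrite ler_pM2r// normr_gt0.
Qed.

(* A quadratic spline: constant outside [0, 1], so that reparametrized curves
   can be concatenated along intervals where both are constant. *)
Definition smoothstep (t : R) : R :=
  2 * Num.max t 0 ^+ 2 - 4 * Num.max (t - 1 / 2) 0 ^+ 2 + 2 * Num.max (t - 1) 0 ^+ 2.

Definition smoothstep' (t : R) : R :=
  4 * Num.max t 0 - 8 * Num.max (t - 1 / 2) 0 + 4 * Num.max (t - 1) 0.

Lemma is_derive_pos_sqr (a t : R) :
  is_derive (t : R^o) (1 : R^o) (fun t : R^o => Num.max (t - a) 0 ^+ 2 : R^o)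
    (2 * Num.max (t - a) 0).
Proof.
apply/is_derive_epsP => e e0; near=> h.
have he : `|h| <= e by near: h; exact: (@nbhs0_le _ R^o e e0).
rewrite -[h *: 1]/(h * 1) mulr1 -[h *: _]/(h * _).
apply: (@le_trans _ _ (`|h| * `|h|)); last by rewrite ler_wpM2r.
rewrite -normrM ger0_norm; last by rewrite -expr2 sqr_ge0.
rewrite ler_norml; apply/andP; split.
  by rewrite /Num.max; case: ifPn; case: ifPn; rewrite -?leNgt => *; nra.
by rewrite /Num.max; case: ifPn; case: ifPn; rewrite -?leNgt => *; nra.
Unshelve. all: by end_near. Qed.

Lemma is_derive_smoothstep (t : R) :
  is_derive (t : R^o) (1 : R^o) (smoothstep : R^o -> R^o) (smoothstep' t).
Proof.
have H0 := is_derive_pos_sqr 0 t.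
have H1 := is_derive_pos_sqr (1/2) t.
have H2 := is_derive_pos_sqr 1 t.
pose F := 2 \*: (fun t : R^o => Num.max (t - 0) 0 ^+ 2 : R^o)
  - 4 \*: (fun t : R^o => Num.max (t - 1/2) 0 ^+ 2 : R^o)
  + 2 \*: (fun t : R^o => Num.max (t - 1) 0 ^+ 2 : R^o).
have <- : F = smoothstep.
  by apply/funext => x; rewrite /F /smoothstep !fctE/= subr0.
have /is_derive_eq : is_derive (t : R^o) (1 : R^o) F
    (2 *: (2 * Num.max (t - 0) 0) - 4 *: (2 * Num.max (t - 1/2) 0)
     + 2 *: (2 * Num.max (t - 1) 0)).
  by apply: is_deriveD.
apply; rewrite /smoothstep' /GRing.scale/= subr0; ring.
Qed.

Lemma smoothstep'_ge0 t : 0 <= smoothstep' t.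
Proof.
by rewrite /smoothstep' /Num.max; case: ifPn; case: ifPn; case: ifPn; rewrite -?leNgt; lra.
Qed.

Lemma smoothstep'_continuous : continuous smoothstep'.
Proof.
move=> t.
have H (a : R) : {for t, continuous (fun t : R => Num.max (t - a) 0)}.
  apply: (@continuous_max _ _ (fun t : R => t - a) (cst 0)).
    by apply: cvgB; [exact: cvg_id|exact: cvg_cst].
  exact: cvg_cst.
rewrite (_ : smoothstep' = fun t => 4 * Num.max (t - 0) 0 - 8 * Num.max (t - 1 / 2) 0
    + 4 * Num.max (t - 1) 0); last by apply/funext => x; rewrite subr0.
by apply: cvgD; [apply: cvgB|]; apply: cvgM; (exact: cvg_cst || exact: H).
Qed.

Lemma smoothstep_le0 t : t <= 0 -> smoothstep t = 0.
Proof.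
move=> t0; rewrite /smoothstep !max_r; [ring|lra..].
Qed.

Lemma smoothstep_ge1 t : 1 <= t -> smoothstep t = 1.
Proof.
move=> t0; rewrite /smoothstep !max_l; [by field|lra..].
Qed.

Lemma smoothstep_itv t : 0 <= smoothstep t <= 1.
Proof.
rewrite /smoothstep /Num.max.
by case: ifPn; case: ifPn; case: ifPn; rewrite -?leNgt => *; apply/andP; split; nra.
Qed.

(* Hides the spline, which unification would otherwise unfold. *)
Lemma smoothstep_exists : exists sigma sigma' : R -> R,
  [/\ forall t : R, is_derive (t : R^o) (1 : R^o) (sigma : R^o -> R^o) (sigma' t),
      continuous sigma' /\ (forall t, 0 <= sigma' t),
      forall t, t <= 0 -> sigma t = 0, forall t, 1 <= t -> sigma t = 1
    & forall t, 0 <= sigma t <= 1].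
Proof.
exists smoothstep, smoothstep'; split.
- exact: is_derive_smoothstep.
- by split; [exact: smoothstep'_continuous|exact: smoothstep'_ge0].
- exact: smoothstep_le0.
- exact: smoothstep_ge1.
- exact: smoothstep_itv.
Qed.

(** Integrating from -1, inside the interval [-1, 2], makes 0 and 1 interior points, so that the
    derivative is two-sided there too. *)
Lemma primitive01 (f : R -> R) : continuous f ->
  exists G : R -> R, (forall x : R, 0 <= x <= 1 -> is_derive (x : R^o) (1 : R^o) (G : R^o -> R^o) (f x)) /\
    G 1 - G 0 = \int[@lebesgue_measure R]_(t in `[0, 1]) f t.
Proof.
move=> cf.
have int a b : (@lebesgue_measure R).-integrable `[a, b] (EFin \o f).
  apply: continuous_compact_integrable; first exact: segment_compact.
  exact: continuous_subspaceT.
pose G x := \int[@lebesgue_measure R]_(t in `[(- 1), x]) f t.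
exists G; split.
  move=> x /andP[x0 x1].
  have [//|||H1 H2] := @continuous_FTC1_closed R f (- 1) x 2 _ (int _ _).
  - lra.
  - lra.
  - exact: cf.
  by apply: DeriveDef; [exact: H1|rewrite -derive1E; exact: H2].
rewrite /G Rintegral_itvB//=; last 2 first.
- by rewrite bnd_simp; lra.
- by rewrite bnd_simp; lra.
rewrite Rintegral_itv_obnd_cbnd//.
by apply: integrableS (int 0 1) => //; exact: subset_itv_oc_cc.
Qed.

End Reparametrization.

(** * Curves, lengths and the Finsler distance *)

Section FinslerNorm.
Context {R : realType} {n : nat} (X : finsler_manifold R n).

Lemma finsler0 (c : chart X) (x : X) : cdom c x -> finsler c x 0 = 0.
Proof.
move=> cx; have := finsler_homo 0 cx (ltr0Sn R 1).
by rewrite scaler0; lra.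
Qed.

Lemma finslerZ (c : chart X) (x : X) (a : R) v : cdom c x -> 0 <= a ->
  finsler c x (a *: v) = a * finsler c x v.
Proof.
move=> cx; rewrite le_eqVlt => /predU1P[<-|a0]; last exact: finsler_homo.
by rewrite scale0r mul0r finsler0.
Qed.

Lemma cdom_nbhs (c : chart X) (x : X) : cdom c x -> nbhs x (cdom c).
Proof. by move=> cx; apply: open_nbhs_nbhs; split => //; exact: cdom_open. Qed.

Lemma finsler_cvg_neq0 (c : chart X) (x : X) (v : 'rV[R]_n) T (F : set_system T) {FF : Filter F}
    (q : T -> X) (w : T -> 'rV[R]_n) : cdom c x -> v != 0 ->
  q t @[t --> F] --> x -> w t @[t --> F] --> v ->
  finsler c (q t) (w t) @[t --> F] --> finsler c x v.
Proof.
move=> cx v0 qx wv.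
have [|U [g [[oU Ug] gC gE]]] := @finsler_smooth R n X c (coord c x, v).
  by split => //=; exists x.
have [gc _] := gC 0%N.
have pc : (coord c (q t), w t) @[t --> F] --> (coord c x, v).
  have c0 : coord c (q t) @[t --> F] --> coord c x.
    by apply: (cvg_comp _ _ qx); exact: coord_continuous.
  exact: cvg_pair c0 wv.
have := cvg_comp _ _ pc (gc _ Ug).
rewrite (gE _ Ug); last by split => //=; exists x.
rewrite /= coordK// => H.
apply: cvg_trans H; apply: near_eq_cvg.
have c1 : \forall t \near F, cdom c (q t) by apply: qx; exact: cdom_nbhs.
have c2 : \forall t \near F, U (coord c (q t), w t).
  by apply: pc; exact: open_nbhs_nbhs.
have c3 : \forall t \near F, w t != 0 by exact: cvgr_neq0 wv v0.
near=> t; rewrite /=.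
have ct : cdom c (q t) by near: t.
rewrite gE/= ?coordK//; first by near: t.
by split; [exists (q t)|near: t].
Unshelve. all: by end_near. Qed.

(** F is positive and continuous on the compact unit sphere, and homogeneity does the rest. The
    near-covering form of compactness is used with pairs (y, k), y near x and k near +oo: k^-1 <= F
    <= k holds near each unit vector, hence on the whole sphere for one neighbourhood of x and one
    k. *)
Lemma finsler_bounds (c : chart X) (x : X) : cdom c x ->
  exists m M : R, [/\ 0 < m, 0 < M & \forall y \near x, cdom c y /\
    forall v, m * `|v| <= finsler c y v <= M * `|v|].
Proof.
move=> cx.
pose S := [set w : 'rV[R]_n | `|w| = 1].
have cS : compact S.
  apply: bounded_closed_compact.
    by exists 1; split => // y y1 w /= ->; exact: ltW.
  rewrite (_ : S = (fun w => `|w|) @^-1` [set 1]); last first.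
    by apply/seteqP; split.
  by apply: closed_comp => [w _|]; [exact: norm_continuous|exact: closed_eq].
move/compact_near_coveringP : cS.
move=> /(_ (X * R)%type (filter_prod (nbhs x) (pinfty_nbhs R))
  (fun p w => p.2^-1 <= finsler c p.1 w <= p.2) _).
move=> H.
have {}H : \forall p \near filter_prod (nbhs x) (pinfty_nbhs R),
    S `<=` (fun w => p.2^-1 <= finsler c p.1 w <= p.2).
  apply: H => w Sw.
  have w0 : w != 0 by rewrite -normr_gt0 Sw.
  have f0 : 0 < finsler c x w.
    rewrite lt_neqAle finsler_ge0// andbT eq_sym.
    by apply/eqP => /(finsler_eq0 cx) /eqP; rewrite (negbTE w0).
  have L : finsler c yw.1 yw.2 @[yw --> filter_prod (nbhs x) (nbhs w)] --> finsler c x w.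
    apply: finsler_cvg_neq0 => //; [exact: cvg_fst|exact: cvg_snd].
  have L1 : \forall yw \near filter_prod (nbhs x) (nbhs w),
      finsler c x w / 2 < finsler c yw.1 yw.2.
    by apply: (cvg_near (P := fun z => _ < z) L); apply: lt_nbhsr; rewrite ltr_pdivrMr// mulr_natr mulr2n ltrDl.
  have L2 : \forall yw \near filter_prod (nbhs x) (nbhs w),
      finsler c yw.1 yw.2 < finsler c x w + 1.
    by apply: (cvg_near (P := fun z => z < _) L); apply: lt_nbhsl; rewrite ltrDl.
  have [[A B] /= [Ax Bw] AB] := filterI L1 L2.
  exists (B, A `*` [set k | finsler c x w + 1 + 2 / finsler c x w < k]) => /=.
    split => //; exists (A, [set k | finsler c x w + 1 + 2 / finsler c x w < k]) => //=.
    by split => //; exists (finsler c x w + 1 + 2 / finsler c x w); rewrite num_real.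
  move=> [w' [y k]] /= [Bw' [Ay kk]].
  have [/= f1 f2] := AB (y, w') (conj Ay Bw').
  have q0 : 0 < 2 / finsler c x w by rewrite divr_gt0.
  have k1 : finsler c x w + 1 < k by lra.
  have k2 : 2 / finsler c x w < k by lra.
  apply/andP; split; last by apply/ltW; exact: lt_trans k1.
  apply/ltW; apply: lt_trans f1.
  rewrite -[finsler c x w / 2]invrK invf_div ltf_pV2 ?posrE//.
  exact: lt_trans k2.
have [[A B] /= [Ax [k0 [_ Bk]]] AB] := H.
pose k := Num.max (k0 + 1) 1.
have k_gt0 : 0 < k by rewrite lt_max ltr01 orbT.
have Bkk : B k by apply: Bk; rewrite lt_max ltrDl ltr01.
exists k^-1, k; split => //; first by rewrite invr_gt0.
apply: filterS2 Ax (cdom_nbhs cx) => y Ay cy; split => // v.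
have [->|v0] := eqVneq v 0; first by rewrite finsler0// normr0 !mulr0 lexx.
have vn : 0 < `|v| by rewrite normr_gt0.
have := AB (y, k) (conj Ay Bkk) (`|v|^-1 *: v).
rewrite /S/= normrZ normfV normr_id mulVf ?gt_eqF// => /(_ erefl).
rewrite finslerZ// ?invr_ge0// => /andP[h1 h2].
rewrite -[finsler c y v](mulVKf (lt0r_neq0 vn)) -!(mulrC `|v|) !ler_pM2l//.
by rewrite h1 h2.
Unshelve. all: by end_near. Qed.

(** Smoothness is given away from the zero section; at a zero vector the upper bound by a multiple
    of the norm squeezes F to 0. *)
Lemma finsler_cvg (c : chart X) (x : X) (v : 'rV[R]_n) T (F : set_system T) {FF : Filter F}
    (q : T -> X) (w : T -> 'rV[R]_n) : cdom c x ->
  q t @[t --> F] --> x -> w t @[t --> F] --> v ->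
  finsler c (q t) (w t) @[t --> F] --> finsler c x v.
Proof.
move=> cx qx wv; have [v0|] := eqVneq v 0; last by move=> ?; exact: finsler_cvg_neq0.
have [m [M [m0 M0 H]]] := finsler_bounds cx.
rewrite v0 finsler0//.
have h : \forall t \near F, 0 <= finsler c (q t) (w t) <= M * `|w t|.
  apply: (@filterS _ F FF _ _ _ (qx _ H)) => t [ct /(_ (w t))/andP[_ ->]].
  by rewrite finsler_ge0.
apply: (squeeze_cvgr h); first exact: cvg_cst.
rewrite -[X in _ --> X](mulr0 M) -[X in _ * X](@normr0 _ 'rV[R]_n) -v0.
by apply: cvgM; [exact: cvg_cst|exact: cvg_norm].
Qed.

End FinslerNorm.

(** * Paths at rest at their ends and additivity of lengths *)

Section Flows.
Context {R : realType} {n : nat} (X : finsler_manifold R n).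

(* G is a primitive of the speed of eta; carrying it along reduces the
   additivity of lengths to algebra. *)
Definition flow_at (eta : R -> X) (G : R -> R) (t : R) : Prop :=
  exists (c : chart X) (v : R -> 'rV[R]_n), \forall u \near t,
    [/\ cdom c (eta u),
        is_derive (u : R^o) (1 : R^o) (coord c \o eta : R^o -> 'rV[R]_n) (v u),
        {for u, continuous v}
      & is_derive (u : R^o) (1 : R^o) (G : R^o -> R^o) (finsler c (eta u) (v u))].

Lemma flow_at_near eta G eta' G' (k : R) t : flow_at eta G t ->
  (\forall u \near t, eta' u = eta u /\ G' u = G u + k) -> flow_at eta' G' t.
Proof.
move=> [c [v H]] E; exists c, v.
apply: filterS2 H (nbhs_interior E) => u [cu du vu Gu] Eu.
have [E1 E2] := nbhs_singleton Eu.
split => //; first by rewrite E1.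
  apply: near_eq_is_derive du.
  by apply: filterS Eu => w [/= -> _].
rewrite E1.
have : is_derive (u : R^o) (1 : R^o) ((G : R^o -> R^o) + cst k) (finsler c (eta u) (v u) + 0).
  by apply: is_deriveD.
rewrite addr0; apply: near_eq_is_derive.
by apply: filterS Eu => w [_ /= ->].
Qed.

(** Time may be slowed down or stopped but not reversed, since F is homogeneous for nonnegative
    factors only. *)
Lemma flow_at_comp eta G (psi dpsi : R -> R) t : flow_at eta G (psi t) ->
  (forall u, is_derive (u : R^o) (1 : R^o) (psi : R^o -> R^o) (dpsi u)) ->
  continuous dpsi -> (forall u, 0 <= dpsi u) -> flow_at (eta \o psi) (G \o psi) t.
Proof.
move=> [c [v H]] dp cp p0.
have pc u : {for u, continuous psi} by apply: is_derive_continuous (dp u).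
exists c, (fun u => dpsi u *: v (psi u)).
have Hp := cvg_near (pc t) H.
apply: filterS Hp => u [cu du vu Gu]; split.
- exact: cu.
- exact: (is_derive_comp_real du (dp u)).
- apply: cvgZ; first exact: cp.
  by apply: continuous_comp; [exact: pc|exact: vu].
- rewrite finslerZ//; exact: (is_derive_comp_real Gu (dp u)).
Qed.

(** A path on the whole line that rests outside [a, b], G being the length already travelled. The
    velocity vanishes at both ends, so two such paths join without a corner. *)
Definition reach (x y : X) (L : R) : Prop := exists (eta : R -> X) (G : R -> R) (a b : R),
  [/\ forall t, flow_at eta G t, a < b,
      forall t, t <= a -> eta t = x /\ G t = 0
    & forall t, b <= t -> eta t = y /\ G t = L].

Lemma flow_derive eta G t : flow_at eta G t ->
  exists2 l, 0 <= l & is_derive (t : R^o) (1 : R^o) (G : R^o -> R^o) l.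
Proof.
move=> [c [v /nbhs_singleton[ct _ _ dG]]].
by exists (finsler c (eta t) (v t)) => //; exact: finsler_ge0.
Qed.

Lemma flow_continuousG eta G : (forall t, flow_at eta G t) -> continuous G.
Proof.
by move=> H t; have [l _ d] := flow_derive (H t); exact: is_derive_continuous d.
Qed.

Lemma flow_nondecreasing eta G : (forall t, flow_at eta G t) ->
  {homo G : s t / s <= t}.
Proof.
move=> H s t st.
pose l u := sval (cid2 (flow_derive (H u))).
have [||u _ E] := @MVT_segment R G l s t st.
- by move=> u _; exact: (svalP (cid2 (flow_derive (H u)))).2.
- by apply: continuous_subspaceT; exact: flow_continuousG H.
rewrite -subr_ge0 E mulr_ge0 ?subr_ge0//.
exact: (svalP (cid2 (flow_derive (H u)))).1.
Qed.

Lemma reach_ge0 x y L : reach x y L -> 0 <= L.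
Proof.
move=> [eta [G [a [b [H ab Ha Hb]]]]].
have := flow_nondecreasing H (ltW ab).
by rewrite (Ha a (lexx _)).2 (Hb b (lexx _)).2.
Qed.

Lemma flow_at_cst (x : X) k t : flow_at (cst x) (cst k) t.
Proof.
have [c cx] := cdom_cover x.
exists c, (cst 0); near=> u; split => //.
- exact: (is_derive_cst (coord c x) (u : R^o) (1 : R^o)).
- exact: cvg_cst.
- rewrite finsler0//; exact: (is_derive_cst (k : R^o) (u : R^o) (1 : R^o)).
Unshelve. all: by end_near. Qed.

Lemma reach_refl x : reach x x 0.
Proof.
exists (cst x), (cst 0), 0, 1; split => //.
by move=> t; exact: flow_at_cst.
Qed.

Lemma reach_trans x y z L M : reach x y L -> reach y z M -> reach x z (L + M).
Proof.
move=> [eta1 [G1 [a1 [b1 [H1 ab1 Ha1 Hb1]]]]] [eta2 [G2 [a2 [b2 [H2 ab2 Ha2 Hb2]]]]].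
(* The second path starts one unit of time after the first has stopped; the formulas switch at b1 +
   1/2, in the middle of the time interval where both rest at y. *)
pose s := b1 + 1 - a2.
exists (fun t => if t <= b1 + 1 / 2 then eta1 t else eta2 (t - s)).
exists (fun t => if t <= b1 + 1 / 2 then G1 t else L + G2 (t - s)).
exists a1, (b2 + s); split.
- move=> t; have [tb|tb] := ltP t (b1 + 1).
    apply: (flow_at_near (k := 0) (H1 t)).
    near=> u.
    have ub : u < b1 + 1 by near: u; exact: lt_nbhsl.
    case: leP => ub2; first by rewrite addr0.
    have [-> ->] := Ha2 (u - s) ltac:(rewrite /s; lra).
    have [-> ->] := Hb1 u ltac:(lra).
    by rewrite addr0.
  apply: (@flow_at_near (eta2 \o (fun u => u - s)) (G2 \o (fun u => u - s)) _ _ L).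
    apply: (@flow_at_comp _ _ _ (cst 1)) => //.
    - move=> u; have -> : cst (1:R) u = 1 - 0 by rewrite subr0.
      by apply: is_deriveB.
    - by move=> ?; exact: cvg_cst.
  near=> u.
  have ub : b1 + 1 / 2 < u by near: u; apply: lt_nbhsr; lra.
  by rewrite leNgt ub /= (addrC L).
- rewrite /s; lra.
- move=> t ta; have -> : t <= b1 + 1 / 2 = true by apply/idP; lra.
  exact: Ha1.
- move=> t ta.
  have -> : t <= b1 + 1 / 2 = false by apply/negbTE; rewrite -ltNge /s in ta *; lra.
  by have [-> ->] := Hb2 (t - s) ltac:(lra).
Unshelve. all: by end_near. Qed.

(** A piece cut out of a path is still moving at its ends. Composition with the spline, which is
    constant outside [0, 1], brings it to rest there. *)
Lemma flow_restrict eta G (a b : R) : (forall t, flow_at eta G t) -> a <= b ->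
  reach (eta a) (eta b) (G b - G a).
Proof.
move=> H ab.
have [smoothstep [smoothstep' [is_derive_smoothstep [smoothstep'_continuous smoothstep'_ge0]
  smoothstep_le0 smoothstep_ge1 smoothstep_itv]]] := @smoothstep_exists R.
pose psi t := a + (b - a) * smoothstep t.
exists (eta \o psi), (fun t => G (psi t) + - G a), 0, 1; split => //.
- move=> t; apply: (@flow_at_near (eta \o psi) (G \o psi) _ _ (- G a)); last exact: filterE.
  apply: (@flow_at_comp _ _ _ (fun t => (b - a) * smoothstep' t)); first exact: H.
  + move=> u; have -> : (b - a) * smoothstep' u = 0 + (b - a) *: smoothstep' u.
      by rewrite add0r.
    apply: is_deriveD; apply: is_deriveZ; exact: is_derive_smoothstep.
  + move=> u; apply: cvgM; [exact: cvg_cst|exact: smoothstep'_continuous].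
  + by move=> u; rewrite mulr_ge0 ?subr_ge0// smoothstep'_ge0.
- by move=> t t0; rewrite /psi /= smoothstep_le0// mulr0 addr0 subrr.
- by move=> t t0; rewrite /psi /= smoothstep_ge1// mulr1 addrC subrK.
Qed.

(** The length travelled is continuous in time, so the intermediate value theorem finds the moment
    at which it equals m. *)
Lemma reach_split x z L m : reach x z L -> 0 <= m <= L ->
  exists2 y, reach x y m & reach y z (L - m).
Proof.
move=> [eta [G [a [b [H ab Ha Hb]]]]] /andP[m0 mL].
have [xa Ga] := Ha a (lexx _); have [zb Gb] := Hb b (lexx _).
have [||t] := @IVT R G a b m (ltW ab).
- by apply: continuous_subspaceT; exact: flow_continuousG H.
- by rewrite Ga Gb ge_min m0 le_max mL orbT.
rewrite in_itv/= => /andP[at_ tb] Gt; exists (eta t).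
  by have := flow_restrict H at_; rewrite Ga Gt subr0 xa.
by have := flow_restrict H tb; rewrite Gb Gt zb.
Qed.

(** The data are meaningful on [0, 1] only, whereas [flow_at] wants two-sided derivatives at all
    times. The spline takes its values in [0, 1], so the composite never looks outside; [clamp]
    extends the speed continuously so that it has a primitive. *)
Lemma reach_of_charts (eta : R -> X) (s : R -> R) :
  (forall t : R, 0 <= t <= 1 -> exists (c : chart X) (g g' : R -> 'rV[R]_n),
     \forall u \near t, [/\ is_derive (u : R^o) (1 : R^o) (g : R^o -> _) (g' u),
       {for u, continuous g'}
     & 0 <= u <= 1 ->
       [/\ cdom c (eta u), coord c (eta u) = g u & s u = finsler c (eta u) (g' u)]]) ->
  {within `[0, 1], continuous s} ->
  reach (eta 0) (eta 1) (\int[@lebesgue_measure R]_(t in `[0, 1]) s t).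
Proof.
move=> H sc.
have [smoothstep [smoothstep' [is_derive_smoothstep [smoothstep'_continuous smoothstep'_ge0]
  smoothstep_le0 smoothstep_ge1 smoothstep_itv]]] := @smoothstep_exists R.
pose clamp (u : R) : R := Num.max 0 (Num.min u 1).
have clamp01 u : 0 <= clamp u <= 1.
  by rewrite /clamp /Num.max /Num.min; case: ifPn; case: ifPn; rewrite -?leNgt; lra.
have clampE u : 0 <= u <= 1 -> clamp u = u.
  by move=> /andP[u0 u1]; rewrite /clamp min_l// max_r.
have cc : continuous clamp.
  move=> u; apply: (@continuous_max R R (cst 0) (fun u => Num.min u 1)).
    exact: cvg_cst.
  by apply: (@continuous_min _ _ id (cst 1)); [exact: cvg_id|exact: cvg_cst].
have [|G [dG GE]] := @primitive01 R (s \o clamp).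
  move=> u; have /subspace_continuousP sc' := sc.
  apply: cvg_comp (sc' (clamp u) _); last by rewrite /= in_itv/= clamp01.
  move=> A HA; have := cvg_near (cc u) HA.
  by apply: filterS => w /= Aw; apply: Aw; rewrite in_itv/= clamp01.
have GI : G 1 - G 0 = \int[@lebesgue_measure R]_(t in `[0, 1]) s t.
  rewrite GE; apply: eq_Rintegral => t; rewrite inE/= in_itv/= => t01.
  by rewrite clampE.
rewrite -GI.
exists (eta \o smoothstep), (fun t => G (smoothstep t) + - G 0), 0, 1; split => //.
- move=> t; apply: (@flow_at_near (eta \o smoothstep) (G \o smoothstep) _ _ (- G 0)); last exact: filterE.
  have [c [g [g' Hg]]] := H _ (smoothstep_itv t).
  exists c, (fun u => smoothstep' u *: g' (smoothstep u)).
  have pc u : {for u, continuous (smoothstep : R -> R)}.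
    by apply: is_derive_continuous (is_derive_smoothstep u).
  have Hp := nbhs_interior (cvg_near (pc t) Hg).
  apply: filterS Hp => u Hu.
  have [d1 c1 /(_ (smoothstep_itv u))[cu gu su]] := nbhs_singleton Hu.
  split; first exact: cu.
  + have := is_derive_comp_real d1 (is_derive_smoothstep u).
    apply: near_eq_is_derive.
    apply: filterS Hu => w [_ _ /(_ (smoothstep_itv w))[_ /= -> _]] //.
  + apply: cvgZ; first exact: smoothstep'_continuous.
    by apply: continuous_comp; [exact: pc|exact: c1].
  + rewrite /= finslerZ ?smoothstep'_ge0// -su.
    have := is_derive_comp_real (dG _ (smoothstep_itv u)) (is_derive_smoothstep u).
    by rewrite /= clampE ?smoothstep_itv.
- by move=> t t0 /=; rewrite smoothstep_le0// subrr.
- by move=> t t0 /=; rewrite smoothstep_ge1.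
Qed.

End Flows.

(** * C^1 curves and resting paths define the same distance *)

Section CurvesAndFlows.
Context {R : realType} {n : nat} (X : finsler_manifold R n).

Lemma curve_near (eta : R -> X) (t : R) (A : set X) : C1_curve eta ->
  0 <= t <= 1 -> nbhs (eta t) A -> \forall u \near t, 0 <= u <= 1 -> A (eta u).
Proof.
move=> [/subspace_continuousP H _] t01 HA.
have := cvg_near (H t ltac:(by rewrite /= in_itv/=)) HA; rewrite near_withinE.
by apply: filterS => u; rewrite /= in_itv.
Qed.

Lemma curve_extension (eta : R -> X) (t : R) (c : chart X) : C1_curve eta ->
  0 <= t <= 1 -> cdom c (eta t) -> exists g : R^o -> 'rV[R]_n,
  \forall u \near t, [/\ is_derive (u : R^o) (1 : R^o) g ('D_1 g u),
    {for u, continuous (fun u : R^o => 'D_1 g u)}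
  & 0 <= u <= 1 -> cdom c (eta u) /\ coord c (eta u) = g u].
Proof.
move=> eC t01 ct.
have [_ /(_ c t (conj t01 ct))[U [g [[oU Ut] [gc gd] gE]]]] := eC.
exists g.
have [gd1 [gd2 _]] := gd (1 : R^o).
have H1 := curve_near eC t01 (cdom_nbhs ct).
have H2 : \forall u \near t, U u by exact: open_nbhs_nbhs.
apply: filterS2 H1 H2 => u cu Uu; split.
- by apply: derivableP; exact: gd1.
- exact: gd2.
- by move=> u01; have cu' := cu u01; split; [exact: cu'|rewrite gE//; split].
Qed.

(** Near u the extension T of the transition map composed with g, and the extension of the curve
    read in [c'], coincide on [0, 1]. Their derivatives at u then agree, even at an endpoint, and
    [finsler_compat] applies to T. *)
Lemma velocity_change_chart (eta : R -> X) (u : R) (c c' : chart X)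
    (g : R^o -> 'rV[R]_n) v v' : C1_curve eta -> 0 <= u <= 1 ->
  cdom c (eta u) -> cdom c' (eta u) -> is_derive (u : R^o) (1 : R^o) g v ->
  (\forall y \near u, 0 <= y <= 1 -> coord c (eta y) = g y) ->
  derivative_on (chart_times eta c') (coord c' \o eta) u 1 v' ->
  finsler c' (eta u) v' = finsler c (eta u) v.
Proof.
move=> eC u01 cu c'u dg gE [U2 [g2 [[oU2 U2u] g2C g2E g2v]]].
have [|U1 [T [[oU1 U1p] TC TE]]] := @transition_smooth _ _ X c c' (coord c (eta u)).
  by exists (eta u).
have gu : coord c (eta u) = g u by exact: (nbhs_singleton gE).
apply: finsler_compat => //.
exists U1, T; split => //.
have U1g : U1 (g u) by rewrite -gu.
have d1 := is_derive_comp_curve oU1 U1g (TC 1%N) dg.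
have d2 : is_derive (u : R^o) (1 : R^o) g2 v'.
  rewrite -g2v; apply: derivableP.
  by have [_ /(_ (1 : R^o))[+ _]] := g2C; apply.
rewrite gu; apply: (is_derive_unique01 u01 d1 d2).
have n1 := curve_near eC u01 (cdom_nbhs cu).
have n2 := curve_near eC u01 (cdom_nbhs c'u).
have n3 : \forall y \near u, U2 y by exact: open_nbhs_nbhs.
have n4 : \forall y \near u, U1 (g y).
  apply: (cvg_near (is_derive_continuous dg)).
  exact: open_nbhs_nbhs.
near=> y => y01.
have cy : cdom c (eta y) by move: y01; near: y.
have c'y : cdom c' (eta y) by move: y01; near: y.
have gy : coord c (eta y) = g y by move: y01; near: y.
have U1y : U1 (g y) by near: y.
rewrite g2E; [|by near: y|by split].
rewrite /= TE//; last by rewrite -gy; exists (eta y).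
by rewrite /= -gy coordK.
Unshelve. all: by end_near. Qed.

(** [speed] may refer to a different chart at each time. Independence of the chart makes s locally
    equal to F of the velocity of one C^1 curve in coordinates, hence continuous, and its primitive
    is the length of a flow. *)
Lemma curve_reach (eta : R -> X) (s : R -> R) : C1_curve eta ->
  (forall t, 0 <= t <= 1 -> speed eta t (s t)) ->
  reach (eta 0) (eta 1) (\int[@lebesgue_measure R]_(t in `[0, 1]) s t).
Proof.
move=> eC es.
have loc (t : R) : 0 <= t <= 1 -> exists (c : chart X) (g : R^o -> 'rV[R]_n),
  \forall u \near t, [/\ is_derive (u : R^o) (1 : R^o) g ('D_1 g u),
    {for u, continuous (fun u : R^o => 'D_1 g u)}
  & 0 <= u <= 1 -> [/\ cdom c (eta u), coord c (eta u) = g u &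
      s u = finsler c (eta u) ('D_1 g u)]].
  move=> t01; have [c ct] := cdom_cover (eta t).
  have [g Hg] := curve_extension eC t01 ct.
  exists c, g; apply: filterS (nbhs_interior Hg) => u Hu.
  have [d1 d2 d3] := nbhs_singleton Hu; split; [exact: d1|exact: d2|].
  move=> u01; have [cu gu] := d3 u01; split; [exact: cu|exact: gu|].
  have [c' [v' [c'u dv' ->]]] := es _ u01.
  apply: (velocity_change_chart eC u01 cu c'u d1 _ dv').
  by apply: filterS Hu => y [_ _ H] /H[].
apply: reach_of_charts.
  move=> t /loc[c [g H]]; exists c, g, (fun u => 'D_1 g u); exact: H.
apply/subspace_continuousP => t; rewrite /= in_itv/= => t01.
have [c [g H]] := loc t t01.
have [d1 d2 /(_ t01)[ct gt st]] := nbhs_singleton H.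
rewrite /from_subspace st.
have [/subspace_continuousP ec _] := eC.
have {}ec : eta u @[u --> within `[0, 1] (nbhs t)] --> eta t.
  by apply: ec; rewrite /= in_itv.
have wc : 'D_1 g u @[u --> within `[0, 1] (nbhs t)] --> 'D_1 g t.
  by apply: cvg_within_filter; exact: d2.
apply: cvg_trans (finsler_cvg ct ec wc).
apply: near_eq_cvg; rewrite near_withinE.
by apply: filterS H => u [_ _ H]; rewrite /= in_itv/= => /H[_ _ ->].
Qed.

Lemma flow_continuous (eta : R -> X) G t : flow_at eta G t -> {for t, continuous eta}.
Proof.
move=> [c [v H]]; have [ct dt _ _] := nbhs_singleton H.
have /subspace_continuousP/(_ (coord c (eta t))) := @coord_inv_continuous _ _ X c.
move=> /(_ _)/= K; have {}K := K ltac:(by exists (eta t)).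
rewrite /from_subspace coordK// in K.
have cc : coord c (eta u) @[u --> t] --> within (coord c @` cdom c) (nbhs (coord c (eta t))).
  move=> A HA; have := cvg_near (is_derive_continuous dt) HA.
  apply: filterS2 H => u [cu _ _ _] /=; apply.
  by exists (eta u).
apply: cvg_trans (cvg_comp _ _ cc K).
apply: near_eq_cvg; apply: filterS H => u [cu _ _ _] /=.
by rewrite coordK.
Qed.

(** [flow_at] provides one chart near each time, while [C1_curve] quantifies over all charts. In
    [c'] the velocity is the derivative of the transition map in the direction v, continuous in time
    by joint continuity in point and direction. *)
Lemma flow_Ck (eta : R -> X) G (c' : chart X) : (forall t, flow_at eta G t) ->
  open [set t | cdom c' (eta t)] /\
  Ck 1 [set t : R^o | cdom c' (eta t)] (coord c' \o eta : R^o -> 'rV[R]_n).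
Proof.
move=> H.
have ec : continuous eta by move=> t; exact: flow_continuous (H t).
have key (u : R) : cdom c' (eta u) -> exists v' : R -> 'rV[R]_n,
    (\forall w \near u, is_derive (w : R^o) (1 : R^o) (coord c' \o eta : R^o -> 'rV[R]_n) (v' w))
    /\ {for u, continuous v'}.
  move=> c'u; have [c [v Hv]] := H u.
  have [cu du vu _] := nbhs_singleton Hv.
  have [|U1 [T [[oU1 U1p] TC TE]]] := @transition_smooth _ _ X c c' (coord c (eta u)).
    by exists (eta u).
  exists (fun w => 'D_(v w) T (coord c (eta w))); split; last first.
    apply: (derive_jointly_continuous (p := coord c (eta u)) oU1 U1p (TC 1%N)) => //.
    exact: is_derive_continuous du.
  have n1 := cvg_near (ec u) (cdom_nbhs cu).
  have n2 := cvg_near (ec u) (cdom_nbhs c'u).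
  have n3 : \forall y \near u, U1 (coord c (eta y)).
    apply: (cvg_near (is_derive_continuous du)); exact: open_nbhs_nbhs.
  have nn : \forall y \near u, [/\ cdom c (eta y), cdom c' (eta y) & U1 (coord c (eta y))].
    by near=> y; split; near: y.
  apply: filterS2 (nbhs_interior nn) Hv => w Hw [cw dw _ _].
  have [_ _ U1w] := nbhs_singleton Hw.
  have d1 := is_derive_comp_curve (q := (coord c \o eta : R^o -> 'rV[R]_n)) oU1 U1w (TC 1%N) dw.
  apply: near_eq_is_derive d1.
  apply: filterS Hw => y [cy c'y U1y] /=.
  rewrite TE//= ?coordK//.
  by exists (eta y).
split.
  apply: open_comp => [t _|]; [exact: ec|exact: cdom_open].
split.
  move=> u /= c'u; have [v' [/nbhs_singleton d _]] := key u c'u.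
  exact: is_derive_continuous d.
move=> h; split.
  move=> u /= c'u; have [v' [/nbhs_singleton d _]] := key u c'u.
  have := is_derive_scale_dir (h : R) d.
  by rewrite /GRing.scale/= mulr1 => -[].
split => // u /= c'u; have [v' [d vc]] := key u c'u.
have e w : is_derive (w : R^o) (1 : R^o) (coord c' \o eta : R^o -> 'rV[R]_n) (v' w) ->
    'D_h (coord c' \o eta : R^o -> 'rV[R]_n) w = (h : R) *: v' w.
  move=> dw; have := is_derive_scale_dir (h : R) dw.
  by rewrite /(_ *: (1 : R^o))/= mulr1 => -[].
rewrite /prop_for /continuous_at (e _ (nbhs_singleton d)).
apply: (@cvg_trans _ ((h : R) *: v' w @[w --> u])).
  by apply: near_eq_cvg; apply: filterS d => w /e ->.
have hh : cst (h : R) x @[x --> (u : R)] --> (h : R) by exact: cvg_cst.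
exact: (cvgZ hh vc).
Unshelve. all: by end_near. Qed.

Lemma reach_curve x y L : reach x y L -> exists (eta : R -> X) (s : R -> R),
    [/\ C1_curve eta, eta 0 = x, eta 1 = y,
        forall t, 0 <= t <= 1 -> speed eta t (s t)
      & L = \int[@lebesgue_measure R]_(t in `[0, 1]) s t].
Proof.
move=> [eta0 [G0 [a [b [H0 ab Ha Hb]]]]].
pose psi t := a + (b - a) * t.
pose eta := eta0 \o psi; pose G := G0 \o psi.
have H t : flow_at eta G t.
  apply: (@flow_at_comp _ _ _ _ _ _ (cst (b - a))).
  - exact: H0.
  - move=> u; have -> : cst (b - a) u = 0 + (b - a) *: (1 : R^o).
      by rewrite add0r /GRing.scale/= mulr1.
    by apply: is_deriveD.
  - by move=> ?; exact: cvg_cst.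
  - by move=> u; rewrite /cst subr_ge0 ltW.
have e0 : eta 0 = x /\ G 0 = 0.
  by rewrite /eta /G /psi/= mulr0 addr0; exact: Ha.
have e1 : eta 1 = y /\ G 1 = L.
  by rewrite /eta /G /psi/= mulr1 addrC subrK; exact: Hb.
pose s (t : R) : R := 'D_(1 : R^o) (G : R^o -> R^o) t.
have eC : C1_curve eta.
  split.
    by apply: continuous_subspaceT => t; exact: flow_continuous (H t).
  move=> c t [t01 ct]; have [oU UC] := flow_Ck c H.
  by exists [set t | cdom c (eta t)], (coord c \o eta); split.
have sc : continuous s.
  move=> t; have [c [v Hv]] := H t.
  have [ct _ vt dt] := nbhs_singleton Hv.
  have E w : is_derive (w : R^o) (1 : R^o) (G : R^o -> R^o) (finsler c (eta w) (v w)) ->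
    s w = finsler c (eta w) (v w) by case.
  rewrite /continuous_at (E _ dt).
  apply: (cvg_trans _ (finsler_cvg ct (flow_continuous (H t)) vt)).
  apply: near_eq_cvg.
  by apply: filterS Hv => w [_ _ _ /E ->].
exists eta, s; split => //; [exact: e0.1|exact: e1.1| |].
  move=> t t01; have [c [v Hv]] := H t.
  have [ct dt _ dG] := nbhs_singleton Hv.
  exists c, (v t); split => //; last by case: dG.
  have [oU UC] := flow_Ck c H.
  by exists [set t | cdom c (eta t)], (coord c \o eta); split => //; case: dt.
have cG : continuous G by exact: flow_continuousG H.
have dG t : derivable (G : R^o -> R^o) t 1.
  by have [l _ []] := flow_derive (H t).
have := @continuous_FTC2 R s G 0 1 ltr01 (continuous_subspaceT sc).
rewrite e0.2 e1.2 sube0 => FTC.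
rewrite /Rintegral FTC//.
- split.
  + by move=> t _; exact: dG.
  + by apply: cvg_at_right_filter; exact: cG.
  + by apply: cvg_at_left_filter; exact: cG.
- by move=> t _; rewrite derive1E.
Qed.

Lemma dist_inf (x y : X) : dist x y = inf [set L | reach x y L].
Proof.
congr inf; apply/seteqP; split => L /=.
  by move=> [eta [s [eC <- <- es ->]]]; exact: curve_reach.
by move=> /reach_curve[eta [s ?]]; exists eta, s.
Qed.

Lemma reach_dist (x y : X) L : reach x y L -> dist x y <= L.
Proof.
move=> H; rewrite dist_inf; apply: ge_inf => //.
by exists 0 => M; exact: reach_ge0.
Qed.

Lemma dist_ge0 (x y : X) : 0 <= dist x y.
Proof.
rewrite dist_inf; have [[L HL]|] := pselect (exists L, reach x y L).
  by apply: lb_le_inf; [exists L|move=> M; exact: reach_ge0].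
move=> H; rewrite (_ : [set L | _] = set0) ?inf0//.
by apply/seteqP; split => // L HL; exfalso; apply: H; exists L.
Qed.

Lemma dist_refl (x : X) : dist x x = 0.
Proof.
apply/eqP; rewrite eq_le dist_ge0 andbT.
exact: reach_dist (reach_refl x).
Qed.

End CurvesAndFlows.

(** * Comparison of lengths with coordinates, up to the boundary *)

Section LocalGeometry.
Context {R : realType} {n : nat} (X : finsler_manifold R n).

Lemma ball_segment (p q q' : 'rV[R]_n) (r t : R) : 0 <= t <= 1 ->
  `|p - q| < r -> `|p - q'| < r -> `|p - (q + t *: (q' - q))| < r.
Proof.
move=> /andP[t0 t1] pq pq'.
have -> : p - (q + t *: (q' - q)) = (1 - t) *: (p - q) + t *: (p - q').
  by apply/rowP => i; rewrite !mxE; ring.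
apply: le_lt_trans (ler_normD _ _) _.
rewrite !normrZ !ger0_norm ?subr_ge0//.
have [->|t0'] := eqVneq t 0; first by rewrite subr0 mul1r mul0r addr0.
have h1 : (1 - t) * `|p - q| <= (1 - t) * r by rewrite ler_wpM2l ?subr_ge0// ltW.
have h2 : t * `|p - q'| < t * r by rewrite ltr_pM2l// lt_neqAle eq_sym t0'.
lra.
Qed.

Lemma reach_segment (c : chart X) (q v : 'rV[R]_n) (M : R) :
  (forall t : R, 0 <= t <= 1 -> (coord c @` cdom c) (q + t *: v)) ->
  (forall t : R, 0 <= t <= 1 ->
     finsler c (coord_inv c (q + t *: v)) v <= M) ->
  exists2 L, reach (coord_inv c q) (coord_inv c (q + v)) L & L <= M.
Proof.
move=> Sq FM.
pose eta (t : R) := coord_inv c (q + t *: v).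
pose s (t : R) := finsler c (eta t) v.
have ceta (t : R) : 0 <= t <= 1 -> cdom c (eta t).
  by move=> /Sq[x cx E]; rewrite /eta -E coordK.
have coeta (t : R) : 0 <= t <= 1 -> coord c (eta t) = q + t *: v.
  by move=> /Sq[x cx E]; rewrite /eta -E coordK.
have lc (t : R) : (q + u *: v) @[u --> t] --> q + t *: v.
  by apply: cvgD; [exact: cvg_cst|apply: cvgZl; exact: cvg_id].
have sc : {within `[0, 1], continuous s}.
  apply/subspace_continuousP => t; rewrite /= in_itv/= => t01.
  apply: (finsler_cvg (ceta t t01)); last exact: cvg_cst.
  have /subspace_continuousP/(_ _ (Sq t t01)) := @coord_inv_continuous _ _ X c.
  apply: cvg_comp => A HA.
  suff : \forall u \near within `[0, 1] (nbhs t), A (q + u *: v) by [].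
  rewrite near_withinE; have := cvg_near (lc t) HA.
  by apply: filterS => u Au; rewrite /= in_itv/= => /Sq /Au.
have := @reach_of_charts R n X eta s _ sc.
have -> : eta 0 = coord_inv c q by rewrite /eta scale0r addr0.
have -> : eta 1 = coord_inv c (q + v) by rewrite /eta scale1r.
move=> H.
eexists; first apply: H.
  move=> t t01; exists c, (fun t => q + t *: v), (cst v).
  near=> u; split; last by move=> u01; split; [exact: ceta|exact: coeta|].
    have -> : cst v u = 0 + (1 : R) *: v by rewrite add0r scale1r.
    apply: is_deriveD; first exact: (is_derive_cst q (u : R^o) (1 : R^o)).
    apply/is_derive_epsP => e e0; near=> h.
    rewrite -[h *: (1 : R^o)]/(h * 1) mulr1 scalerDl addrK scale1r subrr normr0.
    by rewrite mulr_ge0// ltW.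
  exact: cvg_cst.
rewrite -[leRHS]mulr1.
have is1 : (@lebesgue_measure R).-integrable `[0, 1] (EFin \o s).
  apply: continuous_compact_integrable => //; exact: segment_compact.
have ic1 : (@lebesgue_measure R).-integrable `[0, 1] (EFin \o cst M).
  apply: continuous_compact_integrable; first exact: segment_compact.
  by apply: continuous_subspaceT => ?; exact: cvg_cst.
have := @le_Rintegral _ _ _ (@lebesgue_measure R) `[0, 1] s (cst M) _ is1 ic1.
rewrite Rintegral_cst//= lebesgue_measure_itv/= lte_fin ltr01 /= subr0.
apply => // t; rewrite /= in_itv/=; exact: FM.
Unshelve. all: by end_near. Qed.

Lemma inner_bound (e v : 'rV[R]_n) :
  `|(v *m e^T) 0 0| <= (\sum_i `|e 0 i|) * `|v|.
Proof.
rewrite mxE mulr_suml; apply: le_trans (ler_norm_sum _ _ _) _.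
apply: ler_sum => i _; rewrite mxE normrM mulrC ler_wpM2l//.
exact: normr_coord_le.
Qed.

Lemma inner_gt0 (e : 'rV[R]_n) : e != 0 -> 0 < (e *m e^T) 0 0.
Proof.
move=> e0; rewrite mxE; have [i ei] : exists i, e 0 i != 0.
  by apply/existsP; apply: contra_neqT e0; rewrite negb_exists => /forallP H;
    apply/rowP => i; rewrite mxE; apply/eqP; have := H i; rewrite negbK.
rewrite (bigD1 i)//= mxE ltr_pwDl//.
  by rewrite -expr2 lt_neqAle sqr_ge0 andbT eq_sym sqrf_eq0.
by apply: sumr_ge0 => j _; rewrite mxE -expr2 sqr_ge0.
Qed.

Lemma nbhs_ball_rV (p : 'rV[R]_n) A : nbhs p A ->
  exists2 r : R, 0 < r & forall q, `|p - q| < r -> A q.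
Proof. by move=> /nbhs_ballP[r /= r0 H]; exists r => // q pq; apply: H; rewrite mx_norm_ball. Qed.

(* In a chart, move off the boundary along the graph direction, then parallel
   to the chord, then back: the total length is comparable to the chord. *)
Lemma local_reach (c : chart X) (x : X) : cdom c x ->
  exists C : R, 0 < C /\ exists2 V, nbhs x V & forall y z, V y -> V z ->
    [/\ cdom c y, cdom c z &
      exists2 L, reach y z L & L <= C * `|coord c y - coord c z|].
Proof.
move=> cx; have [m [M [m0 M0 HM]]] := finsler_bounds cx.
set p := coord c x; set S := coord c @` cdom c.
have Sp : S p by exists x.
have [r r0 Hr] : exists2 r : R, 0 < r & forall q, `|p - q| < r -> S q ->
    forall v, finsler c (coord_inv c q) v <= M * `|v|.
  have /subspace_continuousP/(_ _ Sp) := @coord_inv_continuous _ _ X c.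
  rewrite /from_subspace coordK// => H.
  have := cvg_near H HM; rewrite near_withinE => /nbhs_ball_rV[r r0 K].
  by exists r => // q pq Sq v; have [_ /(_ v)/andP[]] := K q pq Sq.
have seg q v : (forall t : R, 0 <= t <= 1 -> S (q + t *: v)) ->
    `|p - q| < r -> `|p - (q + v)| < r ->
    exists2 L, reach (coord_inv c q) (coord_inv c (q + v)) L & L <= M * `|v|.
  move=> Sq pq pqv; apply: reach_segment => // t t01; apply: Hr; last exact: Sq.
  have -> : t *: v = t *: (q + v - q) by rewrite addrC addKr.
  exact: ball_segment.
have fin (V : set 'rV[R]_n) C : 0 < C -> nbhs p V ->
    (forall q q', V q -> V q' -> S q -> S q' -> exists2 L,
       reach (coord_inv c q) (coord_inv c q') L & L <= C * `|q - q'|) ->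
    exists C : R, 0 < C /\ exists2 V, nbhs x V & forall y z, V y -> V z ->
    [/\ cdom c y, cdom c z &
      exists2 L, reach y z L & L <= C * `|coord c y - coord c z|].
  move=> C0 pV HV; exists C; split => //.
  exists (cdom c `&` coord c @^-1` V).
    by apply: filterI; [exact: cdom_nbhs|exact: (cvg_near (coord_continuous cx) pV)].
  move=> y z [cy Vy] [cz Vz]; split => //.
  have [] := HV _ _ Vy Vz; [by exists y|by exists z|].
  by move=> L; rewrite !coordK// => HL LC; exists L.
have [U [[oU Up] HU]] := coord_image Sp.
have [rU rU0 HrU] := nbhs_ball_rV (open_nbhs_nbhs (conj oU Up)).
case: HU => [US|[e [f [k [e0 fk fe HS]]]]].
  pose r1 := Num.min r rU.
  have r10 : 0 < r1 by rewrite lt_min r0 rU0.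
  apply: (fin [set q | `|p - q| < r1] M) => //.
    by apply/nbhs_ballP; exists r1 => // q; rewrite mx_norm_ball.
  move=> q q' /= pq pq' Sq Sq'.
  have [|||L] := @seg q (q' - q).
  - move=> t t01; apply: US; apply: HrU.
    have : `|p - (q + t *: (q' - q))| < r1 by exact: ball_segment.
    by rewrite lt_min => /andP[].
  - by move: pq; rewrite lt_min => /andP[].
  - by rewrite subrKC; move: pq'; rewrite lt_min => /andP[].
  rewrite subrKC => HL LM.
  by exists L => //; rewrite distrC.
pose ip (v : 'rV[R]_n) := (v *m e^T) 0 0.
have ipD u v : ip (u + v) = ip u + ip v by rewrite /ip mulmxDl mxE.
have ipZ a v : ip (a *: v) = a * ip v by rewrite /ip -scalemxAl mxE.
have ip0 : 0 < ip e by exact: inner_gt0.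
(* Along the chord the graph function f varies by at most |k| |y - z| and the inner product with e
   by at most (sum of the |e_i|) |y - z|. A lift by h e with h <e, e> = K |y - z| makes up for
   both. *)
pose K := `|k| + \sum_i `|e 0 i| + 1.
have K0 : 0 < K by rewrite ltr_wpDl// addr_ge0// sumr_ge0.
have en0 : 0 < `|e| by rewrite normr_gt0.
pose B := K / ip e * `|e|.
have B0 : 0 < B by rewrite mulr_gt0// divr_gt0.
(* The lift has norm at most B |y - z| < 2 B r1, so the whole detour stays within r1 (1 + 2 B) =
   min(r, rU) / 2 of p. *)
pose r1 := Num.min r rU / (2 * (1 + 2 * B)).
have r10 : 0 < r1 by rewrite divr_gt0 ?lt_min ?r0// mulr_gt0// addr_gt0// mulr_gt0.
have r1E : r1 * (1 + 2 * B) = Num.min r rU / 2.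
  by rewrite /r1; field; rewrite lt0r_neq0// addr_gt0// mulr_gt0.
apply: (fin [set q | `|p - q| < r1] (M * (1 + 2 * B))).
- by rewrite mulr_gt0// addr_gt0// mulr_gt0.
- by apply/nbhs_ballP; exists r1 => // q; rewrite mx_norm_ball.
move=> y z /= py pz Sy Sz.
have dyz : `|y - z| < 2 * r1.
  rewrite -(subrKA p y) addrC; apply: le_lt_trans (ler_normD _ _) _.
  by rewrite (distrC y); lra.
pose h := K / ip e * `|y - z|.
have h0 : 0 <= h by rewrite mulr_ge0// ltW// divr_gt0.
have he t : 0 <= t <= 1 -> `|(t * h) *: e| <= B * `|y - z|.
  move=> /andP[t0 t1]; rewrite normrZ (ger0_norm (mulr_ge0 t0 h0)).
  have -> : B * `|y - z| = h * `|e| by rewrite /B /h; ring.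
  by rewrite ler_wpM2r// ler_piMl.
have inball w u : `|p - w| < r1 -> `|u| <= B * `|y - z| -> `|p - (w + u)| < r /\ `|p - (w + u)| < rU.
  move=> pw ub.
  have : `|p - (w + u)| < Num.min r rU.
    rewrite opprD addrA; apply: le_lt_trans (ler_normB _ _) _.
    have : B * `|y - z| <= B * (2 * r1) by rewrite ler_wpM2l// ltW.
    have mm : 0 < Num.min r rU by rewrite lt_min r0.
    move: r1E; set A := Num.min r rU in mm *; nra.
  by rewrite lt_min => /andP[].
have hK : h * ip e = K * `|y - z| by rewrite /h; field; rewrite lt0r_neq0.
have up w t : S w -> `|p - w| < r1 -> 0 <= t <= 1 -> S (w + (t * h) *: e).
  move=> Sw pw t01; have /andP[t0 t1] := t01.
  have [_ pU] := inball _ _ pw (he _ t01).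
  have pw0 : U w.
    by apply: HrU; have [_] := inball w 0 pw ltac:(by rewrite normr0 mulr_ge0// ltW); rewrite addr0.
  apply/(HS _ (HrU _ pU)); rewrite fe.
  have /(HS _ pw0) fw := Sw.
  apply: (le_trans fw); rewrite -/(ip w) -/(ip _) ipD ipZ lerDl.
  by apply: mulr_ge0; [exact: mulr_ge0|exact: ltW].
have hin w : `|p - w| < r1 -> `|p - (w + h *: e)| < r.
  move=> pw; have := he 1 ltac:(by rewrite ler01 lexx).
  by rewrite mul1r => /(inball _ _ pw)[].
have inr w : `|p - w| < r1 -> `|p - w| < r.
  by move=> pw; have [+ _] := inball w 0 pw ltac:(by rewrite normr0 mulr_ge0// ltW); rewrite addr0.
have hle : `|h *: e| <= B * `|y - z|.
  by have := he 1 ltac:(by rewrite ler01 lexx); rewrite mul1r.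
have [|||L1 R1 E1] := @seg y (h *: e).
- by move=> t t01; rewrite scalerA; exact: up.
- exact: inr.
- exact: hin.
have [|||L2 R2 E2] := @seg (y + h *: e) (z - y).
- move=> t t01; have /andP[t0 t1] := t01.
  have pw : `|p - (y + t *: (z - y))| < r1 by exact: ball_segment.
  rewrite addrAC.
  have [_ pU] := inball _ _ pw hle.
  apply/(HS _ (HrU _ pU)); rewrite fe -/(ip _) !ipD !ipZ hK.
  have Uy : U y by apply: HrU; have [_] := inball y 0 py ltac:(by rewrite normr0 mulr_ge0// ltW); rewrite addr0.
  have /(HS _ Uy) fy := Sy; rewrite -/(ip y) in fy.
  have A1 : f (y + t *: (z - y)) - f y <= `|k| * `|y - z|.
    apply: le_trans (ler_norm _) _; apply: le_trans (fk _ _) _.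
    rewrite addrC addKr normrZ ger0_norm// distrC mulrA.
    apply: ler_wpM2r => //; rewrite mulrC.
    apply: (@le_trans _ _ (t * `|k|)); first by rewrite ler_wpM2l// ler_norm.
    by rewrite ler_piMl.
  have A2 : `|ip (z - y)| <= (\sum_i `|e 0 i|) * `|y - z|.
    by rewrite (distrC y); exact: inner_bound.
  have A3 : `|t * ip (z - y)| <= (\sum_i `|e 0 i|) * `|y - z|.
    by apply: le_trans A2; rewrite normrM ger0_norm// ler_piMl.
  move: A3; rewrite ler_norml => /andP[A3 _].
  have n0 : 0 <= `|y - z| by [].
  have -> : K * `|y - z| = `|k| * `|y - z| + (\sum_i `|e 0 i|) * `|y - z| + `|y - z|.
    by rewrite /K; ring.
  lra.
- exact: hin.
- by rewrite addrAC subrKC; exact: hin.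
have [|||L3 R3 E3] := @seg (z + h *: e) (- (h *: e)).
- move=> t t01; have /andP[t0 t1] := t01.
  have -> : z + h *: e + t *: - (h *: e) = z + ((1 - t) * h) *: e.
    by rewrite -addrA scalerN mulrBl mul1r scalerBl scalerA.
  apply: up => //; apply/andP; split; lra.
- exact: hin.
- by rewrite addrK; exact: inr.
exists (L1 + (L2 + L3)).
  apply: reach_trans R1 _; apply: (@reach_trans _ _ _ _ (coord_inv c (z + h *: e))).
    by move: R2; rewrite addrAC subrKC.
  by move: R3; rewrite addrK.
have F1 : M * `|h *: e| <= M * (B * `|y - z|) by rewrite ler_wpM2l// ltW.
move: E2 E3; rewrite normrN (distrC z) => E2 E3; lra.
Qed.

End LocalGeometry.

(** * The topology of the distance *)

Section DistanceTopology.
Context {R : realType} {n : nat} (X : finsler_manifold R n).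
Implicit Types x y z : X.

Lemma lipschitz_continuous_rV (f : 'rV[R]_n -> R) (k : R) :
  (forall p q, `|f p - f q| <= k * `|p - q|) -> continuous f.
Proof.
move=> fk q A /nbhs_ballP[e /= e0 He]; apply/nbhs_ballP.
have k1 : 0 < `|k| + 1 by rewrite ltr_wpDl.
exists (e / (`|k| + 1)); first by rewrite /= divr_gt0.
move=> q'; rewrite mx_norm_ball /ball_/= ltr_pdivlMr// => qq'.
apply: He; rewrite /ball/=; apply: le_lt_trans (fk _ _) (le_lt_trans _ qq').
by rewrite mulrC ler_wpM2l//; have := ler_norm k; lra.
Qed.

Lemma norm_sub_continuous (p : 'rV[R]_n) : continuous (fun q : 'rV[R]_n => `|p - q|).
Proof.
apply: (@lipschitz_continuous_rV _ 1) => y z; rewrite mul1r.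
apply: le_trans (ler_dist_dist _ _) _.
by rewrite opprB addrC addrA subrK distrC.
Qed.

(** The set reached from x is open because neighbours can be reached from its points, and closed
    because its points can be reached from neighbours: the asymmetry makes both directions of the
    local comparison necessary. *)
Lemma reach_total x y : exists L, reach x y L.
Proof.
suff E : [set y | exists L, reach x y L] = [set: X].
  by have : [set: X] y by []; rewrite -E.
have near_reach z : exists2 V, nbhs z V & forall w, V w ->
    (exists L, reach z w L) /\ exists L, reach w z L.
  have [c cz] := cdom_cover z.
  have [C [_ [V Vz HV]]] := local_reach cz.
  exists V => // w Vw; split.
    by have [_ _ [L ? _]] := HV z w (nbhs_singleton Vz) Vw; exists L.
  by have [_ _ [L ? _]] := HV w z Vw (nbhs_singleton Vz); exists L.
apply: (@manifold_connected _ _ X).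
- by exists x; exists 0; exact: reach_refl.
- exists [set y | exists L, reach x y L]; last by rewrite setTI.
  rewrite openE => z [L Lz]; have [V Vz HV] := near_reach z.
  apply: filterS Vz => w /HV[[M Mw] _]; exists (L + M); exact: reach_trans Lz Mw.
- exists [set y | exists L, reach x y L]; last by rewrite setTI.
  rewrite -openC openE => z nz; have [V Vz HV] := near_reach z.
  apply: filterS Vz => w /HV[_ [M Mw]] [L Lw]; apply: nz.
  exists (L + M); exact: reach_trans Lw Mw.
Qed.

Lemma dist_reach x y (r : R) : dist x y < r -> exists2 L, reach x y L & L < r.
Proof.
rewrite dist_inf => /inf_lt[|L HL Lr]; last by exists L.
by have [L HL] := reach_total x y; exists L.
Qed.

Lemma dist_triangle x y z : dist x z <= dist x y + dist y z.
Proof.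
apply/ler_addgt0Pr => e e0.
have [|L HL Le] := @dist_reach x y (dist x y + e / 2).
  by rewrite ltrDl divr_gt0.
have [|M HM Me] := @dist_reach y z (dist y z + e / 2).
  by rewrite ltrDl divr_gt0.
have := reach_dist (reach_trans HL HM); lra.
Qed.

(** A path of length L < a + b is cut at the fraction a / (a + b) of its length. Strict inequalities
    leave room for the absence of minimizing curves. *)
Lemma dist_split x z (a b : R) : 0 < a -> 0 < b -> dist x z < a + b ->
  exists2 y, dist x y < a & dist y z < b.
Proof.
move=> a0 b0 /dist_reach[L HL Lab].
have L0 := reach_ge0 HL.
have ab0 : 0 < a + b by rewrite addr_gt0.
have q1 : L / (a + b) < 1 by rewrite ltr_pdivrMr// mul1r.
have q0 : 0 <= L / (a + b) by rewrite divr_ge0// ltW.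
have E : L / (a + b) * a + L / (a + b) * b = L by field; rewrite lt0r_neq0.
have [|y Hy Hz] := reach_split (m := L / (a + b) * a) HL.
  apply/andP; split; first by rewrite mulr_ge0// ltW.
  by rewrite -[leRHS]E lerDl mulr_ge0// ltW.
exists y.
  by apply: le_lt_trans (reach_dist Hy) _; rewrite gtr_pMl.
apply: le_lt_trans (reach_dist Hz) _.
by rewrite -[X in X - _]E addrC addKr gtr_pMl.
Qed.

Lemma nbhs_dist_small x (r : R) : 0 < r ->
  \forall y \near x, dist x y < r /\ dist y x < r.
Proof.
move=> r0; have [c cx] := cdom_cover x.
have [C [C0 [V Vx HV]]] := local_reach cx.
have H1 : \forall y \near x, `|coord c x - coord c y| < r / C.
  have := coord_continuous cx => /cvgrPdist_lt; apply.
  by rewrite divr_gt0.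
have xV := nbhs_singleton Vx.
apply: filterS2 Vx H1 => y Vy; rewrite ltr_pdivlMr// mulrC => yr.
have [_ _ [L HL LC]] := HV x y xV Vy; have [_ _ [M HM MC]] := HV y x Vy xV.
split; first exact: le_lt_trans (reach_dist HL) (le_lt_trans LC yr).
by apply: le_lt_trans (reach_dist HM) (le_lt_trans MC _); rewrite distrC.
Unshelve. all: by end_near. Qed.

Lemma nbhs_fball x r : 0 < r -> nbhs x (fball x r).
Proof. by move=> /(nbhs_dist_small x); apply: filterS => y []. Qed.

Lemma nbhs_bball x r : 0 < r -> nbhs x (bball x r).
Proof. by move=> /(nbhs_dist_small x); apply: filterS => y []. Qed.

Lemma open_fball x r : open (fball x r).
Proof.
rewrite openE => y; rewrite /fball/= => xy.
have : 0 < r - dist x y by rewrite subr_gt0.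
move=> /(nbhs_fball y); apply: filterS => z; rewrite /fball/= => yz.
by have := dist_triangle x y z; lra.
Qed.

Lemma open_bball x r : open (bball x r).
Proof.
rewrite openE => y; rewrite /bball/= => xy.
have : 0 < r - dist y x by rewrite subr_gt0.
move=> /(nbhs_bball y); apply: filterS => z; rewrite /bball/= => yz.
by have := dist_triangle z y x; lra.
Qed.

Lemma dist_continuous : continuous (fun xy : X * X => dist xy.1 xy.2).
Proof.
move=> [x y] /=; apply/cvgrPdist_lt => e e0.
have e2 : 0 < e / 2 by rewrite divr_gt0.
exists ([set x' | dist x x' < e / 2 /\ dist x' x < e / 2],
        [set y' | dist y y' < e / 2 /\ dist y' y < e / 2]).
  by split => /=; exact: nbhs_dist_small.
move=> [x' y'] /= [[h1 h2] [h3 h4]]; rewrite /= ltr_norml.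
have t1 := dist_triangle x x' y; have t2 := dist_triangle x' y' y.
have t3 := dist_triangle x' x y'; have t4 := dist_triangle x y y'.
by apply/andP; split; lra.
Qed.

Lemma flow_chart (eta : R -> X) (G : R -> R) (t : R) (c' : chart X) :
  flow_at eta G t -> cdom c' (eta t) -> exists v' : 'rV[R]_n,
    is_derive (t : R^o) (1 : R^o) (coord c' \o eta : R^o -> 'rV[R]_n) v' /\
    is_derive (t : R^o) (1 : R^o) (G : R^o -> R^o) (finsler c' (eta t) v').
Proof.
move=> Ht c't; have [c [v Hv]] := Ht.
have [ct dt _ dG] := nbhs_singleton Hv.
have [|U1 [T [[oU1 U1p] TC TE]]] := @transition_smooth _ _ X c c' (coord c (eta t)).
  by exists (eta t).
exists ('D_(v t) T (coord c (eta t))); split.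
  have n2 := cvg_near (flow_continuous Ht) (cdom_nbhs c't).
  have n3 : \forall y \near t, U1 (coord c (eta y)).
    apply: (cvg_near (is_derive_continuous dt)); exact: open_nbhs_nbhs.
  have d1 := is_derive_comp_curve (q := (coord c \o eta : R^o -> 'rV[R]_n)) oU1 U1p (TC 1%N) dt.
  apply: near_eq_is_derive d1.
  apply: filterS3 Hv n2 n3 => y [cy _ _ _] c'y U1y /=.
  by rewrite TE//= ?coordK//; exists (eta y).
rewrite (@finsler_compat _ _ X c c' (eta t) (v t))//.
by exists U1, T; split.
Qed.

(** The image of a chart need not be closed, but near p it is everything or a region f <= <., e>
    with f Lipschitz, so it meets small closed balls in compact sets, which [coord_inv] carries back
    to X. *)
Lemma local_chart_ball (c : chart X) x : cdom c x -> exists2 r0 : R, 0 < r0 &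
  forall r, r <= r0 -> compact [set y | cdom c y /\ `|coord c x - coord c y| <= r].
Proof.
move=> cx; set p := coord c x; set S := coord c @` cdom c.
have Sp : S p by exists x.
suff [r0 r00 H] : exists2 r0 : R, 0 < r0 & forall r, r <= r0 ->
    closed (S `&` [set q | `|p - q| <= r]).
  exists r0 => // r rr0.
  have -> : [set y | cdom c y /\ `|p - coord c y| <= r] =
      coord_inv c @` (S `&` [set q | `|p - q| <= r]).
    apply/seteqP; split => [y [cy yr]|_ [_ [[y cy <-] yr] <-]] /=.
      by exists (coord c y); [split => //; exists y|rewrite coordK].
    by rewrite coordK.
  apply: continuous_compact.
    apply: continuous_subspaceW (@coord_inv_continuous _ _ X c).
    by move=> q [].
  apply: bounded_closed_compact; last exact: H.
  exists (`|p| + r); split; first exact: num_real.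
  move=> M Mr q [_ /= pq].
  rewrite -(subKr p q); apply: le_trans (ler_normB _ _) _; lra.
have clb r : closed [set q : 'rV[R]_n | `|p - q| <= r].
  rewrite (_ : [set q | _] = (fun q => `|p - q|) @^-1` [set z | z <= r])//.
  apply: closed_comp => [q _|]; last exact: closed_le.
  exact: norm_sub_continuous.
have [U [[oU Up] HU]] := coord_image Sp.
have [rU rU0 HrU] := nbhs_ball_rV (open_nbhs_nbhs (conj oU Up)).
exists (rU / 2); first by rewrite divr_gt0.
move=> r rr0.
have inU q : `|p - q| <= r -> U q by move=> pq; apply: HrU; lra.
case: HU => [US|[e [f [k [e0 fk fe HS]]]]].
  rewrite (_ : _ `&` _ = [set q | `|p - q| <= r]); first exact: clb.
  by apply/seteqP; split => [q []|q pq] //; split => //; apply: US; exact: inU.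
have gc : continuous (fun q : 'rV[R]_n => (q *m e^T) 0 0 - f q).
  apply: (@lipschitz_continuous_rV _ (\sum_i `|e 0 i| + k)) => u v.
  rewrite mulrDl; apply: le_trans (lerD (inner_bound e (u - v)) (fk u v)).
  rewrite mulmxBl !mxE; apply: le_trans (ler_normB _ _).
  by rewrite le_eqVlt; apply/orP; left; apply/eqP; congr (`|_|); ring.
rewrite (_ : _ `&` _ = [set q | `|p - q| <= r] `&`
    (fun q => (q *m e^T) 0 0 - f q) @^-1` [set z | 0 <= z]).
  apply: closedI; first exact: clb.
  apply: closed_comp => [q _|]; last exact: closed_ge.
  exact: gc.
apply/seteqP; split => q /= [h1 h2].
  by split => //; rewrite subr_ge0; apply/HS => //; exact: inU.
by split => //; apply/HS; [exact: inU|rewrite -subr_ge0].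
Qed.

(** For the sup norm it suffices to treat one coordinate with either sign: that coordinate minus G /
    m is nonincreasing, since its derivative is at most |v| - F(v) / m <= 0. *)
Lemma flow_coord_le (c : chart X) (m a u : R) (eta : R -> X) (G : R -> R) : 0 < m ->
  (forall t, flow_at eta G t) -> a <= u ->
  (forall w, a <= w <= u -> cdom c (eta w) /\
     forall v, m * `|v| <= finsler c (eta w) v) ->
  `|coord c (eta a) - coord c (eta u)| <= (G u - G a) / m.
Proof.
move=> m0 H au Hc.
apply: normr_rV_le.
  apply: divr_ge0; last exact: ltW.
  by rewrite subr_ge0; exact: flow_nondecreasing H _ _ au.
move=> i.
have dd (w : R) : a <= w <= u -> exists l : R * R, 
    [/\ is_derive (w : R^o) (1 : R^o) ((fun s => coord c (eta s) 0 i) : R^o -> R^o) l.1,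
       is_derive (w : R^o) (1 : R^o) (G : R^o -> R^o) l.2 & `|l.1| <= l.2 / m].
  move=> /andP[aw wu].
  have [cw mw] := Hc w ltac:(by rewrite aw).
  have [v' [d1 d2]] := flow_chart (H w) cw.
  exists (v' 0 i, finsler c (eta w) v') => /=; split.
  - exact: (is_derive_coord i d1).
  - exact: d2.
  - rewrite ler_pdivlMr// mulrC.
    by apply: le_trans (mw v'); apply: ler_wpM2l; [exact: ltW|exact: normr_coord_le].
have mono (s : R) : `|s| = 1 ->
    s * (coord c (eta u) 0 i) - G u / m <= s * (coord c (eta a) 0 i) - G a / m.
  move=> s1.
  pose psi := s \*: (fun s => coord c (eta s) 0 i : R^o) - m^-1 \*: (G : R -> R^o) : R^o -> R^o.
  have psiE w : psi w = s * (coord c (eta w) 0 i) - G w / m.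
    by rewrite [G w / m]mulrC.
  have /choice[l Hl] : forall w : R, exists l : R * R, a <= w <= u ->
    [/\ is_derive (w : R^o) (1 : R^o) ((fun s => coord c (eta s) 0 i) : R^o -> R^o) l.1,
       is_derive (w : R^o) (1 : R^o) (G : R^o -> R^o) l.2 & `|l.1| <= l.2 / m].
    move=> w; have [/dd[l Hl]|nw] := pselect (a <= w <= u); first by exists l.
    by exists (0, 0) => /nw.
  have dpsi (w : R) : a <= w <= u -> is_derive (w : R^o) (1 : R^o) psi (s *: (l w).1 - m^-1 *: (l w).2).
    move=> /Hl[d1 d2 _]; exact: is_deriveB.
  rewrite -!psiE -subr_le0.
  have [||w] := @MVT_segment R psi (fun w => s *: ((l w).1 : R^o) - m^-1 *: ((l w).2 : R^o)) a u au.
  - by move=> w; rewrite in_itv/= => /andP[aw wu]; apply: dpsi; rewrite !ltW.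
  - apply: derivable_within_continuous => w; rewrite in_itv/= => aw.
    by have [] := dpsi w aw.
  rewrite in_itv/= => /Hl[_ _ lm] ->.
  rewrite mulr_le0_ge0 ?subr_ge0// subr_le0.
  apply: (@le_trans _ _ `|s * (l w).1|); first exact: ler_norm.
  by rewrite normrM s1 mul1r; apply: le_trans lm _; rewrite [_ / m]mulrC.
have := mono 1 (normr1 _); have := mono (-1) (normrN1 _).
rewrite !mxE mulrBl ler_norml => *; apply/andP; split; lra.
Qed.

(** A path from x of length L < m rho cannot leave the chart ball W of radius rho: as long as it
    stays in W, the lower bound on F confines it to the smaller closed set [W'] of radius L / m. *)
Lemma fball_nbhs_base x A : nbhs x A -> exists2 r : R, 0 < r & fball x r `<=` A.
Proof.
move=> xA; have [c cx] := cdom_cover x.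
have [m [M [m0 M0 HM]]] := finsler_bounds cx.
have [r0 r00 Hc] := local_chart_ball cx.
set p := coord c x in Hc *.
have [r1 r10 H1] : exists2 r1 : R, 0 < r1 & forall y, cdom c y ->
    `|p - coord c y| < r1 -> A y /\ forall v, m * `|v| <= finsler c y v.
  have /subspace_continuousP/(_ p) := @coord_inv_continuous _ _ X c.
  move=> /(_ _)/= K; have {}K := K ltac:(by exists x).
  rewrite /from_subspace coordK// in K.
  have HA : \forall y \near x, A y /\ cdom c y /\
      forall v, m * `|v| <= finsler c y v <= M * `|v| by exact: filterI.
  have := cvg_near K HA; rewrite near_withinE => Kn.
  have [r rp Hr] := nbhs_ball_rV Kn.
  exists r => // y cy py.
  have : A (coord_inv c (coord c y)) /\ cdom c (coord_inv c (coord c y)) /\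
      forall v, m * `|v| <= finsler c (coord_inv c (coord c y)) v <= M * `|v|.
    by apply: Hr; [exact: py|exists y].
  by rewrite coordK// => -[h1 [_ h2]]; split => // v; have /andP[] := h2 v.
pose rho := Num.min r0 r1.
have rho0 : 0 < rho by rewrite lt_min r00.
exists (m * rho); first exact: mulr_gt0.
move=> y; rewrite /fball/= => /dist_reach[L HL Lr].
have [eta [G [a [b [H ab Ha Hb]]]]] := HL.
pose rho' := L / m.
have rho'E : rho' < rho by rewrite ltr_pdivrMr// mulrC.
have L0 := reach_ge0 HL.
have rho'0 : 0 <= rho' by rewrite divr_ge0// ltW.
pose W' := [set z | cdom c z /\ `|p - coord c z| <= rho'].
have W'cl : closed W'.
  apply: compact_closed; first exact: manifold_hausdorff.
  apply: Hc; apply: (le_trans (ltW rho'E)); by rewrite ge_min lexx.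
pose W := [set z | cdom c z /\ `|p - coord c z| < rho].
have ec : continuous eta by move=> t; exact: flow_continuous (H t).
have W'W z : W' z -> \forall u \near z, W u.
  move=> [cz pz].
  have h1 : \forall u \near coord c z, `|p - u| < rho.
    apply: (cvg_near (@norm_sub_continuous p (coord c z)) (P := fun w => w < rho)); apply: lt_nbhsl.
    exact: le_lt_trans rho'E.
  by apply: filterS2 (cdom_nbhs cz) (cvg_near (coord_continuous cz) h1) => u.
have W'A z : W z -> A z.
  move=> [cz pz].
  have pz1 : `|p - coord c z| < r1 by apply: lt_le_trans pz _; rewrite ge_min lexx orbT.
  by have [] := H1 z cz pz1.
have xa : eta a = x by have [] := Ha a (lexx _).
have key (t : R) : a <= t -> (forall u, a <= u < t -> W (eta u)) ->
    forall u, a <= u < t -> W' (eta u).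
  move=> at_ HW u /andP[au ut].
  have [cu _] := HW u ltac:(by rewrite au).
  split => //.
  have Gu : G u - G a <= L.
    rewrite (Ha a (lexx _)).2 subr0.
    have [ub|/ltW bu] := leP u b; last by rewrite (Hb u bu).2.
    by rewrite -(Hb b (lexx _)).2; exact: flow_nondecreasing H _ _ ub.
  apply: (@le_trans _ _ ((G u - G a) / m)); last by rewrite ler_wpM2r// invr_ge0 ltW.
  rewrite /p -xa; apply: (flow_coord_le m0 H au) => w /andP[aw wu].
  have [cw pw] : W (eta w) by apply: HW; rewrite aw (le_lt_trans wu).
  split => //; have [] := H1 _ cw _ => //.
  by apply: lt_le_trans pw _; rewrite ge_min lexx orbT.
have [T|nT] := pselect (forall t, a <= t <= b -> W' (eta t)).
  apply: W'A; have [cy py] := T b ltac:(by rewrite (ltW ab) lexx).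
  by move: cy py; rewrite (Hb b (lexx _)).1 => cy py; split => //; exact: le_lt_trans rho'E.
exfalso; pose B := [set t | a <= t /\ ~ W' (eta t)].
have [t0 Bt0] : B !=set0.
  move/existsNP: nT => [t /not_implyP[/andP[at_ _] nt]]; by exists t.
have infB : has_inf B by split; [exists t0|exists a => t []].
(* First bad time. Closedness of [W'] keeps the path in [W'] at tau, openness of W keeps it in W a
   little longer, and [key] improves W to [W'] there, so that tau was not the infimum. *)
pose tau := inf B.
have atau : a <= tau by apply: lb_le_inf; [exists t0|move=> t []].
have below u : a <= u < tau -> W' (eta u).
  move=> /andP[au ut]; apply: contrapT => nu.
  by move: ut; rewrite ltNge => /negP; apply; apply: ge_inf; [exists a => t []|].
have Wtau : W' (eta tau).
  have [<-|atau'] := eqVneq a tau.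
    have cx' : cdom c (eta a) by rewrite xa.
    by split => //; rewrite xa subrr normr0.
  have {}atau' : a < tau by rewrite lt_neqAle atau'.
  apply: W'cl => A' nA'.
  have /nbhs_ballP[d /= d0 Hd] := cvg_near (ec tau) nA'.
  have [u [ua ut ud]] : exists u, [/\ a <= u, u < tau & tau - u < d].
    exists (Num.max a (tau - d / 2)); rewrite le_max lexx gt_max atau'; split => //.
      by rewrite ltrBlDr ltrDl divr_gt0.
    rewrite ltrBlDr -ltrBlDl lt_max; apply/orP; right; lra.
  exists (eta u); split; first by apply: below; rewrite ua.
  by apply: Hd; rewrite /ball/= gtr0_norm// subr_gt0.
have /nbhs_ballP[d /= d0 Hd] := cvg_near (ec tau) (W'W _ Wtau).
have HW u : a <= u < tau + d -> W (eta u).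
  move=> /andP[au ud]; have [ut|tu] := ltP u tau.
    have [cu pu] := below u ltac:(by rewrite au).
    by split => //; exact: le_lt_trans rho'E.
  by apply: Hd; rewrite /ball/= ler0_norm ?subr_le0//; lra.
have HW' := key (tau + d) ltac:(lra) HW.
have : tau + d <= tau.
  apply: lb_le_inf; first by exists t0.
  move=> u [au nu]; rewrite leNgt; apply/negP => ud.
  by apply: nu; apply: HW'; rewrite au.
lra.
Qed.

End DistanceTopology.

(** * Precompactness of forward balls *)

Section HopfRinow.
Context {R : realType} {n : nat} (X : finsler_manifold R n).
Implicit Types x y z : X.

(** Extraction of a finite subcover as an induction principle. The covering is indexed by the filter
    of sets that eventually contain a given good set, a filter because good sets are stable under
    union. *)
Lemma compact_ind (T : topologicalType) (Q : set T -> Prop) (K : set T) : Q set0 ->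
  (forall A B, Q A -> Q B -> Q (A `|` B)) ->
  (forall x : T, K x -> exists2 A, nbhs x A & Q A) -> compact K ->
  exists2 A, Q A & K `<=` A.
Proof.
move=> Q0 QU Qn /compact_near_coveringP.
move=> /(_ (set T) (filter_from Q (fun A => [set A' | A `<=` A'])) (fun A w => A w)).
have FF : Filter (filter_from Q (fun A : set T => [set A' | A `<=` A'])).
  apply: filter_from_filter; first by exists set0.
  move=> A B QA QB; exists (A `|` B); first exact: QU.
  by move=> C /= ABC; split => w ?; apply: ABC; [left|right].
move=> /(_ FF)[|A QA KA]; last by exists A => //; exact: KA.
move=> x /Qn[A xA QA]; exists (A, [set A' | A `<=` A']) => /=.
  by split => //; exists A.
by move=> [w A'] /= [Aw AA']; exact: AA'.
Qed.

Lemma compact_nbhs x : exists2 K, nbhs x K & compact K.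
Proof.
have [c cx] := cdom_cover x; have [r r0 H] := local_chart_ball cx.
exists [set y | cdom c y /\ `|coord c x - coord c y| <= r]; last exact: H.
apply: filterI; first exact: cdom_nbhs.
by have := coord_continuous cx => /cvgrPdist_le; apply.
Qed.

Lemma filter_ex3 (T : Type) (F : set_system T) (A B C : set T) : ProperFilter F ->
  F A -> F B -> F C -> exists u, [/\ A u, B u & C u].
Proof.
move=> FF FA FB FC; suff : F [set u | [/\ A u, B u & C u]] by exact: filter_ex.
by apply: filterS3 FA FB FC => u.
Qed.

Lemma fmap_ultra (T U : Type) (f : T -> U) (F : set_system T) :
  UltraFilter F -> UltraFilter (f @ F).
Proof.
move=> FU; split; first exact: fmap_proper_filter.
move=> G GF fFG; apply/seteqP; split => // A GA.
have [//|FnA] := in_ultra_setVsetC (f @^-1` A) FU.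
have : G (~` A) by apply: fFG.
by move=> GnA; have /filter_ex[u []] : G (A `&` ~` A) by exact: filterI.
Qed.

(** A chain of approximate midpoints from x towards y. With e_j = s / 2^j and dist x y < s, each
    next point exists by [dist_split]. *)
Fixpoint approach x (e : nat -> R) (y : X) (j : nat) : X :=
  if j is j'.+1 then
    get (fun q : X => dist (approach x e y j') q < e j /\ dist q y < e j)
  else x.

Lemma geometric_small (r eps : R) : 0 < eps -> exists j : nat, r / 2 ^+ j < eps.
Proof.
move=> e0; have [j Hj] : exists j : nat, `|r| / eps < j%:R.
  by exists (Num.bound (`|r| / eps)); apply: archi_boundP; rewrite divr_ge0// ltW.
exists j; apply: le_lt_trans (ler_norm _) _.
have p0 : (0 : R) < 2 ^+ j by rewrite exprn_gt0.
rewrite normrM normfV (gtr0_norm p0) ltr_pdivrMr//.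
move: Hj; rewrite ltr_pdivrMr// mulrC => /lt_le_trans; apply.
apply: ler_wpM2l; first exact: ltW.
by rewrite -natrX ler_nat ltnW// ltn_expl.
Qed.

Lemma forward_Cauchy_cvg (y_ : nat -> X) (r : R) : forward_complete X ->
  (forall j, dist (y_ j) (y_ j.+1) <= r / 2 ^+ j.+1) -> exists y, y_ @ \oo --> y.
Proof.
move=> fc H; apply: fc => eps /(geometric_small r)[M HM].
exists M => p q Mp pq.
have P2 k : (0 : R) < 2 ^+ k by rewrite exprn_gt0.
have r0 : 0 <= r.
  have := le_trans (dist_ge0 _ _) (H 0%N).
  by rewrite pmulr_lge0// invr_gt0.
have key k : dist (y_ p) (y_ (p + k)%N) <= r / 2 ^+ p - r / 2 ^+ (p + k).
  elim: k => [|k IH]; first by rewrite addn0 dist_refl subrr.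
  apply: le_trans (dist_triangle _ (y_ (p + k)%N) _) _.
  have := H (p + k)%N; rewrite addnS.
  have E : r / 2 ^+ (p + k) = r / 2 ^+ (p + k).+1 + r / 2 ^+ (p + k).+1.
    by rewrite exprS; field; rewrite lt0r_neq0.
  lra.
have := key (q - p)%N; rewrite subnKC; last exact: ltnW.
move=> K; apply: le_trans K _; apply: (@le_trans _ _ (r / 2 ^+ p)).
  by rewrite gerBl divr_ge0// ltW.
apply: le_trans (ltW HM); rewrite ler_wpM2l// lef_pV2 ?posrE//.
by rewrite ler_eXn2l ?ltr1n// ltnW.
Qed.

(** A Hopf-Rinow argument without geodesics. A radius with precompact ball can be increased, by
    local compactness ([Pext]), and a limit of such radii is again one, by completeness ([Plim]); so
    their supremum cannot be finite. *)
Lemma fball_precompact x r : forward_complete X ->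
  exists2 K, compact K & fball x r `<=` K.
Proof.
move=> fc; pose P (r : R) := exists2 K, compact K & fball x r `<=` K.
have Pmono (s t : R) : s <= t -> P t -> P s.
  by move=> st [K cK tK]; exists K => // y xy; apply: tK; exact: lt_le_trans st.
have P0 (s : R) : s <= 0 -> P s.
  move=> s0; exists set0; first exact: compact0.
  by move=> y; rewrite /fball/= => ys; have := dist_ge0 x y; lra.
have Pext (s : R) : P s -> exists2 e, 0 < e & P (s + e).
  have [s0 _|s0] := leP s 0.
    have [K xK cK] := compact_nbhs x.
    have [e e0 eK] := fball_nbhs_base xK.
    exists e => //; exists K => // y xy; apply: eK.
    by apply: lt_le_trans xy _; rewrite gerDr.
  move=> [K cK sK].
  pose Q (A : set X) := exists2 e : R, 0 < e & exists2 K', compact K' &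
    forall w, A w -> fball w e `<=` K'.
  have [||||A [e e0 [K' cK' HA]] KA] := @compact_ind X Q K.
  - by exists 1 => //; exists set0 => //; exact: compact0.
  - move=> A B [e1 e10 [K1 cK1 H1]] [e2 e20 [K2 cK2 H2]].
    exists (Num.min e1 e2); first by rewrite lt_min e10.
    exists (K1 `|` K2); first exact: compactU.
    move=> w [/H1|/H2] H z; rewrite /fball/= lt_min => /andP[z1 z2].
      by left; exact: H.
    by right; exact: H.
  - move=> w _; have [K0 wK0 cK0] := compact_nbhs w.
    have [e e0 eK] := fball_nbhs_base wK0.
    exists (fball w (e / 2)); first by apply: nbhs_fball; rewrite divr_gt0.
    exists (e / 2); first by rewrite divr_gt0.
    exists K0 => // u wu z uz; apply: eK.
    move: wu uz; rewrite /fball/= => wu uz.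
    by apply: le_lt_trans (dist_triangle _ u _) _; lra.
  - exact: cK.
  exists e => //; exists K' => // z; rewrite /fball/= => xz.
  have [w xw wz] := dist_split s0 e0 xz.
  by apply: (HA w) => //; apply: KA; exact: sK.
have Plim (s : R) : 0 < s -> (forall t, t < s -> P t) -> P s.
  move=> s0 Ps; apply: contrapT => nP.
  (* If the ball of radius s lies in no compact set, its parts outside compact sets generate a
     proper filter; a finer ultrafilter U contains the ball and the complement of every compact
     set. *)
  pose F0 := filter_from [set C : set X | compact C] (fun C => fball x s `\` C).
  have F0f : ProperFilter F0.
    apply: filter_from_proper.
      apply: filter_from_filter; first by exists set0; exact: compact0.
      move=> A B cA cB; exists (A `|` B); first exact: compactU.
      by move=> z [zs nAB]; split; split => // ?; apply: nAB; [left|right].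
    move=> C cC; apply: contrapT => /nonemptyPn E; apply: nP; exists C => //.
    move=> z zs; apply: contrapT => nz.
    by have : (fball x s `\` C) z by []; rewrite E.
  have [U [UU FU]] := ultraFilterLemma F0f.
  have UB : U (fball x s).
    by apply: FU; exists set0; [exact: compact0|move=> z []].
  pose e (j : nat) : R := s / 2 ^+ j.
  have e_gt0 j : 0 < e j by rewrite divr_gt0// exprn_gt0.
  have eE j : e j = e j.+1 + e j.+1.
    by rewrite /e exprS; field; rewrite lt0r_neq0// exprn_gt0.
  pose p j y := approach x e y j.
  have p2 j y : fball x s y -> dist (p j y) y < e j /\
      dist (p j y) (p j.+1 y) < e j.+1.
    move=> ys.
    have step i : dist (p i y) y < e i -> dist (p i y) (p i.+1 y) < e i.+1 /\
        dist (p i.+1 y) y < e i.+1.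
      rewrite eE => /(dist_split (e_gt0 _) (e_gt0 _))[w w1 w2].
      have := @getPex X (fun q : X => dist (p i y) q < e i.+1 /\ dist q y < e i.+1).
      by apply; exists w.
    have H : dist (p j y) y < e j.
      elim: j => [|j IH]; first by rewrite /p/= /e expr0 divr1.
      exact: (step j IH).2.
    by split => //; exact: (step j H).1.
  have px j y : fball x s y -> dist x (p j y) <= s - e j.
    move=> ys; elim: j => [|j IH]; first by rewrite /p/= dist_refl /e expr0 divr1 subrr.
    apply: le_trans (dist_triangle _ (p j y) _) _.
    have [_] := p2 j y ys; have := eE j; lra.
  (* For fixed j the j-th chain points of all z lie in a ball of radius s - e_j / 2, precompact by
     assumption, so they converge along U. Their limits y_j inherit the geometric steps of the
     chains and form a forward Cauchy sequence. *)
  have /choice[y_ Hy] : forall j, exists yj : X, p j z @[z --> U] --> yj.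
    move=> j; have [K cK HK] := Ps (s - e j / 2) ltac:(rewrite ltrBlDr ltrDl divr_gt0//).
    have UK : (p j @ U) K.
      rewrite /fmap/=; apply: filterS UB => z zs; apply: HK; rewrite /fball/=.
      apply: le_lt_trans (px j z zs) _; have := e_gt0 j; lra.
    move: cK; rewrite compact_ultra => cK.
    by have [yj [_ Hyj]] := cK _ (fmap_ultra (p j) UU) UK; exists yj.
  have near_y (j : nat) (d : R) : 0 < d ->
      \forall z \near U, dist (y_ j) (p j z) < d /\ dist (p j z) (y_ j) < d.
    by move=> d0; exact: (cvg_near (Hy j) (nbhs_dist_small (y_ j) d0)).
  have ydist j : dist (y_ j) (y_ j.+1) <= s / 2 ^+ j.+1.
    apply/ler_addgt0Pr => d d0; have d2 : 0 < d / 2 by rewrite divr_gt0.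
    have [z [[h1 _] [_ h2] zs]] := filter_ex3 _ (near_y j _ d2) (near_y j.+1 _ d2) UB.
    have [_ h3] := p2 j z zs.
    have t1 := dist_triangle (y_ j) (p j z) (y_ j.+1).
    have t2 := dist_triangle (p j z) (p j.+1 z) (y_ j.+1).
    rewrite /e in h3; lra.
  have [y yy] := forward_Cauchy_cvg fc ydist.
  (* For some z selected by U the chain y, y_j, p_j(z), z is shorter than d, which puts z in the
     compact set C that U avoids. *)
  have [C yC cC] := compact_nbhs y.
  have [d d0 dC] := fball_nbhs_base yC.
  have d3 : 0 < d / 3 by rewrite divr_gt0.
  have [j [ej yj]] : exists j, e j < d / 3 /\ dist y (y_ j) < d / 3.
    have [M HM] := geometric_small s d3.
    have N1 : \forall j \near \oo, (M <= j)%N by exists M.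
    have N2 : \forall j \near \oo, fball y (d / 3) (y_ j).
      by apply: (cvg_near yy); exact: nbhs_fball.
    have [j [Mj yj _]] := filter_ex3 _ N1 N2 N2.
    exists j; split => //; apply: le_lt_trans HM.
    rewrite /e; apply: ler_wpM2l; first exact: ltW.
    rewrite lef_pV2 ?posrE ?exprn_gt0//.
    by rewrite ler_eXn2l ?ltr1n.
  have UC : U (~` C).
    by apply: FU; exists C => // z [].
  have [z [zs [h1 _] nC]] := filter_ex3 _ UB (near_y j _ d3) UC.
  apply: nC; apply: dC; rewrite /fball/=.
  have [h2 _] := p2 j z zs.
  have t1 := dist_triangle y (y_ j) z.
  have t2 := dist_triangle (y_ j) (p j z) z.
  lra.
apply: contrapT => nPr.
pose S := [set s | P s].
have Sub : has_ubound S.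
  by exists r => s Ps; rewrite leNgt; apply/negP => /ltW rs; apply: nPr; exact: Pmono Ps.
have S0 : S 0 by apply: P0.
have sup0 : 0 <= sup S by exact: ub_le_sup.
have below (t : R) : t < sup S -> P t.
  by move=> /sup_gt[|u Pu tu]; [exists 0|exact: Pmono (ltW tu) Pu].
have [e e0 Pe] : exists2 e, 0 < e & P (sup S + e).
  apply: Pext; move: sup0; rewrite le_eqVlt => /predU1P[<-|s0]; first exact: P0.
  exact: Plim.
have : sup S + e <= sup S by exact: ub_le_sup.
lra.
Qed.

Lemma dist_gt0 x y : x != y -> 0 < dist x y.
Proof.
move=> xy; have := @manifold_hausdorff _ _ X; rewrite open_hausdorff => /(_ _ _ xy)[[A B] /=].
rewrite !inE => -[xA yB] [oA oB AB0].
have [r r0 rA] := fball_nbhs_base (open_nbhs_nbhs (conj oA xA)).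
apply: (lt_le_trans r0); rewrite leNgt; apply/negP => yr.
have : (A `&` B) y by split => //; exact: rA.
by rewrite AB0.
Qed.

End HopfRinow.

(** * Measures on X *)

Section GeneralMeasure.
Local Open Scope ereal_scope.
Context d (T : measurableType d) {R : realType}.

(** The integral of a nonnegative function is a supremum over the simple functions below it, hence
    monotone for arbitrary functions. This is applied to the slope, whose measurability is never
    established. *)
Lemma le_integral_nonneg (mu : {measure set T -> \bar R}) (D : set T) (f g : T -> \bar R) :
  (forall x, D x -> 0 <= f x) -> (forall x, D x -> f x <= g x) ->
  \int[mu]_(x in D) f x <= \int[mu]_(x in D) g x.
Proof.
move=> f0 fg; rewrite !ge0_integralE//; last first.
  by move=> x Dx; apply: le_trans (fg x Dx); exact: f0.
apply: le_ereal_sup => _ [h hf <-]; exists h => // x /=.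
apply: (le_trans (hf x)); rewrite !patchE; case: ifPn => // /set_mem Dx.
exact: fg.
Qed.

Lemma measurable_fun_lt (f : T -> R) :
  (forall r, measurable [set x | (f x < r)%R]) -> measurable_fun setT f.
Proof.
move=> H mD; apply: (measurability _ (RGenInftyO.measurableE R)) => //.
move=> _ [_ [r ->] <-]; rewrite setTI.
by rewrite (_ : _ @^-1` _ = [set x | (f x < r)%R])//; apply/seteqP; split => x /=; rewrite in_itv.
Qed.

Lemma measurable_superlevel (f : T -> R) (r : R) :
  measurable_fun setT f -> measurable [set x | (r < f x)%R].
Proof.
move=> mf; rewrite -[X in measurable X]setTI.
rewrite (_ : [set x | _] = f @^-1` `]r, +oo[); first exact: mf.
by apply/seteqP; split => x /=; rewrite in_itv/= andbT.
Qed.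

End GeneralMeasure.

Lemma lebesgue_int_ge0 (R : realType) n (f : 'rV[R]_n -> \bar R) :
  (forall q, 0 <= f q)%E -> (0 <= lebesgue_int f)%E.
Proof.
elim: n f => [|n IH] f f0 /=; first exact: f0.
by apply: integral_ge0 => t _; apply: IH => v; exact: f0.
Qed.

Lemma lebesgue_int0 (R : realType) n : lebesgue_int (fun _ : 'rV[R]_n => 0%E) = 0%E.
Proof.
elim: n => [//|n IH] /=.
by under eq_integral do rewrite IH; rewrite integral0.
Qed.

(** Induction on the dimension: f lives on a sup-norm cube of side 2 r, and each slice on a cube of
    one dimension less. Through [volE] this yields local finiteness of the volume. *)
Lemma lebesgue_int_bound (R : realType) n (f : 'rV[R]_n -> \bar R) p (r M : R) :
  0 <= r -> 0 <= M -> (forall q, 0 <= f q)%E -> (forall q, f q <= M%:E)%E ->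
  (forall q, f q != 0%E -> `|p - q| <= r) ->
  (lebesgue_int f <= (M * (2 * r) ^+ n)%:E)%E.
Proof.
move=> r0 M0; elim: n f p => [|n IH] f p f0 fM fr /=.
  by rewrite expr0 mulr1.
pose p0 := p 0 0.
pose C := M * (2 * r) ^+ n.
have C0 : 0 <= C by rewrite mulr_ge0// exprn_ge0// mulr_ge0.
pose D : set R := `[p0 - r, p0 + r]%classic.
have H t : (lebesgue_int (fun v : 'rV[R]_n => f (row_mx (const_mx t : 'M[R]_(1, 1)) v))
    <= (C * \1_D t)%:E)%E.
  have [tD|tD] := boolP (t \in D).
    rewrite indicE tD mulr1; apply: (IH _ (rsubmx (p : 'rV[R]_(1 + n)))) => // v /fr.
    apply: le_trans; apply: normr_rV_le => // i.
    have := normr_coord_le (p - (row_mx (const_mx t : 'M[R]_(1, 1)) v : 'rV[R]_n.+1)) (rshift 1 i).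
    by rewrite !mxE; case: splitP => // j /= => [|[/val_inj ->]] //; case: j => -[].
  rewrite indicE (negbTE tD) mulr0.
  rewrite (_ : (fun v => _) = fun _ => 0%E) ?lebesgue_int0//.
  apply/funext => v; apply/eqP; apply: contraT => /fr pr.
  move/negP: tD => []; apply/mem_set; rewrite /D/= in_itv/=; rewrite -ler_distlC distrC.
  apply: le_trans pr.
  have := normr_coord_le (p - (row_mx (const_mx t : 'M[R]_(1, 1)) v : 'rV[R]_n.+1)) 0.
  rewrite !mxE; case: splitP => // j /=.
  by rewrite mxE distrC.
apply: (@le_trans _ _ (\int[@lebesgue_measure R]_t (C * \1_D t)%:E)%E).
  apply: le_integral_nonneg => t _; last exact: H.
  by apply: lebesgue_int_ge0.
under eq_integral do rewrite EFinM.
rewrite ge0_integralZl//=; last first.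
  by apply/measurable_EFinP; apply: measurable_indic; exact: measurable_itv.
have mD : (@lebesgue_measure R D <= (2 * r)%:E)%E.
  rewrite /D lebesgue_measure_itv/= lte_fin; case: ifPn => _.
    by rewrite -EFinD lee_fin; lra.
  by rewrite lee_fin mulr_ge0.
have -> : (\int[@lebesgue_measure R]_x (\1_D x)%:E = @lebesgue_measure R D)%E.
  by rewrite integral_indic//; [rewrite setIT|exact: measurable_itv].
rewrite exprSr mulrA -/C [X in (_ <= X)%E]EFinM.
by apply: lee_wpmul2l => //; rewrite lee_fin.
Qed.

(** * Borel sets, measurability of the distance, volume of compact sets *)

Section BorelStructure.
Context {R : realType} {n : nat} (X : measured_finsler R n).
Implicit Types x y z : X.

Lemma open_borel (A : set (borel X)) : open (A : set X) -> measurable A.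
Proof. by move=> oA; exact: sub_sigma_algebra. Qed.

Lemma closed_borel (A : set (borel X)) : closed (A : set X) -> measurable A.
Proof.
move=> cA; rewrite -[A]setCK; apply: measurableC.
by apply: open_borel; exact: closed_openC.
Qed.

Lemma compact_borel (A : set (borel X)) : compact (A : set X) -> measurable A.
Proof.
by move=> cA; apply: closed_borel; apply: compact_closed => //; exact: manifold_hausdorff.
Qed.

Lemma fball_borel x r : measurable (fball x r : set (borel X)).
Proof. by apply: open_borel; exact: open_fball. Qed.

Lemma bball_borel x r : measurable (bball x r : set (borel X)).
Proof. by apply: open_borel; exact: open_bball. Qed.

Lemma dense_sequence : exists q : nat -> X, forall x A, nbhs x A -> exists j, A (q j).
Proof.
have [B cB [Bo Bb]] := @manifold_second_countable _ _ X.
have [f Bf] : exists f : nat -> set X, forall b, B b -> exists j, f j = b.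
  have /countable_injP[g gi] := cB.
  exists (fun j => xget set0 [set b | B b /\ g b = j]) => b Bb'.
  exists (g b); case: xgetP => [b' -> [Bb'' gb]|/(_ b)]; last by case.
  by apply: gi; rewrite ?inE.
exists (fun j => get (f j)) => x A xA.
have [b [/= Bb' bx] bA] := Bb x A xA.
have [j fj] := Bf b Bb'; exists j; apply: bA; rewrite fj.
by apply: getI; exact: bx.
Qed.

Lemma inv_nat_small (e : R) : 0 < e -> exists l : nat, l.+1%:R^-1 < e.
Proof.
move=> e0; exists (Num.bound e^-1); rewrite -[ltRHS]invrK ltf_pV2 ?posrE ?invr_gt0//.
apply: lt_trans (archi_boundP _) _; first by rewrite invr_ge0 ltW.
by rewrite ltr_nat.
Qed.

Lemma dist_lt_dense (q : nat -> X) (r : R) x y :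
  (forall x A, nbhs x A -> exists j, A (q j)) ->
  dist x y < r <-> exists j l : nat, dist x (q j) < l.+1%:R^-1 /\
    dist (q j) y < r - l.+1%:R^-1.
Proof.
move=> Hq; split => [xyr|[j [l [h1 h2]]]]; last first.
  by have := dist_triangle x (q j) y; set a := l.+1%:R^-1 in h1 h2; lra.
have [l Hl] : exists l : nat, l.+1%:R^-1 < (r - dist x y) / 2.
  by apply: inv_nat_small; rewrite divr_gt0// subr_gt0.
have l0 : (0 : R) < l.+1%:R^-1 by rewrite invr_gt0.
have [j [h1 h2]] := Hq x _ (nbhs_dist_small x l0).
exists j, l; split; first exact: h1.
by have := dist_triangle (q j) x y; set a := l.+1%:R^-1 in h1 h2 Hl *; lra.
Qed.

(** The sigma-algebra is the product of the Borel ones, for which open sets must be exhausted by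
    rectangles: a dense sequence writes {dist < r} as a countable union of products of a backward
    and a forward ball. *)
Lemma measurable_dist :
  measurable_fun setT (fun z : borel X * borel X => dist (z.1 : X) (z.2 : X)).
Proof.
have [q Hq] := dense_sequence.
apply: measurable_fun_lt => r.
rewrite (_ : [set z | _] = \bigcup_j \bigcup_l
   ((bball (q j) (l.+1%:R^-1) : set (borel X)) `*` (fball (q j) (r - l.+1%:R^-1) : set (borel X)))).
  apply: bigcupT_measurable => j; apply: bigcupT_measurable => l.
  by apply: measurableX; [exact: bball_borel|exact: fball_borel].
apply/seteqP; split => [[x y] /= /(dist_lt_dense _ _ _ Hq)[j [l [h1 h2]]]|[x y] [j _ [l _ /= [h1 h2]]]].
  by exists j => //; exists l.
by apply/(dist_lt_dense _ _ _ Hq); exists j, l.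
Qed.

Lemma vol_density_bounded (c : chart X) x : cdom c x ->
  exists2 M : R, 0 <= M & \forall y \near x, cdom c y /\ vol_density c (coord c y) <= M.
Proof.
move=> cx; have [|U [g [[oU Up] gC gE]]] := @vol_density_smooth R n X c (coord c x).
  by exists x.
have [gc _] := gC 0%N.
exists (`|g (coord c x)| + 1); first by rewrite addr_ge0.
have h1 : \forall q \near coord c x, U q by exact: open_nbhs_nbhs.
have h2 : \forall q \near coord c x, g q < `|g (coord c x)| + 1.
  apply: (cvg_near (gc _ Up) (P := fun w : R => w < _)); apply: lt_nbhsl.
  by have := ler_norm (g (coord c x)); lra.
apply: filterS2 (cdom_nbhs cx) (cvg_near (coord_continuous cx) (filterI h1 h2)).
move=> y cy [Uy gy]; split => //.
by rewrite -(gE _ Uy)//; [exact: ltW|exists y].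
Qed.

Lemma vol_locally_finite x : exists2 A : set X, nbhs x A &
  open A /\ (vol X A < +oo)%E.
Proof.
have [c cx] := cdom_cover x.
have [M M0 HM] := vol_density_bounded cx.
have h1 : \forall y \near x, `|coord c x - coord c y| <= 1.
  by have := coord_continuous cx => /cvgrPdist_le; apply.
have HI : nbhs x [set y | (cdom c y /\ vol_density c (coord c y) <= M) /\
    `|coord c x - coord c y| <= 1] by exact: filterI.
have [A [oA Ax] HA] : exists2 A, open_nbhs x A & A `<=`
    [set y | (cdom c y /\ vol_density c (coord c y) <= M) /\ `|coord c x - coord c y| <= 1].
  by move: HI; rewrite nbhsE.
exists A; first exact: open_nbhs_nbhs.
split => //; rewrite (volE (c := c)).
- apply: (@le_lt_trans _ _ (M * (2 * 1) ^+ n)%:E); last exact: ltry.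
  apply: (@lebesgue_int_bound _ _ _ (coord c x)) => //.
  + move=> q; rewrite lee_fin; have [/set_mem qA|qA] := boolP (q \in coord c @` A).
      apply: mulr_ge0 => //; apply: ltW; apply: vol_density_gt0.
      by case: qA => y /HA[[cy _] _] <-; exists y.
    by rewrite indicE (negbTE qA) mul0r.
  + move=> q; rewrite lee_fin indicE; have [/set_mem qA|qA] := boolP (q \in coord c @` A).
      by rewrite mul1r; case: qA => y /HA[[_ yM] _] <-.
    by rewrite mul0r.
  + move=> q; rewrite indicE; have [/set_mem qA _|qA] := boolP (q \in coord c @` A).
      by case: qA => y /HA[_ ?] <-.
    by rewrite mul0r eqxx.
- exact: open_borel.
- by move=> y /HA[[]].
Qed.

Lemma vol_compact (K : set X) : compact K -> (vol X K < +oo)%E.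
Proof.
move=> cK.
have [||||A [oA Af] KA] := @compact_ind X (fun A => open A /\ (vol X A < +oo)%E) K.
- by split; [exact: open0|rewrite measure0].
- move=> A B [oA Af] [oB Bf]; split; first exact: openU.
  apply: le_lt_trans (measureU2 _ _ _) _; [exact: open_borel..|].
  exact: lte_add_pinfty.
- move=> x _; exact: vol_locally_finite.
- exact: cK.
apply: le_lt_trans Af; apply: le_measure; rewrite ?inE//.
  exact: compact_borel.
exact: open_borel.
Qed.

Lemma vol_fball x r : forward_complete X -> (vol X (fball x r) < +oo)%E.
Proof.
move=> /(fball_precompact x r)[K cK xK].
apply: le_lt_trans (vol_compact cK); apply: le_measure; rewrite ?inE//.
  exact: fball_borel.
exact: compact_borel.
Qed.

End BorelStructure.

Section DensityImage.
Local Open Scope ereal_scope.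
Context d d' (T : measurableType d) (T' : measurableType d') (R : realType).

(* The proofs are arguments so that the measure instance below can use them. *)
Definition density_image (mu : {measure set T -> \bar R}) (f : T -> R) (phi : T -> T')
    (mf : measurable_fun setT f) (f0 : forall x, (0 <= f x)%R)
    (mphi : measurable_fun setT phi) (S : set T') : \bar R :=
  \int[mu]_(x in phi @^-1` S) (f x)%:E.

Context (mu : {measure set T -> \bar R}) (f : T -> R) (phi : T -> T')
  (mf : measurable_fun setT f) (f0 : forall x, (0 <= f x)%R)
  (mphi : measurable_fun setT phi).
Local Notation nu := (density_image mu mf f0 mphi).

Lemma density_image0 : nu set0 = 0.
Proof. by rewrite /density_image preimage_set0 integral_set0. Qed.

Lemma density_image_ge0 S : 0 <= nu S.
Proof. by apply: integral_ge0 => x _; rewrite lee_fin. Qed.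

Lemma density_image_sigma_additive : semi_sigma_additive nu.
Proof.
move=> F mF tF mUF; rewrite /density_image preimage_bigcup.
have mpF i : measurable (phi @^-1` F i) by rewrite -[X in measurable X]setTI; exact: mphi.
rewrite ge0_integral_bigcup//.
- apply: is_cvg_ereal_nneg_natsum_cond => k _ _.
  by apply: integral_ge0 => x _; rewrite lee_fin.
- by apply/measurable_EFinP; apply: measurable_funTS.
- by move=> x _; rewrite lee_fin.
- by move=> i j _ _ [x [xi xj]]; apply: tF => //; exists (phi x).
Qed.

HB.instance Definition _ := isMeasure.Build _ _ _ nu
  density_image0 density_image_ge0 density_image_sigma_additive.

Import HBNNSimple.

Lemma integral_density_image (g : T' -> \bar R) : measurable_fun setT g ->
  (forall y, 0 <= g y) -> \int[nu]_y g y = \int[mu]_x ((f x)%:E * g (phi x)).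
Proof.
move=> mg g0.
pose g_ := nnsfun_approx measurableT mg.
have mgphi n : measurable_fun setT (fun x => ((f x) * (g_ n (phi x)))%R).
  by apply: measurable_funM => //; apply: measurableT_comp.
transitivity (limn (fun n => \int[nu]_y (g_ n y)%:E)).
  rewrite -monotone_convergence//.
  - apply: eq_integral => y _; apply/esym/cvg_lim => //.
    exact: cvg_nnsfun_approx.
  - by move=> n; exact/measurable_EFinP/measurable_funP.
  - by move=> n y _; rewrite lee_fin.
  - by move=> y _ m n mn; rewrite lee_fin; exact/lefP/nd_nnsfun_approx.
rewrite [X in limn X](_ : _ = (fun n => \int[mu]_x (f x * g_ n (phi x))%:E)).
  rewrite -monotone_convergence//; last 3 first.
  - by move=> n; exact/measurable_EFinP.
  - by move=> n x _; rewrite lee_fin mulr_ge0.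
  - move=> x _ m n mn; rewrite lee_fin ler_wpM2l//.
    exact/lefP/nd_nnsfun_approx.
  apply: eq_integral => x _; apply/cvg_lim => //.
  under eq_fun do rewrite EFinM.
  apply: cvgeZl => //; exact: cvg_nnsfun_approx.
apply/funext => n.
have mpre r : measurable (phi @^-1` (g_ n @^-1` [set r])).
  by rewrite -[X in measurable X]setTI; exact: mphi.
rewrite integralT_nnsfun sintegralE.
transitivity (\sum_(k \in range (g_ n))
    \int[mu]_x (f x * (k * \1_(g_ n @^-1` [set k]) (phi x)))%:E); last first.
  rewrite -ge0_integral_fsum//.
  - apply: eq_integral => x _; rewrite [in RHS]fimfunE.
    by rewrite fsumEFin// -mulr_fsumr.
  - move=> k; apply/measurable_EFinP; apply: measurable_funM => //.
    by apply: measurable_funM => //; apply: measurableT_comp.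
  - move=> k x _; rewrite lee_fin mulr_ge0//.
    by rewrite -lee_fin EFinM nnfun_muleindic_ge0.
apply: eq_fsbigr => k /set_mem[y _ <-].
set r := g_ n y.
rewrite -/r /nu/= /density_image.
have -> : \int[mu]_x (f x * (r * \1_(g_ n @^-1` [set r]) (phi x)))%:E =
    r%:E * \int[mu]_x (((EFin \o f) \_ (phi @^-1` (g_ n @^-1` [set r]))) x).
  rewrite -ge0_integralZl//.
  - apply: eq_integral => x _.
    have E : (phi x \in g_ n @^-1` [set r]) = (x \in phi @^-1` (g_ n @^-1` [set r])).
      by apply/idP/idP; rewrite !inE.
    rewrite patchE indicE E; case: ifPn => _; last by rewrite !mulr0 mule0.
    by rewrite /= mulr1 -EFinM mulrC.
  - apply/(measurable_restrictT (EFin \o f)); first exact: mpre.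
    by apply: measurable_funTS; exact/measurable_EFinP.
  - by move=> x _; rewrite patchE; case: ifP => // _; rewrite lee_fin.
  - by rewrite lee_fin.
by rewrite -integral_mkcond.
Qed.

End DensityImage.

(** * Gluing of transport plans and midpoints *)

(* Two plans sharing a marginal are glued along a countable partition into
   cells: conditionally on the cell of the middle point they are taken
   independent, so that no disintegration is needed. *)
Section Gluing.
Local Open Scope ereal_scope.
Context d (T : measurableType d) (R : realType).
Implicit Types (mu : probability T R) (pi : probability (T * T)%type R).

Context (mu : probability T R) (pi1 pi2 : probability (T * T)%type R) (idx : T -> nat)
  (midx : forall j, measurable [set z | idx z = j])
  (pi1mu : forall A, measurable A -> pi1 (setT `*` A) = mu A)
  (pi2mu : forall A, measurable A -> pi2 (A `*` setT) = mu A).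

Local Notation mass j := (fine (mu [set z | idx z = j])).

(** Density of the glued law with respect to the product of the two plans. On a cell of mass 0 the
    inverse is 0 by convention, which breaks the normalization only on the null set of
    [null_cells]. *)
Definition glue_weight (z : (T * T) * (T * T)) : R :=
  (if idx z.1.2 == idx z.2.1 then (mass (idx z.1.2))^-1 else 0)%R.

Lemma glue_weight_ge0 z : (0 <= glue_weight z)%R.
Proof. by rewrite /glue_weight; case: ifP => // _; rewrite invr_ge0 fine_ge0. Qed.

Lemma measurable_cells (P : nat -> Prop) : measurable [set z | P (idx z)].
Proof.
rewrite (_ : [set z | _] = \bigcup_(j in P) [set z | idx z = j]); last first.
  by apply/seteqP; split => [z Pz|z [j Pj /= ->]//]; exists (idx z).
exact: bigcup_measurable.
Qed.

Lemma measurable_glue_weight : measurable_fun setT glue_weight.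
Proof.
move=> _ Y mY; rewrite setTI.
have -> : glue_weight @^-1` Y = \bigcup_j
    ((setT `*` [set z | idx z = j]) `*`
     ([set z | Y (if j == idx z then (mass j)^-1 else 0)%R] `*` setT)).
  apply/seteqP; split => [[[a b] [a' b']] /= Yz|[[a b] [a' b']] [j _]] /=.
    by exists (idx b).
  by rewrite /glue_weight /= => -[[_ ->] []].
apply: bigcupT_measurable => j; apply: measurableX; apply: measurableX => //.
exact: (measurable_cells (fun i => Y (if j == i then (mass j)^-1 else 0)%R)).
Qed.

Lemma massE j : mu [set z | idx z = j] = (mass j)%:E.
Proof. by rewrite fineK// fin_num_measure. Qed.

Lemma measurable_null_cells : measurable [set z | mass (idx z) = 0%R].
Proof. exact: (measurable_cells (fun j => mass j = 0%R)). Qed.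

Lemma null_cells : mu [set z | mass (idx z) = 0%R] = 0.
Proof.
have -> : [set z | mass (idx z) = 0%R] =
    \bigcup_(j in [set j | mass j = 0%R]) [set z | idx z = j].
  by apply/seteqP; split => [z /= mz|z [j /= mj -> //]]; exists (idx z).
rewrite measure_bigcup//; last by move=> i j _ _ [z [/= -> ->]].
by apply: eseries0 => j _; rewrite inE /= => mj; rewrite massE mj.
Qed.

Local Notation pi12 := (pi1 \x pi2).

(** For fixed a, the weight integrates over the second plan to mass / mass = 1 in the cell of the
    end point of a. The exceptional a end in a null cell, and form a null set because the second
    marginal of [pi1] is mu. *)
Lemma integral_glue1 (H : T * T -> \bar R) : measurable_fun setT H -> (forall a, 0 <= H a) ->
  \int[pi12]_z ((glue_weight z)%:E * H z.1) = \int[pi1]_a H a.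
Proof.
move=> mH H0.
have mf : measurable_fun setT (fun z : (T * T) * (T * T) => (glue_weight z)%:E * H z.1).
  apply: emeasurable_funM; first by apply/measurable_EFinP; exact: measurable_glue_weight.
  exact: measurableT_comp measurable_fst.
have f0 z : 0 <= (glue_weight z)%:E * H z.1 by rewrite mule_ge0// lee_fin glue_weight_ge0.
rewrite fubini_tonelli1//.
apply: ge0_ae_eq_integral => //.
- exact: measurable_fun_fubini_tonelli_F.
- by move=> a _; apply: integral_ge0.
exists (setT `*` [set z | mass (idx z) = 0%R]); split.
- by apply: measurableX => //; exact: measurable_null_cells.
- exact: etrans (pi1mu measurable_null_cells) null_cells.
move=> a /= na; split => //; apply: contrapT => ma; apply: na => _.
rewrite /fubini_F.
have -> : (fun y => (glue_weight (a, y))%:E * H (a, y).1) =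
    (fun y => ((mass (idx a.2))^-1%:E * H a) *
      (\1_([set z | idx z = idx a.2] `*` setT) y)%:E).
  apply/funext => y; rewrite /glue_weight/= indicE.
  have [e|e] := eqVneq (idx a.2) (idx y.1).
    by rewrite mem_set ?mule1// e.
  rewrite memNset ?mule0 ?mul0e// => -[/= e' _].
  by move: e; rewrite e' eqxx.
rewrite ge0_integralZl//=.
- rewrite integral_indic//; last exact: measurableX.
  rewrite setIT [X in _ * X](etrans (pi2mu (midx _)) (massE _)).
  rewrite muleAC -EFinM mulVf ?mul1e//.
  exact/eqP.
- by apply/measurable_EFinP/measurable_indic; exact: measurableX.
- by rewrite mule_ge0// lee_fin invr_ge0 fine_ge0.
Qed.

Lemma integral_glue2 (H : T * T -> \bar R) : measurable_fun setT H -> (forall a, 0 <= H a) ->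
  \int[pi12]_z ((glue_weight z)%:E * H z.2) = \int[pi2]_a H a.
Proof.
move=> mH H0.
have mf : measurable_fun setT (fun z : (T * T) * (T * T) => (glue_weight z)%:E * H z.2).
  apply: emeasurable_funM; first by apply/measurable_EFinP; exact: measurable_glue_weight.
  exact: measurableT_comp measurable_snd.
have f0 z : 0 <= (glue_weight z)%:E * H z.2 by rewrite mule_ge0// lee_fin glue_weight_ge0.
rewrite fubini_tonelli2//.
apply: ge0_ae_eq_integral => //.
- exact: measurable_fun_fubini_tonelli_G.
- by move=> a _; apply: integral_ge0.
exists ([set z | mass (idx z) = 0%R] `*` setT); split.
- by apply: measurableX => //; exact: measurable_null_cells.
- exact: etrans (pi2mu measurable_null_cells) null_cells.
move=> a /= na; split => //; apply: contrapT => ma; apply: na => _.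
rewrite /fubini_G.
have -> : (fun y => (glue_weight (y, a))%:E * H (y, a).2) =
    (fun y => ((mass (idx a.1))^-1%:E * H a) *
      (\1_(setT `*` [set z | idx z = idx a.1]) y)%:E).
  apply/funext => y; rewrite /glue_weight/= indicE.
  have [e|e] := eqVneq (idx y.2) (idx a.1).
    by rewrite mem_set ?mule1// e.
  rewrite memNset ?mule0 ?mul0e// => -[/= _ e'].
  by move: e; rewrite e' eqxx.
rewrite ge0_integralZl//=.
- rewrite integral_indic//; last exact: measurableX.
  rewrite setIT [X in _ * X](etrans (pi1mu (midx _)) (massE _)).
  rewrite muleAC -EFinM mulVf ?mul1e//.
  exact/eqP.
- by apply/measurable_EFinP/measurable_indic; exact: measurableX.
- by rewrite mule_ge0// lee_fin invr_ge0 fine_ge0.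
Qed.

Lemma measurable_outer :
  measurable_fun setT (fun z : (T * T) * (T * T) => (z.1.1, z.2.2)).
Proof.
apply: measurable_fun_pair.
  exact: measurableT_comp measurable_fst measurable_fst.
exact: measurableT_comp measurable_snd measurable_snd.
Qed.

Lemma glued_plan : exists gam : probability (T * T)%type R,
  [/\ forall A, measurable A -> gam (A `*` setT) = pi1 (A `*` setT),
      forall A, measurable A -> gam (setT `*` A) = pi2 (setT `*` A)
    & forall g, measurable_fun setT g -> (forall y, 0 <= g y) ->
      \int[gam]_y g y = \int[pi12]_z ((glue_weight z)%:E * g (z.1.1, z.2.2))].
Proof.
pose nu := density_image pi12 measurable_glue_weight glue_weight_ge0 measurable_outer.
have nuI (g : T * T -> \bar R) : measurable_fun setT g -> (forall y, 0 <= g y) ->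
    \int[nu]_y g y = \int[pi12]_z ((glue_weight z)%:E * g (z.1.1, z.2.2)).
  exact: integral_density_image.
have nuA (S : set (T * T)) : measurable S ->
    nu S = \int[pi12]_z ((glue_weight z)%:E * (\1_S (z.1.1, z.2.2))%:E).
  move=> mS; apply: etrans (nuI (fun y => (\1_S y)%:E) _ _) => //.
    by rewrite integral_indic// setIT.
  by apply/measurable_EFinP; exact: measurable_indic.
have nu1 (A : set T) : measurable A -> nu (A `*` setT) = pi1 (A `*` setT).
  move=> mA; rewrite nuA; last exact: measurableX.
  transitivity (\int[pi1]_z (\1_(A `*` setT) z)%:E); last first.
    by rewrite integral_indic ?setIT//; exact: measurableX.
  rewrite -integral_glue1//.
  by apply/measurable_EFinP; apply: measurable_indic; exact: measurableX.
have nu2 (A : set T) : measurable A -> nu (setT `*` A) = pi2 (setT `*` A).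
  move=> mA; rewrite nuA; last exact: measurableX.
  transitivity (\int[pi2]_z (\1_(setT `*` A) z)%:E); last first.
    by rewrite integral_indic ?setIT//; exact: measurableX.
  rewrite -integral_glue2//.
  by apply/measurable_EFinP; apply: measurable_indic; exact: measurableX.
have nuT : nu setT = 1.
  by rewrite -setXTT nu1// setXTT probability_setT.
pose gam : probability (T * T)%type R :=
  HB.pack nu (Measure_isProbability.Build _ _ _ nu nuT).
by exists gam; split.
Qed.

End Gluing.

Lemma measurable_first_index d (T : measurableType d) (S : nat -> set T) :
  (forall j, measurable (S j)) -> (forall z, exists j, S j z) ->
  exists idx : T -> nat, (forall z, S (idx z) z) /\
    forall j, measurable [set z | idx z = j].
Proof.
move=> mS cS.
have cD z : exists j, seqDU S j z.
  have [j Sj] := cS z.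
  have : (\bigcup_j seqDU S j) z by rewrite -seqDU_bigcup_eq; exists j.
  by move=> [i _ ?]; exists i.
have [idx Hidx] := choice cD.
exists idx; split => [z|j]; first exact: (subset_seqDU (Hidx z)).
rewrite (_ : [set z | _] = seqDU S j).
  by apply: measurableD => //; exact: bigsetU_measurable.
apply/seteqP; split => [z /= <-//|z Sz /=].
have /trivIsetP tD := trivIset_seqDU S.
apply: contrapT => /eqP ij; have := tD (idx z) j I I ij.
by rewrite -subset0 => /(_ z); apply.
Qed.

(** Each cell lies in a forward and a backward ball about the same centre: for an asymmetric
    distance both are needed to travel from z to the centre and on to [z']. *)
Lemma small_cells (R : realType) n (X : measured_finsler R n) (delta : R) : 0 < delta ->
  exists idx : borel X -> nat, (forall j, measurable [set z | idx z = j]) /\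
    forall z z', idx z = idx z' -> dist (z : X) z' < delta.
Proof.
move=> d0; have [q Hq] := dense_sequence X.
have [||idx [Hidx midx]] := @measurable_first_index _ (borel X)
    (fun j => (fball (q j) (delta / 2) : set (borel X)) `&` bball (q j) (delta / 2)).
- by move=> j; apply: measurableI; [exact: fball_borel|exact: bball_borel].
- move=> z; have d2 : 0 < delta / 2 by rewrite divr_gt0.
  by have [j [? ?]] := Hq z _ (nbhs_dist_small z d2); exists j.
exists idx; split=> // z z' e.
have [_ h1] := Hidx z; have [h2 _] := Hidx z'; rewrite -e in h2.
by move: h1 h2 (dist_triangle (z : X) (q (idx z)) z'); rewrite /fball /bball /=; lra.
Qed.

Lemma eq_lexx d (T : porderType d) (x y : T) : x = y -> (x <= y)%O.
Proof. by move=> ->. Qed.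

(* The square b^2 is replaced by its tangent line at (1 - s) d. *)
Lemma transport_cost_lower (R : realType) (s D delta rho a b d : R) :
  0 < s < 1 -> 0 <= delta -> 0 <= rho -> 0 <= d <= D -> d <= a + delta + b ->
  s * D + rho <= a \/ rho = 0 ->
  d ^+ 2 + rho ^+ 2 / s <= a ^+ 2 / s + b ^+ 2 / (1 - s) + 2 * D * delta.
Proof.
move=> /andP[s0 s1] delta0 rho0 /andP[d0 dD] dab ha.
have t0 : 0 < 1 - s by rewrite subr_gt0.
have h1 : a ^+ 2 / s = (a - s * d) ^+ 2 / s + 2 * a * d - s * d ^+ 2.
  by field; rewrite gt_eqF.
have h2 : 2 * d * b - d ^+ 2 * (1 - s) <= b ^+ 2 / (1 - s).
  rewrite -subr_ge0 (_ : _ - _ = (b - (1 - s) * d) ^+ 2 / (1 - s)).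
    by rewrite divr_ge0 ?sqr_ge0// ltW.
  by field; rewrite gt_eqF.
have h3 : rho ^+ 2 / s <= (a - s * d) ^+ 2 / s.
  rewrite ler_pM2r ?invr_gt0//; case: ha => [ha|->]; last by rewrite expr0n sqr_ge0.
  rewrite -ler_sqrt ?sqr_ge0// sqrtr_sqr ger0_norm// sqrtr_sqr.
  apply: le_trans (ler_norm _).
  by have : s * d <= s * D; [rewrite ler_pM2l|lra].
have h4 : d * (d - delta - a) <= d * b by rewrite ler_wpM2l//; lra.
have h5 : d * delta <= D * delta by rewrite ler_wpM2r.
have -> : 2 * D * delta = D * delta + D * delta by ring.
have e1 : d * (d - delta - a) = d ^+ 2 - d * delta - a * d by ring.
rewrite h1.
have e2 : d ^+ 2 * (1 - s) = d ^+ 2 - s * d ^+ 2 by ring.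
have e3 : 2 * d * b = d * b + d * b by ring.
have e4 : 2 * a * d = a * d + a * d by ring.
by lra.
Qed.

(** The two defects of optimality contribute k (1 - s) / 4 and k s / 4, and the size of the cells at
    most k / 4, so the total excess over w is at most k / 2. *)
Lemma transport_slack (R : realType) (s D w k : R) : 0 < s < 1 -> 0 <= D -> 0 < k ->
  exists eta delta, [/\ 0 < eta, 0 < delta &
    s^-1 * (s ^+ 2 * w + eta) + ((1 - s)^-1 * ((1 - s) ^+ 2 * w + eta) + 2 * D * delta)
      < w + k].
Proof.
move=> /andP[s0 s1] D0 k0; have t0 : 0 < 1 - s by rewrite subr_gt0.
have D1 : 0 < D + 1 by rewrite ltr_wpDl.
exists (k * s * (1 - s) / 4), (k / (8 * (D + 1))); split.
- by rewrite divr_gt0// !mulr_gt0.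
- by rewrite divr_gt0// mulr_gt0.
rewrite (_ : s^-1 * _ = s * w + k * (1 - s) / 4); last by field; rewrite gt_eqF.
rewrite (_ : (1 - s)^-1 * _ = (1 - s) * w + k * s / 4); last by field; rewrite gt_eqF.
have : 2 * D * (k / (8 * (D + 1))) <= k / 4.
  rewrite -subr_ge0 (_ : _ - _ = k / (4 * (D + 1))).
    by rewrite divr_ge0// ?mulr_ge0// ltW.
  by field; rewrite gt_eqF.
lra.
Qed.

Lemma le_integral_combination d (T : measurableType d) (R : realType)
    (mu : {measure set T -> \bar R}) (f1 f2 g1 g2 g3 : T -> \bar R) (c k1 k2 k3 : R) :
  measurable_fun setT f1 -> measurable_fun setT f2 -> measurable_fun setT g1 ->
  measurable_fun setT g2 -> measurable_fun setT g3 ->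
  (forall x, 0 <= f1 x)%E -> (forall x, 0 <= f2 x)%E -> (forall x, 0 <= g1 x)%E ->
  (forall x, 0 <= g2 x)%E -> (forall x, 0 <= g3 x)%E ->
  0 <= c -> 0 <= k1 -> 0 <= k2 -> 0 <= k3 ->
  {ae mu, forall x, f1 x + c%:E * f2 x <= k1%:E * g1 x + (k2%:E * g2 x + k3%:E * g3 x)}%E ->
  (\int[mu]_x f1 x + c%:E * \int[mu]_x f2 x <=
   k1%:E * \int[mu]_x g1 x + (k2%:E * \int[mu]_x g2 x + k3%:E * \int[mu]_x g3 x))%E.
Proof.
move=> mf1 mf2 mg1 mg2 mg3 f10 f20 g10 g20 g30 c0 k10 k20 k30 fg.
have m0 (k : R) (h : T -> \bar R) : 0 <= k -> (forall x, 0 <= h x)%E ->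
    forall x, setT x -> (0 <= k%:E * h x)%E.
  by move=> k0 h0 x _; exact: mule_ge0.
have mk (k : R) (h : T -> \bar R) : measurable_fun setT h ->
    measurable_fun setT (fun x => k%:E * h x)%E.
  by move=> mh; exact: emeasurable_funM.
have g230 x : setT x -> (0 <= k2%:E * g2 x + k3%:E * g3 x)%E by move=> _; rewrite adde_ge0 ?m0.
have mg23 : measurable_fun setT (fun x => k2%:E * g2 x + k3%:E * g3 x)%E.
  by apply: emeasurable_funD; exact: mk.
rewrite -!ge0_integralZl_EFin//.
rewrite -!ge0_integralD//; try solve [exact: mk|exact: m0].
apply: ae_ge0_le_integral => //.
- by move=> x _; rewrite adde_ge0 ?m0.
- by apply: emeasurable_funD => //; exact: mk.
- by move=> x _; apply: adde_ge0; [exact: m0|exact: g230].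
- by apply: emeasurable_funD => //; exact: mk.
- by apply: filterS fg => x fgx _.
Qed.

Lemma ge0_ae_le_integral_cst d (T : measurableType d) (R : realType)
    (P : probability T R) (S : set T) (f : T -> \bar R) (c : R) :
  measurable S -> P (~` S) = 0%E -> measurable_fun setT f -> (forall x, 0 <= f x)%E ->
  0 <= c -> (forall x, S x -> f x <= c%:E)%E -> (\int[P]_x f x <= c%:E)%E.
Proof.
move=> mS PS mf f0 c0 fc.
rewrite -[leRHS]mule1 -(probability_setT P) -integral_cst//.
apply: ae_ge0_le_integral => //.
exists (~` S); split => //; first exact: measurableC.
by move=> x /= nx Sx; apply: nx => _; exact: fc.
Qed.

(** * Where the intermediate measure of a geodesic is concentrated *)

Section Concentration.
Local Open Scope ereal_scope.
Context {R : realType} {n : nat} (X : measured_finsler R n).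
Local Notation prob := (probability (borel X) R).
Implicit Types (mu ms : prob) (A B Q : set (borel X)).

Local Notation cost pi := (\int[pi]_z ((dist (z.1 : X) (z.2 : X)) ^+ 2)%:E).

Lemma weighted_cost_lower (x z z' y : X) (s D delta rho m q : R) :
  (0 < s < 1 -> 0 <= delta -> 0 <= rho -> 0 <= m -> dist x y <= D -> dist z z' < delta ->
   q = 0 \/ q = 1 /\ s * D + rho <= dist x z ->
   m * dist x y ^+ 2 + rho ^+ 2 / s * (m * q) <=
   s^-1 * (m * dist x z ^+ 2) + ((1 - s)^-1 * (m * dist z' y ^+ 2) + 2 * D * delta * m))%R.
Proof.
move=> s01 delta0 rho0 m0 xyD zz' hq.
have tri : (dist x y <= dist x z + delta + dist z' y)%R.
  by have := dist_triangle x z y; have := dist_triangle z z' y; move: zz'; lra.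
have d0D : (0 <= dist x y <= D)%R by rewrite dist_ge0.
have H : (dist x y ^+ 2 + (rho ^+ 2 / s) * q <=
    dist x z ^+ 2 / s + dist z' y ^+ 2 / (1 - s) + 2 * D * delta)%R.
  case: hq => [->|[-> hq]].
    have := transport_cost_lower s01 delta0 (lexx 0%R) d0D tri (or_intror erefl).
    by rewrite expr0n /= mul0r mulr0.
  by rewrite mulr1; exact: (transport_cost_lower s01 delta0 rho0 d0D tri (or_introl hq)).
have := ler_wpM2l m0 H.
set u := dist x y; set v := dist x z; set w := dist z' y.
by rewrite (_ : m * (_ + _) = m * u ^+ 2 + rho ^+ 2 / s * (m * q))%R; [|ring];
  rewrite (_ : m * (_ + _) = s^-1 * (m * v ^+ 2) + ((1 - s)^-1 * (m * w ^+ 2) +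
    2 * D * delta * m))%R; [|ring].
Qed.

Lemma measurable_cost d (T : measurableType d) (f : T -> borel X * borel X) :
  measurable_fun setT f ->
  measurable_fun setT (fun w => ((dist ((f w).1 : X) ((f w).2 : X)) ^+ 2)%:E).
Proof.
move=> mf; apply/measurable_EFinP; apply: measurable_funX.
exact: (measurableT_comp (@measurable_dist _ _ X) mf).
Qed.

(** Suppose that [ms] gives mass p > 0 to the complement of Q. Glue nearly optimal plans and
    integrate [transport_cost_lower]: passing outside Q costs an extra rho^2 / s, so the glued plan
    would have a cost below w once the slack is less than p rho^2 / s. *)
Lemma midpoint_concentration mu0 mu1 ms A B Q (s D rho w : R) :
  (0 < s < 1)%R -> (0 < rho)%R -> (0 <= D)%R ->
  measurable A -> measurable B -> measurable Q ->
  mu0 (~` A) = 0 -> mu1 (~` B) = 0 ->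
  (forall x y, A x -> B y -> (dist (x : X) y <= D)%R) ->
  (forall x z, A x -> ~ Q z -> (s * D + rho <= dist (x : X) z)%R) ->
  (forall eta : R, (0 < eta)%R -> exists2 pi, coupling mu0 ms pi &
     cost pi <= (s ^+ 2 * w + eta)%:E) ->
  (forall eta : R, (0 < eta)%R -> exists2 pi, coupling ms mu1 pi &
     cost pi <= ((1 - s) ^+ 2 * w + eta)%:E) ->
  (forall pi, coupling mu0 mu1 pi -> w%:E <= cost pi) ->
  ms (~` Q) = 0.
Proof.
move=> s01 rho0 D0 mA mB mQ A0 B0 AB AQ near1 near2 w_le.
have /andP[s0 s1] := s01.
have t0 : (0 < 1 - s)%R by rewrite subr_gt0.
have mQC : measurable (~` Q) by exact: measurableC.
have pE : ms (~` Q) = (fine (ms (~` Q)))%:E by rewrite fineK// fin_num_measure.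
set p := fine (ms (~` Q)) in pE.
have p_ge0 : (0 <= p)%R by rewrite fine_ge0.
have [p0|] := leP p 0%R; first by rewrite pE; congr (_%:E); apply/eqP; rewrite eq_le p0.
move=> p0; exfalso.
have [c cE] : exists c, c = (rho ^+ 2 / s)%R by exists (rho ^+ 2 / s)%R.
have c0 : (0 < c)%R by rewrite cE divr_gt0// exprn_gt0.
have [eta [delta [eta0 delta0 slack]]] := transport_slack w s01 D0 (mulr_gt0 c0 p0).
have [pi1 [c1 i1]] : exists pi, coupling mu0 ms pi /\ cost pi <= (s ^+ 2 * w + eta)%:E.
  by have [pi ? ?] := near1 _ eta0; exists pi.
have [pi2 [c2 i2]] : exists pi, coupling ms mu1 pi /\ cost pi <= ((1 - s) ^+ 2 * w + eta)%:E.
  by have [pi ? ?] := near2 _ eta0; exists pi.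
have [idx [midx Hidx]] := small_cells X delta0.
have pi1ms (S : set (borel X)) : measurable S -> pi1 (setT `*` S) = ms S by move=> /c1[].
have pi2ms (S : set (borel X)) : measurable S -> pi2 (S `*` setT) = ms S by move=> /c2[].
have [gam [g1 g2 gI]] := glued_plan midx pi1ms pi2ms.
have gc : coupling mu0 mu1 gam.
  move=> S mS; rewrite g1// g2//; split; first by have [] := c1 S mS.
  by have [] := c2 S mS.
pose om z := (glue_weight ms idx z)%:E.
have mom : measurable_fun setT om.
  by apply/measurable_EFinP; exact: measurable_glue_weight.
have om0 z : 0 <= om z by rewrite lee_fin glue_weight_ge0.
pose d13 (z : (borel X * borel X) * (borel X * borel X)) := ((dist (z.1.1 : X) (z.2.2 : X)) ^+ 2)%:E.
pose d12 (z : (borel X * borel X) * (borel X * borel X)) := ((dist (z.1.1 : X) (z.1.2 : X)) ^+ 2)%:E.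
pose d23 (z : (borel X * borel X) * (borel X * borel X)) := ((dist (z.2.1 : X) (z.2.2 : X)) ^+ 2)%:E.
pose nQ (z : (borel X * borel X) * (borel X * borel X)) := (\1_(setT `*` ~` Q) z.1 : R)%:E.
pose one (z : (borel X * borel X) * (borel X * borel X)) := (1 : \bar R).
have m13 : measurable_fun setT d13 by apply: (measurable_cost (@measurable_outer _ (borel X))).
have m12 : measurable_fun setT d12 by exact: (measurable_cost measurable_fst).
have m23 : measurable_fun setT d23 by exact: (measurable_cost measurable_snd).
have mTQ : measurable (setT `*` ~` Q : set (borel X * borel X)) by exact: measurableX.
have mnQ : measurable_fun setT nQ.
  apply/measurable_EFinP; apply: measurableT_comp measurable_fst.
  exact: measurable_indic.
have mone : measurable_fun setT one by exact: measurable_cst.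
have d13_ge0 z : 0 <= d13 z by rewrite lee_fin sqr_ge0.
have d12_ge0 z : 0 <= d12 z by rewrite lee_fin sqr_ge0.
have d23_ge0 z : 0 <= d23 z by rewrite lee_fin sqr_ge0.
have nQ_ge0 z : 0 <= nQ z by rewrite lee_fin.
have one_ge0 z : 0 <= one z by [].
have mm f : measurable_fun setT f -> measurable_fun setT (fun z => om z * f z).
  by move=> mf; exact: emeasurable_funM.
pose P := (pi1 \x pi2).
have I13 : \int[P]_z (om z * d13 z) = cost gam.
  by rewrite gI//; [exact: (measurable_cost (f := id))|move=> y; rewrite lee_fin sqr_ge0].
have I12 : \int[P]_z (om z * d12 z) = cost pi1.
  apply: (integral_glue1 midx pi1ms pi2ms (H := fun a => (dist (a.1 : X) (a.2 : X) ^+ 2)%:E)) => //.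
    exact: (measurable_cost (f := id)).
  by move=> y; rewrite lee_fin sqr_ge0.
have I23 : \int[P]_z (om z * d23 z) = cost pi2.
  apply: (integral_glue2 midx pi1ms pi2ms (H := fun a => (dist (a.1 : X) (a.2 : X) ^+ 2)%:E)) => //.
    exact: (measurable_cost (f := id)).
  by move=> y; rewrite lee_fin sqr_ge0.
have InQ : \int[P]_z (om z * nQ z) = p%:E.
  transitivity (\int[pi1]_a (\1_(setT `*` ~` Q) a : R)%:E).
    apply: (integral_glue1 midx pi1ms pi2ms (H := fun a => (\1_(setT `*` ~` Q) a : R)%:E)) => //.
    by apply/measurable_EFinP; exact: measurable_indic.
  by rewrite integral_indic// setIT -pE; exact: pi1ms.
have I1 : \int[P]_z (om z * one z) = 1.
  transitivity (\int[pi1]_a 1).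
    by apply: (integral_glue1 midx pi1ms pi2ms (H := fun a => 1)).
  by rewrite integral_cst// mul1e; exact: probability_setT.
have k1 : (0 <= s^-1)%R by rewrite invr_ge0 ltW.
have k2 : (0 <= (1 - s)^-1)%R by rewrite invr_ge0 ltW.
have k3 : (0 <= 2 * D * delta)%R by rewrite !mulr_ge0// ltW.
have k4 : (0 <= c)%R by exact: ltW.
have o0 f : (forall z, 0 <= f z) -> forall z, 0 <= om z * f z.
  by move=> f0 z; exact: mule_ge0.
have LU := @le_integral_combination _ _ _ P _ _ _ _ _ c s^-1 (1 - s)^-1 (2 * D * delta)
  (mm _ m13) (mm _ mnQ) (mm _ m12) (mm _ m23) (mm _ mone) (o0 _ d13_ge0) (o0 _ nQ_ge0)
  (o0 _ d12_ge0) (o0 _ d23_ge0) (o0 _ one_ge0) k4 k1 k2 k3.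
rewrite I13 I12 I23 InQ I1 mule1 in LU.
have {LU} : cost gam + c%:E * p%:E <=
    s^-1%:E * cost pi1 + ((1 - s)^-1%:E * cost pi2 + (2 * D * delta)%:E).
  apply: LU.
  (* The pointwise bound may fail only for quadruples that do not start in A or do not end in B. *)
  exists (((~` A `*` setT) `*` setT) `|` (setT `*` (setT `*` ~` B))); split.
  - apply: measurableU; apply: measurableX => //; apply: measurableX => //; exact: measurableC.
  - apply/eqP; rewrite eq_le measure_ge0 andbT.
    have mCA : measurable (~` A `*` setT : set (borel X * borel X)).
      by apply: measurableX => //; exact: measurableC.
    have mCB : measurable (setT `*` ~` B : set (borel X * borel X)).
      by apply: measurableX => //; exact: measurableC.
    apply: le_trans (measureU2 _ _ _) _; [exact: measurableX..|].
    have PE (S S' : set (borel X * borel X)) : measurable S -> measurable S' ->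
        P (S `*` S') = pi1 S * pi2 S'.
      by move=> mS mS'; exact: product_measure1E.
    rewrite -[leRHS]adde0; apply: leeD; apply: eq_lexx.
      apply: etrans (PE _ _ mCA measurableT) _.
      have [e _] := c1 _ (measurableC mA).
      by rewrite [X in X * _](etrans e A0) mul0e.
    apply: etrans (PE _ _ measurableT mCB) _.
    have [_ e] := c2 _ (measurableC mB).
    by rewrite [X in _ * X](etrans e B0) mule0.
  move=> z /= nz; apply: contrapT => nAB; apply: nz.
  have zA : A z.1.1 by apply: contrapT => ?; apply: nAB; left.
  have zB : B z.2.2 by apply: contrapT => ?; apply: nAB; right.
  rewrite /om /glue_weight; case: ifPn => [/eqP e|_]; last by rewrite !mul0e !mule0 !adde0.
  set m := (_^-1)%R; have m0 : (0 <= m)%R by rewrite invr_ge0 fine_ge0.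
  rewrite /d13 /d12 /d23 /nQ /one !mule1 -!EFinM -!EFinD lee_fin cE.
  apply: weighted_cost_lower => //; [exact: ltW|exact: ltW|exact: AB|exact: Hidx|].
  have [q|q] := pselect (Q z.1.2); [left|right; split; last exact: AQ].
    by rewrite indicE memNset// => -[_ /=]; exact.
  by rewrite indicE mem_set.
move=> /(le_trans (leeD2r _ (w_le _ gc))); rewrite leNgt -EFinM => /negP; apply.
have j1 := lee_wpmul2l (_ : 0 <= s^-1%:E) i1.
have j2 := lee_wpmul2l (_ : 0 <= (1 - s)^-1%:E) i2.
apply: le_lt_trans (leeD (j1 _) (leeD (j2 _) (lexx _))) _; [by rewrite lee_fin..|].
by rewrite -!EFinM -!EFinD lte_fin.
Qed.

Lemma cost_ge0 (pi : probability (borel X * borel X)%type R) : 0 <= cost pi.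
Proof. by apply: integral_ge0 => z _; rewrite lee_fin sqr_ge0. Qed.

Lemma ereal_inf_cost_ge0 mu nu : 0 <= ereal_inf [set cost pi | pi in coupling mu nu].
Proof. by apply/ereal_infP => _ [pi _ <-]; exact: cost_ge0. Qed.

Lemma W2E mu nu (r : R) : W2 mu nu = r%:E ->
  ereal_inf [set cost pi | pi in coupling mu nu] = (r ^+ 2)%:E.
Proof.
rewrite /W2; have := ereal_inf_cost_ge0 mu nu; case: (ereal_inf _) => [x x0| |]//.
- rewrite poweR_EFin => -[<-]; congr (_%:E).
  rewrite -powR_mulrn ?powR_ge0// -powRrM mulVf// powRr1//.
- by rewrite poweRyr// invr_eq0.
Qed.

Lemma coupling_same_law mu mu' nu nu' pi : same_law mu mu' -> same_law nu nu' ->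
  coupling mu nu pi -> coupling mu' nu' pi.
Proof. by move=> h h' c S mS; rewrite -h// -h'//; exact: c. Qed.

(** The product coupling is concentrated on the product of A and B, where the cost is at most
    D^2. *)
Lemma W2_fin_num mu0 mu1 A B (D : R) :
  measurable A -> measurable B -> mu0 (~` A) = 0 -> mu1 (~` B) = 0 ->
  (forall x y, A x -> B y -> (dist (x : X) y <= D)%R) ->
  W2 mu0 mu1 \is a fin_num.
Proof.
move=> mA mB A0 B0 AB.
rewrite fin_num_poweR// ge0_fin_numE ?ereal_inf_cost_ge0//.
pose P : probability (borel X * borel X)%type R := (mu0 \x mu1).
have PA (S S' : set (borel X)) : measurable S -> measurable S' -> P (S `*` S') = mu0 S * mu1 S'.
  by move=> mS mS'; exact: product_measure1E.
have cP : coupling mu0 mu1 P.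
  move=> S mS; split.
    exact: etrans (PA _ _ mS measurableT) (etrans (congr1 _ (probability_setT mu1)) (mule1 _)).
  apply: etrans (PA _ _ measurableT mS) _.
  by rewrite [X in X * _](probability_setT mu0) mul1e.
apply: le_lt_trans (ereal_inf_lbound _) _; first by exists P.
apply: (@le_lt_trans _ _ (D ^+ 2)%:E); last exact: ltry.
have mAB : measurable (A `*` B : set (borel X * borel X)) by exact: measurableX.
have PAB : P (~` (A `*` B)) = 0.
  rewrite probability_setC// (PA _ _ mA mB).
  have one (mu : prob) S : measurable S -> mu (~` S) = 0 -> mu S = 1.
    by move=> mS S0; have := probability_setC mu mS; rewrite S0 => /esym/eqP;
      rewrite sube_eq ?fin_num_measure// add0e => /eqP.
  by rewrite (one mu0 A)// (one mu1 B)// mule1 subee.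
apply: (ge0_ae_le_integral_cst mAB PAB) => //.
- exact: (measurable_cost (f := id)).
- by move=> z; rewrite lee_fin sqr_ge0.
- exact: sqr_ge0.
move=> z [zA zB]; have d0 := dist_ge0 (z.1 : X) z.2; have dD := AB _ _ zA zB.
by rewrite lee_fin ler_sqr// nnegrE// (le_trans d0).
Qed.

(** Along a geodesic the infimal costs of the two halves are s^2 w and (1 - s)^2 w, where w is the
    square of [W2 mu0 mu1]: weighted by 1 / s and 1 / (1 - s) they add up to w exactly, leaving
    nothing for mass outside Q. *)
Lemma geodesic_concentration mu0 mu1 (mu : R -> prob) A B Q (s D rho : R) :
  W2_geodesic mu0 mu1 mu ->
  (0 < s < 1)%R -> (0 < rho)%R -> (0 <= D)%R ->
  measurable A -> measurable B -> measurable Q ->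
  mu0 (~` A) = 0 -> mu1 (~` B) = 0 ->
  (forall x y, A x -> B y -> (dist (x : X) y <= D)%R) ->
  (forall x z, A x -> ~ Q z -> (s * D + rho <= dist (x : X) z)%R) ->
  mu s (~` Q) = 0.
Proof.
move=> [e0 e1 geo] s01 rho0 D0 mA mB mQ A0 B0 AB AQ; have /andP[s0 s1] := s01.
have := W2_fin_num mA mB A0 B0 AB; case WE: (W2 mu0 mu1) => [r| |]// _.
have near t t' : (0 <= t <= t')%R -> (t' <= 1)%R -> forall eta : R, (0 < eta)%R ->
    exists2 pi, coupling (mu t) (mu t') pi & cost pi <= ((t' - t) ^+ 2 * r ^+ 2 + eta)%:E.
  move=> /andP[t0 tt'] t1 eta eta0.
  have := geo _ _ t0 tt' t1; rewrite WE -EFinM => /W2E H.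
  have [|_ [pi c <-] /ltW] := @lb_ereal_inf_adherent _ [set cost pi | pi in coupling (mu t) (mu t')] _ eta0.
    by rewrite H.
  by rewrite H -EFinD exprMn => ?; exists pi.
apply: (@midpoint_concentration mu0 mu1 (mu s) A B Q s D rho (r ^+ 2)) => //.
- move=> eta eta0; have [||pi c ci] := near 0%R s _ _ eta eta0; [by rewrite lexx ltW|exact: ltW|].
  rewrite subr0 in ci; exists pi => //; exact: coupling_same_law c.
- move=> eta eta0; have [||pi c ci] := near s 1%R _ _ eta eta0; [by rewrite !ltW|by []|].
  by exists pi => //; exact: coupling_same_law c.
- by move=> pi c; rewrite -(W2E WE); apply: ereal_inf_lbound; exists pi.
Qed.

End Concentration.

(** * Brunn-Minkowski inequality and volume growth *)

Section GeneralDensity.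
Local Open Scope ereal_scope.
Context d (T : measurableType d) {R : realType}.
Implicit Types (mu : {measure set T -> \bar R}).

Lemma young_powR (al t l : R) : (0 < al < 1)%R -> (0 <= t)%R -> (0 <= l)%R ->
  (t `^ al * l `^ al <= al * (l * t) + (1 - al))%R.
Proof.
move=> /andP[a0 a1] t0 l0.
have := @conjugate_powR R ((t * l) `^ al)%R 1%R al^-1%R (1 - al)^-1%R.
rewrite powR_ge0 ler01 !invr_gt0 a0 subr_gt0 a1 !invrK => /(_ isT isT isT isT).
rewrite subrKC => /(_ erefl).
rewrite mulr1 -powRrM mulfV ?gt_eqF// powRr1 ?mulr_ge0// powR1 mul1r powRM//.
by rewrite [(t * l * al)%R]mulrC [(t * l)%R]mulrC.
Qed.

(** Jensen's inequality by a tangent line: Young's inequality with l = q gives q^al rho^al <= al q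
    rho + (1 - al), whose integral over Q is at most q. *)
Lemma integral_powR_le mu (Q : set T) (rho : T -> R) (q al : R) :
  (0 < al < 1)%R -> measurable Q -> mu Q = q%:E -> measurable_fun setT rho ->
  (forall x, 0 <= rho x)%R -> \int[mu]_(x in Q) (rho x)%:E <= 1 ->
  \int[mu]_(x in Q) (rho x `^ al)%:E <= (q `^ (1 - al))%:E.
Proof.
move=> al01 mQ Qq mrho rho0 I1; have /andP[a0 a1] := al01.
have q_ge0 : (0 <= q)%R by rewrite -lee_fin -Qq.
have mpow : measurable_fun Q (fun x => (rho x `^ al)%:E).
  apply/measurable_EFinP; apply: measurable_funTS.
  exact: (measurableT_comp (measurable_powR al)).
have [q0|q0] := eqVneq q 0%R.
  rewrite null_set_integral//; first by rewrite lee_fin powR_ge0.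
  by rewrite Qq q0.
have qp : (0 < q)%R by rewrite lt_neqAle eq_sym q0.
have H : (q `^ al)%:E * \int[mu]_(x in Q) (rho x `^ al)%:E <= q%:E.
  rewrite -ge0_integralZl_EFin//; last 2 first.
  - by move=> x _; rewrite lee_fin powR_ge0.
  - by rewrite powR_ge0.
  apply: (@le_trans _ _ (\int[mu]_(x in Q) ((al * q)%:E * (rho x)%:E + (1 - al)%:E))).
    apply: ge0_le_integral => //.
    - by move=> x _; rewrite mule_ge0// lee_fin powR_ge0.
    - exact: emeasurable_funM.
    - apply: emeasurable_funD => //; apply: emeasurable_funM => //.
      by apply/measurable_EFinP; exact: measurable_funTS.
    - move=> x _; rewrite -!EFinM -EFinD lee_fin mulrC -mulrA.
      by apply: young_powR => //; exact: ltW.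
  have k0 : (0 <= al * q)%R by rewrite mulr_ge0// ltW.
  have mr : measurable_fun Q (fun x => (rho x)%:E).
    by apply/measurable_EFinP; exact: measurable_funTS.
  rewrite ge0_integralD//; last 3 first.
  - by move=> x _; rewrite mule_ge0// lee_fin.
  - exact: emeasurable_funM.
  - by move=> x _; rewrite lee_fin subr_ge0 ltW.
  rewrite ge0_integralZl_EFin// ?integral_cst//; last by move=> x _; rewrite lee_fin.
  rewrite Qq; apply: le_trans (leeD (lee_wpmul2l _ I1) (lexx _)) _; first by rewrite lee_fin.
  by rewrite mule1 -EFinM -EFinD lee_fin; apply: eq_lexx; ring.
have pa : (0 < q `^ al)%R by rewrite powR_gt0.
have qE : (q = q `^ al * q `^ (1 - al))%R.
  by rewrite -powRD ?q0 ?implybT// subrKC powRr1.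
by move: H; rewrite [leRHS](congr1 EFin qE) EFinM lee_pmul2l.
Qed.

End GeneralDensity.

(** * Entropy of uniform and of concentrated measures *)

Section Entropy.
Local Open Scope ereal_scope.
Context {R : realType} {n : nat} (X : measured_finsler R n).
Local Notation prob := (probability (borel X) R).
Implicit Types (mu : prob) (A B Q : set (borel X)).

Lemma uniform_probability A (a : R) : measurable A -> vol X A = a%:E -> (0 < a)%R ->
  exists mu : prob, forall S, measurable S -> mu S = (a^-1)%:E * vol X (S `&` A).
Proof.
move=> mA Aa a0.
have ia : (0 <= a^-1)%R by rewrite invr_ge0 ltW.
pose nu := mscale (NngNum ia) (mrestr (vol X) mA).
have nuT : nu setT = 1.
  by rewrite /nu /mscale /= /mrestr setTI Aa -EFinM mulVf// gt_eqF.
pose mu : prob := HB.pack nu (Measure_isProbability.Build _ _ _ nu nuT).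
by exists mu.
Qed.

(** [ac_density] is an arbitrary choice of density. It agrees almost everywhere with the uniform one
    because mu, being absolutely continuous, gives no mass to the null set Z. *)
Lemma renyi_entropy_uniform mu A (a N : R) : (1 < N)%R -> measurable A ->
  vol X A = a%:E -> (0 < a)%R ->
  (forall S, measurable S -> mu S = (a^-1)%:E * vol X (S `&` A)) ->
  renyi_entropy N mu = - (a `^ N^-1)%:E.
Proof.
move=> N1 mA Aa a0 muE.
have N0 : (0 < N)%R by exact: lt_trans N1.
have al0 : (0 < 1 - N^-1)%R by rewrite subr_gt0 invf_lt1.
pose rho0 (x : borel X) : R := (a^-1 * \1_A x)%R.
have mrho0 : measurable_fun setT rho0.
  by apply: measurable_funM => //; exact: measurable_indic.
have rho00 x : (0 <= rho0 x)%R by rewrite mulr_ge0// invr_ge0 ltW.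
have muI S : measurable S -> mu S = \int[vol X]_(x in S) (rho0 x)%:E.
  move=> mS; rewrite muE// /rho0; under eq_integral do rewrite EFinM.
  rewrite ge0_integralZl_EFin//.
  - by rewrite integral_indic// setIC.
  - by apply/measurable_EFinP; exact: measurable_indic.
  - by rewrite invr_ge0 ltW.
have [rhoP|] := pselect (exists rho, is_ac_density mu rho); last first.
  move=> nrho; exfalso; apply: nrho; exists rho0; split => //.
  by exists set0; split=> // S mS; rewrite setI0 measure0 adde0 muI.
rewrite /renyi_entropy; congr (- _).
rewrite /ac_density; case: xgetP => [rho _ [mrho rho_ge0 [Z [mZ Z0 rhoE]]]|/(_ rho0) []]; last first.
  split => //; exists set0; split=> // S mS; by rewrite setI0 measure0 adde0 muI.
have Zmu S : measurable S -> mu (S `&` Z) = 0.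
  move=> mS; rewrite muE; last exact: measurableI.
  rewrite (_ : vol X _ = 0) ?mule0//.
  apply/eqP; rewrite eq_le measure_ge0 andbT -Z0 le_measure ?inE//.
    by apply: measurableI => //; exact: measurableI.
  by move=> x [[]].
have ae : ae_eq (vol X) setT (EFin \o rho0) (EFin \o rho).
  apply: integral_ae_eq => //.
  - apply/integrableP; split; first exact/measurable_EFinP.
    under eq_integral do rewrite /= ger0_norm//.
    by rewrite -muI// (le_lt_trans (probability_le1 _ _))// ltry.
  - exact/measurable_EFinP.
  - by move=> S _ mS; rewrite -muI// rhoE// Zmu// adde0.
transitivity (\int[vol X]_x (rho0 x `^ (1 - N^-1))%:E).
  apply: ge0_ae_eq_integral => //.
  - by apply/measurable_EFinP; exact: (measurableT_comp (measurable_powR _)).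
  - by apply/measurable_EFinP; exact: (measurableT_comp (measurable_powR _)).
  - by move=> x _; rewrite lee_fin powR_ge0.
  - by move=> x _; rewrite lee_fin powR_ge0.
  by apply: filterS ae => x /(_ I) [e] _; rewrite e.
rewrite (_ : (fun x => _) = fun x => ((a^-1 `^ (1 - N^-1))%:E * (\1_A x)%:E)); last first.
  apply/funext => x; rewrite -EFinM /rho0; congr (_%:E).
  rewrite powRM ?invr_ge0 ?(ltW a0)//; congr (_ * _)%R.
  rewrite indicE; case: (_ \in _); first by rewrite powR1.
  by rewrite powR0// gt_eqF.
rewrite ge0_integralZl_EFin//.
- rewrite integral_indic// setIT Aa -EFinM; congr (_%:E).
  rewrite -[X in (_ * X)%R]powRr1 ?ltW// -powR_inv1 ?ltW// -powRrM -powRD.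
    by congr (_ `^ _)%R; ring.
  by rewrite (gt_eqF a0) implybT.
- by apply/measurable_EFinP; exact: measurable_indic.
- exact: powR_ge0.
Qed.

(** A singular part is allowed: the density has integral at most 1 on Q and vanishes almost
    everywhere off Q, so Jensen's inequality on Q suffices. *)
Lemma renyi_entropy_ge mu Q (q N : R) : (1 < N)%R -> measurable Q ->
  vol X Q = q%:E -> mu (~` Q) = 0 -> - (q `^ N^-1)%:E <= renyi_entropy N mu.
Proof.
move=> N1 mQ Qq muQ.
have N0 : (0 < N)%R by exact: lt_trans N1.
have al0 : (0 < 1 - N^-1)%R by rewrite subr_gt0 invf_lt1.
have al1 : (1 - N^-1 < 1)%R by rewrite ltrBlDr ltrDl invr_gt0.
rewrite /renyi_entropy leeN2 /ac_density.
(* The default value of [ac_density] is the zero function, for which the entropy is 0. *)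
case: xgetP => [rho _ [mrho rho_ge0 [Z [mZ Z0 rhoE]]]|_]; last first.
  rewrite integral0_eq ?lee_fin ?powR_ge0// => x _.
  by rewrite powR0// gt_eqF.
have mQC : measurable (~` Q) by exact: measurableC.
have mp S : measurable_fun S (fun x => (rho x `^ (1 - N^-1))%:E).
  apply/measurable_EFinP; apply: measurable_funTS.
  exact: (measurableT_comp (measurable_powR _)).
rewrite -(setUv Q) ge0_integral_setU//; last 2 first.
- by move=> x _; rewrite lee_fin powR_ge0.
- by apply/disj_setPS; rewrite setICr.
have mr S : measurable_fun S (fun x => (rho x)%:E).
  by apply/measurable_EFinP; exact: measurable_funTS.
have Ile S : measurable S -> \int[vol X]_(x in S) (rho x)%:E <= mu S.
  by move=> mS; rewrite rhoE// leeDl.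
have I0 : \int[vol X]_(x in ~` Q) (rho x `^ (1 - N^-1))%:E = 0.
  have : \int[vol X]_(x in ~` Q) `|(rho x)%:E| = 0.
    apply/eqP; rewrite eq_le integral_ge0// andbT -[X in _ <= X]muQ.
    by under eq_integral do rewrite gee0_abs ?lee_fin//; exact: Ile.
  move=> /(ae_eq_integral_abs _ mQC (mr _)) ae0.
  rewrite (ge0_ae_eq_integral (g := cst 0)) ?integral0//.
  - by move=> x _; rewrite lee_fin powR_ge0.
  - apply: filterS ae0 => x h /h /= [->]; by rewrite powR0// gt_eqF.
rewrite I0 adde0.
have := @integral_powR_le _ (borel X) R (vol X) Q rho q (1 - N^-1).
rewrite (_ : 1 - (1 - N^-1) = N^-1)%R; last by ring.
apply=> //; first by rewrite al0 al1.
by apply: le_trans (Ile _ mQ) _; exact: probability_le1.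
Qed.

Lemma uniform_dominated mu A (a : R) : measurable A ->
  (forall S, measurable S -> mu S = (a^-1)%:E * vol X (S `&` A)) -> mu `<< vol X.
Proof.
move=> mA muE; apply/null_content_dominatesP => S mS S0.
rewrite muE// (_ : vol X _ = 0) ?mule0//.
apply/eqP; rewrite eq_le measure_ge0 andbT -S0 le_measure ?inE//.
exact: measurableI.
Qed.

Lemma measurable_dist_from (o : X) : measurable_fun setT (fun x : borel X => dist o x).
Proof. by apply: measurable_fun_lt => r; exact: fball_borel. Qed.

Lemma measurable_dist_to (o : X) : measurable_fun setT (fun x : borel X => dist (x : X) o).
Proof. by apply: measurable_fun_lt => r; exact: bball_borel. Qed.

Lemma concentrated_finite_second_moment mu A (o : X) (M : R) : measurable A -> mu (~` A) = 0 ->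
  (0 <= M)%R -> (forall x, A x -> (dist o x <= M /\ dist (x : X) o <= M)%R) ->
  finite_second_moment mu.
Proof.
move=> mA A0 M0 AM; exists o.
apply: (@le_lt_trans _ _ ((M + M) ^+ 2)%:E); last exact: ltry.
apply: (ge0_ae_le_integral_cst mA A0).
- apply/measurable_EFinP; apply: measurable_funX; apply: measurable_funD.
    exact: measurable_dist_from.
  exact: measurable_dist_to.
- by move=> x; rewrite lee_fin sqr_ge0.
- exact: sqr_ge0.
move=> x /AM[h1 h2]; rewrite lee_fin ler_sqr ?nnegrE ?addr_ge0 ?dist_ge0//.
exact: lerD.
Qed.

Lemma brunn_minkowski (N : R) A B Q (a b q s D rho M : R) (o : X) : (1 < N)%R -> CD0 X N ->
  (0 < s < 1)%R -> (0 < rho)%R -> (0 <= D)%R -> (0 <= M)%R ->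
  measurable A -> measurable B -> measurable Q ->
  vol X A = a%:E -> vol X B = b%:E -> vol X Q = q%:E -> (0 < a)%R -> (0 < b)%R ->
  (forall x, A x \/ B x -> (dist o x <= M /\ dist (x : X) o <= M)%R) ->
  (forall x y, A x -> B y -> (dist (x : X) y <= D)%R) ->
  (forall x z, A x -> ~ Q z -> (s * D + rho <= dist (x : X) z)%R) ->
  ((1 - s) * a `^ N^-1 + s * b `^ N^-1 <= q `^ N^-1)%R.
Proof.
move=> N1 [_ cd] s01 rho0 D0 M0 mA mB mQ Aa Bb Qq a0 b0 AM AB AQ.
have /andP[s0 s1] := s01.
have [mu0 mu0E] := uniform_probability mA Aa a0.
have [mu1 mu1E] := uniform_probability mB Bb b0.
have A0 : mu0 (~` A) = 0.
  by rewrite mu0E ?setICl ?measure0 ?mule0//; exact: measurableC.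
have B0 : mu1 (~` B) = 0.
  by rewrite mu1E ?setICl ?measure0 ?mule0//; exact: measurableC.
have [||||mu [geo _ conv]] := cd mu0 mu1.
- exact: uniform_dominated mu0E.
- exact: uniform_dominated mu1E.
- by apply: (concentrated_finite_second_moment mA A0 M0) => x Ax; apply: AM; left.
- by apply: (concentrated_finite_second_moment mB B0 M0) => x Bx; apply: AM; right.
have Q0 := geodesic_concentration geo s01 rho0 D0 mA mB mQ A0 B0 AB AQ.
have s01' : (0 <= s <= 1)%R by rewrite !ltW.
have := le_trans (renyi_entropy_ge N1 mQ Qq Q0) (conv _ _ (lexx N) s01').
rewrite (renyi_entropy_uniform N1 mA Aa a0 mu0E) (renyi_entropy_uniform N1 mB Bb b0 mu1E).
rewrite -!EFinN -!EFinM -EFinD lee_fin; lra.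
Qed.

End Entropy.

(** * Volume expansion and the growth of balls *)

Section Growth.
Context {R : realType} {n : nat} (X : measured_finsler R n).
Implicit Types (A B Q E : set (borel X)) (o x y z : X).

(** A forward ball gives no direct control of the distances back to its centre; its precompactness
    does, and makes forward balls [dist_bounded]. *)
Lemma fball_dist_to_bounded o r : forward_complete X ->
  exists M : R, forall x, fball o r x -> dist x o <= M.
Proof.
move=> /(fball_precompact o r)[K cK oK].
have [||||A [M AM] KA] := @compact_ind X (fun A => exists M : R, forall x, A x -> dist x o <= M) K.
- by exists 0.
- move=> A B [M AM] [M' BM]; exists (Num.max M M') => x [/AM|/BM] h.
    by rewrite le_max h.
  by rewrite le_max h orbT.
- move=> x _; exists (bball x 1); first exact: nbhs_bball.
  exists (1 + dist x o) => y; rewrite /bball /= => yx.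
  by have := dist_triangle y x o; lra.
- exact: cK.
by exists M => x /oK/KA/AM.
Qed.

Lemma dist_bounded_from_to o (E : set X) : dist_bounded E ->
  exists2 M : R, 0 <= M & forall x, E x -> dist o x <= M /\ dist x o <= M.
Proof.
move=> [[p [r Ep]] [q [r' Eq]]].
exists (`|dist o p + r| + `|dist q o + r'|); first by rewrite addr_ge0.
move=> x Ex; have := Ep x Ex; have := Eq x Ex; rewrite /fball /bball /= => h h'.
have t1 := dist_triangle o p x; have t2 := dist_triangle x q o.
have a1 := ler_norm (dist o p + r); have a2 := ler_norm (dist q o + r').
have b1 := normr_ge0 (dist o p + r); have b2 := normr_ge0 (dist q o + r').
by split; lra.
Qed.

Lemma vol_fballE o r : forward_complete X ->
  vol X (fball o r) = (fine (vol X (fball o r)))%:E.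
Proof. by move=> fc; rewrite fineK// ge0_fin_numE ?vol_fball. Qed.

(* Brunn-Minkowski between A and the ball of center o and radius r, at the time
   s at which the ball contributes an expansion by e, as r goes to infinity. *)
Lemma volume_expansion (N : R) A Q (a q e k : R) o :
  1 < N -> forward_complete X -> CD0 X N -> measurable A -> measurable Q ->
  dist_bounded A -> vol X A = a%:E -> 0 < a -> vol X Q = q%:E -> 0 < e ->
  (forall x z, A x -> ~ Q z -> e <= dist x z) -> 0 <= k ->
  (\forall r \near +oo, 0 < fine (vol X (fball o r)) /\
     k * r <= fine (vol X (fball o r)) `^ N^-1) ->
  a `^ N^-1 + e * k <= q `^ N^-1.
Proof.
move=> N1 fc cd mA mQ bA Aa a0 Qq e0 AQ k0 near_k.
have [M M0 AM] := dist_bounded_from_to o bA.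
set a' := a `^ N^-1; have a'0 : 0 <= a' by exact: powR_ge0.
apply/ler_addgt0Pr => eta eta0.
pose c := e * (a' + k * (M + 1)).
have c0 : 0 <= c by rewrite mulr_ge0 ?addr_ge0 ?mulr_ge0 ?addr_ge0// ltW.
have [r [[r0 re rc] [fr kr]]] : exists r, [/\ 0 <= r, e <= r & c / eta <= r] /\
    (0 < fine (vol X (fball o r)) /\ k * r <= fine (vol X (fball o r)) `^ N^-1).
  have H : \forall r \near +oo, Num.max e (c / eta) <= r.
    by apply: nbhs_pinfty_ge; exact: num_real.
  near +oo_R => r; exists r.
  have : Num.max e (c / eta) <= r by near: r.
  rewrite ge_max => /andP[h1 h2]; split; last by near: r.
  by split => //; apply: le_trans h1; exact: ltW.
have [M' BM'] := fball_dist_to_bounded o r fc.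
pose D := M + r; have D0 : 0 <= D by rewrite addr_ge0.
have D1 : 0 < D + 1 by rewrite ltr_wpDl.
(* With rho = s this gives s D + rho = e exactly. The loss compared with the limit r = +oo is s (a'
   + k (M + 1)), which is at most eta since r >= c / eta. *)
pose s := e / (D + 1).
have s0 : 0 < s by rewrite divr_gt0.
have s1 : s < 1 by rewrite ltr_pdivrMr// mul1r; apply: le_lt_trans re _; rewrite /D; lra.
have rho0 : 0 < e / (D + 1) by exact: s0.
have sD : s * D + s = e by rewrite /s; field; rewrite gt_eqF.
have := @brunn_minkowski R n X N A (fball o r) Q a (fine (vol X (fball o r))) q s D s
  (M + r + `|M'|) o N1 cd.
rewrite s0 s1 sD => /(_ isT isT D0); rewrite -/a'.
set b' := _ `^ _ in kr *.
have H1 : 0 <= M + r + `|M'| by rewrite !addr_ge0.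
move=> /(_ H1 mA (fball_borel o r) mQ Aa (vol_fballE o r fc) Qq a0 fr).
have n0 := normr_ge0 M'; have nM := ler_norm M'.
have H2 x : A x \/ fball o r x -> dist o x <= M + r + `|M'| /\ dist x o <= M + r + `|M'|.
  move=> [/AM[h1 h2]|h]; first by split; lra.
  by have h' := BM' x h; rewrite /fball /= in h; split; lra.
have H3 x y : A x -> fball o r y -> dist x y <= D.
  move=> /AM[_ h]; rewrite /fball /= => h'; have := dist_triangle x o y; rewrite /D; lra.
move=> /(_ H2 H3 AQ).
have h5 : s * (k * r) <= s * b' by rewrite ler_pM2l.
have h6 : s * (k * r) = e * k - s * (k * (M + 1)).
  by rewrite -[in RHS]sD /D; ring.
have h7 : s * (a' + k * (M + 1)) <= eta.
  rewrite /s mulrAC ler_pdivrMr// -/c -ler_pdivrMl// mulrC.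
  by apply: le_trans rc _; rewrite /D; lra.
rewrite h6 in h5.
have -> : (1 - s) * a' = a' - s * a' by ring.
move: h5 h7; rewrite mulrDr; lra.
Unshelve. all: by end_near. Qed.

Local Notation ball_vol o r := (fine (vol X (fball o r))).

Lemma Gamma_ge0 (s : R) : 0 <= Gamma s.
Proof.
apply: Rintegral_ge0 => x _; by rewrite mulr_ge0 ?powR_ge0 ?expR_ge0.
Qed.

Lemma omega_ge0 (N : R) : 0 <= omega N.
Proof. by rewrite divr_ge0 ?powR_ge0 ?Gamma_ge0. Qed.

(** [lim] takes the default value 0 when there is no limit, so positivity forces convergence. *)
Lemma AVR_cvg (N : R) o : (0 < AVR N o)%E ->
  (vol X (fball o r) * ((omega N * r `^ N)^-1)%:E)%E @[r --> +oo%R] --> AVR N o.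
Proof.
move=> A0; set F := (X in X --> _).
have [//|nc] := pselect (cvg F).
by move: A0; rewrite /AVR (dvgP nc) ltxx.
Qed.

(** If [omega N] were 0, its inverse would be 0 by convention and so would the volume ratio; this
    spares the positivity of the Gamma integral. *)
Lemma omega_gt0 (N : R) o : (0 < AVR N o)%E -> 0 < omega N.
Proof.
move=> A0; rewrite lt_neqAle omega_ge0 andbT eq_sym; apply/eqP => w0.
move: (A0); rewrite /AVR w0.
under eq_fun do rewrite mul0r invr0 mule0.
by rewrite lim_cst ?ltxx.
Qed.

Lemma AVR_ball_vol (N : R) o : forward_complete X -> (0 < AVR N o)%E ->
  (ball_vol o r / (omega N * r `^ N))%:E @[r --> +oo%R] --> AVR N o.
Proof.
move=> fc A0; have := AVR_cvg A0.
by under eq_fun do rewrite (vol_fballE o _ fc) -EFinM.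
Qed.

Lemma powR_inv_ltl (N x y : R) : 0 < N -> 0 <= x -> 0 <= y -> x `^ N < y -> x < y `^ N^-1.
Proof.
move=> N0 x0 y0 xy; have := gt0_ltr_powR (_ : 0 < N^-1) _ _ xy.
by rewrite !nnegrE powR_ge0 invr_gt0 y0 -powRrM divff ?gt_eqF// powRr1//; apply.
Qed.

Lemma powR_inv_ltr (N x y : R) : 0 < N -> 0 <= x -> 0 <= y -> y < x `^ N -> y `^ N^-1 < x.
Proof.
move=> N0 x0 y0 xy; have := gt0_ltr_powR (_ : 0 < N^-1) _ _ xy.
by rewrite !nnegrE powR_ge0 invr_gt0 y0 -powRrM divff ?gt_eqF// powRr1//; apply.
Qed.

Lemma ball_vol_lower (N k : R) o : 0 < N -> forward_complete X -> (0 < AVR N o)%E ->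
  0 <= k -> ((k `^ N / omega N)%:E < AVR N o)%E ->
  \forall r \near +oo, 0 < ball_vol o r /\ k * r <= ball_vol o r `^ N^-1.
Proof.
move=> N0 fc A0 k0 kA.
have w0 := omega_gt0 A0.
have H : \forall y \near AVR N o, ((k `^ N / omega N)%:E < y)%E.
  exact: open_ereal_gt' kA.
have H2 := cvg_near (AVR_ball_vol fc A0) H.
near=> r.
have r0 : 0 < r by near: r; apply: nbhs_pinfty_gt; exact: num_real.
have : ((k `^ N / omega N)%:E < (ball_vol o r / (omega N * r `^ N))%:E)%E by near: r.
have rN : 0 < r `^ N by rewrite powR_gt0.
have e : k `^ N / omega N * (omega N * r `^ N) = (k * r) `^ N.
  by rewrite mulrA divfK ?gt_eqF// powRM ?(ltW r0).
rewrite lte_fin ltr_pdivlMr ?e; last exact: mulr_gt0.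
move=> h; split; first by apply: le_lt_trans h; exact: powR_ge0.
by apply/ltW/powR_inv_ltl => //; rewrite ?mulr_ge0 ?(ltW r0)// fine_ge0.
Unshelve. all: by end_near. Qed.

Lemma ball_vol_upper (N k : R) o : 0 < N -> forward_complete X -> (0 < AVR N o)%E ->
  0 <= k -> (AVR N o < (k `^ N / omega N)%:E)%E ->
  \forall r \near +oo, ball_vol o r `^ N^-1 <= k * r.
Proof.
move=> N0 fc A0 k0 kA.
have w0 := omega_gt0 A0.
have H : \forall y \near AVR N o, (y < (k `^ N / omega N)%:E)%E.
  exact: open_ereal_lt' kA.
have H2 := cvg_near (AVR_ball_vol fc A0) H.
near=> r.
have r0 : 0 < r by near: r; apply: nbhs_pinfty_gt; exact: num_real.
have : ((ball_vol o r / (omega N * r `^ N))%:E < (k `^ N / omega N)%:E)%E by near: r.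
have rN : 0 < r `^ N by rewrite powR_gt0.
have e : k `^ N / omega N * (omega N * r `^ N) = (k * r) `^ N.
  by rewrite mulrA divfK ?gt_eqF// powRM ?(ltW r0).
rewrite lte_fin ltr_pdivrMr ?e; last exact: mulr_gt0.
by move=> h; apply/ltW/powR_inv_ltr => //; rewrite ?mulr_ge0 ?(ltW r0)// fine_ge0.
Unshelve. all: by end_near. Qed.

(** With an infinite ratio every linear rate k is available. For k = q + 1, where q is the N-th root
    of the volume of the ball of radius r0 + 1, expanding the ball of radius r0 by 1 would already
    exceed q. *)
Lemma AVR_lty (N : R) o : 1 < N -> forward_complete X -> CD0 X N -> (0 < AVR N o)%E ->
  (AVR N o < +oo)%E.
Proof.
move=> N1 fc cd A0; rewrite ltNge leye_eq; apply/negP => /eqP Ay.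
have N0 : 0 < N by exact: lt_trans N1.
have grow k : 0 <= k -> \forall r \near +oo, 0 < ball_vol o r /\ k * r <= ball_vol o r `^ N^-1.
  by move=> k0; apply: ball_vol_lower => //; rewrite Ay ltry.
have [r0 fr] : exists r, 0 < ball_vol o r.
  have := grow 0 (lexx _) => g; near +oo_R => r; exists r.
  have [//] : 0 < ball_vol o r /\ 0 * r <= ball_vol o r `^ N^-1 by near: r.
pose q := ball_vol o (r0 + 1) `^ N^-1.
have q0 : 0 <= q by exact: powR_ge0.
have [M BM] := fball_dist_to_bounded o r0 fc.
have bA : dist_bounded (fball o r0).
  split; first by exists o, r0.
  by exists o, (M + 1) => x /BM; rewrite /bball /=; lra.
have := @volume_expansion N (fball o r0) (fball o (r0 + 1)) (ball_vol o r0) (ball_vol o (r0 + 1)) 1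
  (q + 1) o N1 fc cd (fball_borel _ _) (fball_borel _ _) bA (vol_fballE _ _ fc) fr
  (vol_fballE _ _ fc) ltr01.
rewrite -/q mul1r; have := powR_ge0 (ball_vol o r0) N^-1 => p0 H.
have q1 : 0 <= q + 1 by rewrite addr_ge0.
have : ball_vol o r0 `^ N^-1 + (q + 1) <= q.
  apply: H => //; last exact: grow.
  move=> x z; rewrite /fball /= => h1 /negP; rewrite -leNgt => h2.
  have := dist_triangle o x z; lra.
lra.
Unshelve. all: by end_near. Qed.

End Growth.

(** * The isoperimetric inequality *)

Section Levels.
Context {R : realType}.

(** The tangent inequality for the convex function t^N, read off from Young's inequality with
    exponents N and N / (N - 1) applied to p and q^(N - 1). *)
Lemma powR_tangent (N p q : R) : 1 < N -> 0 <= p -> 0 <= q ->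
  q `^ N + N * q `^ (N - 1) * (p - q) <= p `^ N.
Proof.
move=> N1 p0 q0; have N0 : 0 < N by exact: lt_trans N1.
have M0 : 0 < N - 1 by rewrite subr_gt0.
have := @conjugate_powR R p (q `^ (N - 1)) N (N / (N - 1)) p0 (powR_ge0 _ _) N0.
rewrite divr_gt0// -powRrM mulrCA divff ?gt_eqF// mulr1 => /(_ isT).
have -> : N^-1 + (N / (N - 1))^-1 = 1 by field; rewrite !gt_eqF.
move=> /(_ erefl) /(ler_wpM2l (ltW N0)); have := mulr_powRB1 q0 N0.
set qn := q `^ N; set qm := q `^ (N - 1); set x := p `^ N => h.
have -> : N * (x / N + qn / (N / (N - 1))) = x + N * qn - qn.
  by field; rewrite !gt_eqF.
have -> : N * qm * (p - q) = N * (p * qm) - N * (q * qm) by ring.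
rewrite h; lra.
Qed.

(** This is the tangent at q - e, evaluated at q. Taking the slope there and not at a makes the
    bound depend on the larger set only; the truncation and the alternative a = 0 cover an empty
    eroded level set. *)
Lemma powR_increment (N a q e : R) : 1 < N -> 0 <= a -> 0 <= e -> 0 <= q ->
  a + e <= q \/ a = 0 -> N * e * (Num.max (q - e) 0) `^ (N - 1) <= q `^ N - a `^ N.
Proof.
move=> N1 a0 e0 q0 aeq; have N0 : 0 < N by exact: lt_trans N1.
have aN : a <= Num.max (q - e) 0.
  by rewrite le_max; case: aeq => [h|->]; [rewrite lerBrDr h|rewrite lexx orbT].
have h : a `^ N <= Num.max (q - e) 0 `^ N.
  by apply: ge0_ler_powR (aN); rewrite ?nnegrE ?(ltW N0)// (le_trans a0 aN).
move: h; have [qe|qe] := leP (q - e) 0.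
  rewrite (@powR0 _ N) ?gt_eqF// powR0 ?gt_eqF ?subr_gt0// mulr0 subr_ge0.
  by move=> /le_trans; apply; exact: powR_ge0.
move=> h; have := powR_tangent N1 q0 (ltW qe); rewrite subKr mulrAC; lra.
Qed.

(** The sum is the ceiling of x capped at J: a discrete layer-cake formula with rounding error at
    most 1. *)
Lemma count_levels (J : nat) (x : R) : 0 <= x ->
  Num.min x J%:R <= \sum_(i < J) (i%:R < x)%R%:R <= x + 1.
Proof.
move=> x0; elim: J => [|J /andP[IH1 IH2]].
  by rewrite big_ord0 ge_min lexx orbT addr_ge0.
rewrite big_ord_recr /=; have [Jx|xJ] := ltP J%:R x.
  have : \sum_(i < J) (i%:R < x)%R%:R <= J%:R :> R.
    rewrite -[X in _ <= X%:R]card_ord -sumr_const; apply: ler_sum => i _.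
    by case: (_ < _).
  move: IH1; rewrite (min_idPr (ltW Jx)) -natr1 ge_min -[nat_of_bool true]/1%N => h1 h2.
  by apply/andP; split; [apply/orP; right|]; lra.
rewrite addr0 IH2 andbT; move: IH1; rewrite (min_idPl xJ) => h.
by rewrite ge_min h.
Qed.

Local Open Scope ereal_scope.

Lemma superlevel_subset T (v f : T -> R) (S : set T) (i J : nat) :
  (forall x, ~ S x -> v x = 0%R) -> (forall x, 0 <= f x <= v x)%R ->
  [set x | (i%:R < J%:R * f x)%R] `<=` S.
Proof.
move=> vS fv x /= ix; apply: contrapT => nS; move: ix; have := fv x.
by rewrite (vS x nS) => /le_anti <-; rewrite mulr0 ltNge ler0n.
Qed.

(** Integrate [count_levels] for J v and J w over S. Rounding costs at most 1 at each point of S,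
    thus [mu S] in all, a term that does not grow with J and vanishes after division by J. *)
Lemma sum_level_sets d (T : measurableType d) (mu : {measure set T -> \bar R})
    (v w : T -> R) (G : T -> \bar R) (S : set T) (e : R) (J : nat) :
  (0 <= e)%R -> measurable S -> measurable_fun setT v -> measurable_fun setT w ->
  measurable_fun S G -> (forall x, 0 <= G x) ->
  (forall x, 0 <= w x <= v x)%R -> (forall x, v x <= 1)%R ->
  (forall x, ~ S x -> v x = 0%R) ->
  (forall x, S x -> (v x - w x)%:E <= e%:E * G x) ->
  \sum_(i < J) mu [set x | (i%:R < J%:R * v x)%R] <=
  \sum_(i < J) mu [set x | (i%:R < J%:R * w x)%R] +
    ((J%:R * e)%:E * \int[mu]_(x in S) G x + mu S).
Proof.
move=> e0 mS mv mw mG G0 wv v1 vS vwG.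
have Je : (0 <= J%:R * e)%R by rewrite mulr_ge0.
have mlev (f : T -> R) (i : nat) : measurable_fun setT f ->
    measurable [set x | (i%:R < J%:R * f x)%R].
  by move=> mf; apply: measurable_superlevel; exact: measurable_funM.
have levS (f : T -> R) (i : nat) : (forall x, 0 <= f x <= v x)%R ->
    [set x | (i%:R < J%:R * f x)%R] `<=` S.
  by move=> fv; exact: superlevel_subset fv.
have vv x : (0 <= v x <= v x)%R.
  by have /andP[h1 h2] := wv x; rewrite lexx andbT (le_trans h1).
have muE (f : T -> R) : measurable_fun setT f -> (forall x, 0 <= f x <= v x)%R ->
    \sum_(i < J) mu [set x | (i%:R < J%:R * f x)%R] =
    \int[mu]_(x in S) (\sum_(i < J) (i%:R < J%:R * f x)%R%:R)%R%:E.
  move=> mf fv; under [RHS]eq_integral do rewrite -sumEFin.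
  have ind i : (fun x => ((i%:R < J%:R * f x)%R%:R : R)%:E) =
      (fun x => (\1_[set x | (i%:R < J%:R * f x)%R] x)%:E).
    by apply/funext => x; rewrite indicE; congr (_%:R%:E); rewrite mem_setE.
  rewrite ge0_integral_sum//; last first.
    by move=> i; rewrite ind; apply/measurable_EFinP; apply: measurable_indic; exact: mlev.
  apply: eq_bigr => i _; rewrite ind integral_indic//; last exact: mlev.
  by rewrite (setIidl (levS _ _ fv)).
rewrite !muE//.
have -> : mu S = \int[mu]_(x in S) 1 by rewrite integral_cst// mul1e.
have mcount (f : T -> R) : measurable_fun setT f ->
    measurable_fun S (fun x => (\sum_(i < J) (i%:R < J%:R * f x)%R%:R : R)%R%:E).
  move=> mf; apply/measurable_EFinP; apply: measurable_sum => i.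
  rewrite (_ : (fun x => _) = (\1_[set x | (i%:R < J%:R * f x)%R] : T -> R)).
    by apply: measurable_indic; exact: mlev.
  by apply/funext => x; rewrite indicE; congr (_%:R); rewrite mem_setE.
have c0 (f : T -> R) x : 0 <= (\sum_(i < J) (i%:R < J%:R * f x)%R%:R : R)%R%:E.
  by rewrite lee_fin sumr_ge0.
have meG : measurable_fun S (fun x => (J%:R * e)%:E * G x) by exact: emeasurable_funM.
have eG0 x : 0 <= (J%:R * e)%:E * G x by rewrite mule_ge0.
rewrite -ge0_integralZl_EFin// -ge0_integralD// -ge0_integralD//; last 3 first.
- exact: mcount.
- by move=> x _; rewrite adde_ge0.
- exact: emeasurable_funD.
apply: ge0_le_integral => //.
- exact: mcount.
- by apply: emeasurable_funD; [exact: mcount|exact: emeasurable_funD].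
move=> x Sx.
have /andP[w0 wvx] := wv x.
have J0 : (0 <= J%:R :> R)%R by exact: ler0n.
have /andP[_ h1] := count_levels J (mulr_ge0 J0 (le_trans w0 wvx)).
have /andP[h2 _] := count_levels J (mulr_ge0 J0 w0).
have {}h2 : (J%:R * w x <= \sum_(i < J) (i%:R < J%:R * w x)%R%:R)%R.
  apply: le_trans h2; rewrite le_min lexx /= -[leRHS]mulr1 ler_wpM2l//.
  exact: le_trans (v1 x).
have h3 := vwG x Sx.
apply: (@le_trans _ _ ((J%:R * w x)%:E + (J%:R%:E * (v x - w x)%:E + 1))).
  by rewrite -EFinM -!EFinD lee_fin mulrBr; lra.
apply: leeD; first by rewrite lee_fin.
apply: leeD => //; rewrite EFinM -muleA.
by apply: lee_wpmul2l => //; rewrite lee_fin.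
Qed.

End Levels.

(** * Erosion of a function *)

Section Erosion.
Context {R : realType} {n : nat} (X : measured_finsler R n).
Implicit Types (v : X -> R) (x y : X) (e : R).

Definition erosion v e x : R := inf [set v y | y in fball x e].

Variables (v : X -> R) (e : R).
Hypotheses (v0 : forall x, 0 <= v x) (e0 : 0 < e).

Lemma erosion_le x y : dist x y < e -> erosion v e x <= v y.
Proof.
move=> xy; apply: ge_inf; last by exists y.
by exists 0 => _ [z _ <-].
Qed.

Lemma le_erosion x r : (forall y, dist x y < e -> r <= v y) -> r <= erosion v e x.
Proof.
move=> H; apply: lb_le_inf => [|_ [y xy <-]]; last exact: H.
by exists (v x), x => //; rewrite /fball /= dist_refl.
Qed.

Lemma erosion_ge0 x : 0 <= erosion v e x.
Proof. by apply: le_erosion. Qed.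

Lemma erosion_le_self x : erosion v e x <= v x.
Proof. by apply: erosion_le; rewrite dist_refl. Qed.

(** Strict sublevel sets of an erosion are unions of backward balls, hence open, whatever v is. *)
Lemma measurable_erosion : measurable_fun setT (erosion v e : borel X -> R).
Proof.
apply: measurable_fun_lt => r; apply: open_borel.
rewrite (_ : [set x | _] = \bigcup_(y in [set y | v y < r]) bball y e).
  by apply: bigcup_open => y _; exact: open_bball.
apply/seteqP; split => x /=; last first.
  by move=> [y /= yr xy]; exact: le_lt_trans (erosion_le xy) yr.
move=> xr; apply: contrapT => nH; move: xr; rewrite ltNge => /negP; apply.
apply: le_erosion => y xy; rewrite leNgt; apply/negP => yr; apply: nH.
by exists y.
Qed.

End Erosion.

(** * The slope at a positive scale *)

Section SlopeScale.
Context {R : realType} {n : nat} (X : measured_finsler R n).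
Hypothesis no_isolated : forall (x : X) A, nbhs x A -> exists2 y, A y & y != x.
Implicit Types (u : X -> R) (x y : X) (d : R).

(** Uniform version of the slope, bounding descents from x over the whole forward ball of radius d.
    At an isolated point the supremum could be that of the empty set, -oo; [no_isolated] excludes
    it. *)
Definition slope_scale u d x : \bar R :=
  ereal_sup [set (Num.max (u x - u y) 0 / dist x y)%:E |
    y in [set y | y != x /\ dist x y < d]].

Lemma slope_scale_ge0 u d x : 0 < d -> (0 <= slope_scale u d x)%E.
Proof.
move=> /(nbhs_fball x)/no_isolated[y xy yx].
apply: (@le_trans _ _ (Num.max (u x - u y) 0 / dist x y)%:E).
  by rewrite lee_fin divr_ge0 ?dist_ge0// le_max lexx orbT.
by apply: ereal_sup_ubound; exists y.
Qed.

Lemma slope_scale_mono u d d' x : d <= d' -> (slope_scale u d x <= slope_scale u d' x)%E.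
Proof.
move=> dd'; apply: le_ereal_sup => _ [y [yx xy] <-]; exists y => //.
by split => //; exact: lt_le_trans dd'.
Qed.

Lemma slope_scale_descent u d x y : 0 < d -> dist x y < d ->
  ((Num.max (u x - u y) 0)%:E <= (dist x y)%:E * slope_scale u d x)%E.
Proof.
move=> d0 xy; have [->|yx] := eqVneq y x.
  by rewrite subrr maxxx mule_ge0 ?slope_scale_ge0// lee_fin dist_ge0.
have xy0 : 0 < dist x y by apply: dist_gt0; rewrite eq_sym.
rewrite -[leLHS](_ : (dist x y)%:E * (Num.max (u x - u y) 0 / dist x y)%:E = _)%E.
  by apply: lee_wpmul2l; [rewrite lee_fin ltW|apply: ereal_sup_ubound; exists y].
by rewrite -EFinM mulrC divfK// gt_eqF.
Qed.

(** Forward balls form a neighbourhood base, so each punctured neighbourhood in the limsup contains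
    a punctured ball of radius 1 / (k + 1). *)
Lemma slope_scale_le_slope u x : (ereal_inf [set slope_scale u k.+1%:R^-1 x | k in setT] <= slope u x)%E.
Proof.
rewrite /slope limf_esupE; apply/ereal_infP => _ [V xV <-].
have [r r0 rV] := fball_nbhs_base (xV : nbhs x [set y | y != x -> V y]).
have [k kr] := inv_nat_small r0.
apply: le_trans (ereal_inf_lbound _) _; first by exists k.
apply: le_ereal_sup => _ [y [yx xy] <-]; exists y => //.
by apply: rV => //; exact: lt_trans kr.
Qed.

Lemma slope_ge0 u x : (0 <= slope u x)%E.
Proof.
apply: le_trans (slope_scale_le_slope u x); apply/ereal_infP => _ [k _ <-].
exact: slope_scale_ge0.
Qed.

Lemma loc_lipschitz_continuous u : loc_lipschitz u -> continuous u.
Proof.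
move=> Lu x; have [U [L [xU HU]]] := Lu x.
apply/cvgrPdist_lt => e e0.
have L1 : 0 < `|L| + 1 by rewrite ltr_wpDl.
have H := nbhs_fball x (divr_gt0 e0 L1).
have Ux := nbhs_singleton xU.
apply: filterS (filterI xU H) => y [Uy]; rewrite /fball /= => xy.
apply: le_lt_trans (HU _ _ Ux Uy) _.
apply: (@le_lt_trans _ _ ((`|L| + 1) * dist x y)).
  by rewrite ler_wpM2r ?dist_ge0//; have := ler_norm L; lra.
by rewrite -ltr_pdivlMl// mulrC.
Qed.

(** Lower semicontinuity: a quotient at x with end point y that exceeds r >= 0 still does so, with
    the same y, for starting points near x. For r < 0 the superlevel set is everything. *)
Lemma measurable_slope_scale u d : 0 < d -> loc_lipschitz u ->
  measurable_fun setT (slope_scale u d : borel X -> \bar R).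
Proof.
move=> d0 Lu; have cu := loc_lipschitz_continuous Lu.
move=> mT; apply: (measurability _ (ErealGenOInfty.measurableE R)) => // _ [_ [r ->] <-].
rewrite setTI; apply: open_borel.
have [r0|r0] := ltP r 0.
  rewrite (_ : _ @^-1` _ = setT); first exact: openT.
  apply/seteqP; split => // x _ /=; rewrite in_itv/= andbT.
  by apply: lt_le_trans (slope_scale_ge0 u x d0); rewrite lte_fin.
rewrite openE => x /=; rewrite in_itv/= andbT => /ereal_sup_gt[_ [y [yx xy] <-]].
have xy0 : 0 < dist x y by apply: dist_gt0; rewrite eq_sym.
rewrite lte_fin ltr_pdivlMr// lt_max => /orP[h|]; last first.
  by rewrite ltNge mulr_ge0// ltW.
have cd : {for x, continuous (fun z : X => dist z y)}.
  apply: (@continuous_comp _ _ _ (fun z : X => (z, y)) (fun p : X * X => dist p.1 p.2)).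
    by apply: cvg_pair; [exact: cvg_id|exact: cvg_cst].
  exact: dist_continuous.
have h1 : \forall z \near x, dist z y < d.
  exact: (cvg_near cd (lt_nbhsl xy)).
have h2 : \forall z \near x, 0 < u z - u y - r * dist z y.
  have c2 : (fun z => u z - u y - r * dist z y) z @[z --> x] --> u x - u y - r * dist x y.
    by apply: cvgB; [apply: cvgB; [exact: cu|exact: cvg_cst]|apply: cvgMr; exact: cd].
  by rewrite -subr_gt0 in h; exact: (cvg_near c2 (lt_nbhsr h)).
have h3 : \forall z \near x, 0 < dist z y by exact: (cvg_near cd (lt_nbhsr xy0)).
apply: filterS3 h1 h2 h3 => z z1 z2 z3 /=; rewrite in_itv/= andbT.
apply: (@lt_le_trans _ _ (Num.max (u z - u y) 0 / dist z y)%:E).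
  by rewrite lte_fin ltr_pdivlMr// lt_max -subr_gt0 z2.
apply: ereal_sup_ubound; exists y => //; split => //.
by apply/eqP => e; move: z3; rewrite e dist_refl ltxx.
Qed.

(** The local constants become one constant at one scale by compactness; this provides the
    dominating function when the scale tends to 0. *)
Lemma lipschitz_scale u (K : set X) : loc_lipschitz u -> compact K ->
  exists d L : R, [/\ 0 < d, 0 <= L & forall x y, K x -> dist x y < d ->
    u x - u y <= L * dist x y].
Proof.
move=> Lu cK.
have [||||A [d [L [d0 L0 H]]] KA] := @compact_ind X (fun A => exists d L : R,
    [/\ 0 < d, 0 <= L & forall x y, A x -> dist x y < d -> u x - u y <= L * dist x y]) K.
- by exists 1, 0; split.
- move=> A B [d [L [d0 L0 HA]]] [d' [L' [d'0 L'0 HB]]].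
  exists (Num.min d d'), (L + L'); split; [by rewrite lt_min d0|exact: addr_ge0|].
  move=> x y ABx; rewrite lt_min => /andP[xd xd']; have xy0 := dist_ge0 x y.
  rewrite mulrDl; have h := mulr_ge0 L0 xy0; have h' := mulr_ge0 L'0 xy0.
  by case: ABx => [Ax|Bx]; [have := HA x y Ax xd|have := HB x y Bx xd']; lra.
- move=> x _; have [U [L [xU HU]]] := Lu x.
  have [r r0 rU] := fball_nbhs_base xU.
  have r2 : 0 < r / 2 by rewrite divr_gt0.
  exists (fball x (r / 2)); first exact: nbhs_fball.
  exists (r / 2), `|L|; split => // y z; rewrite /fball /= => xy yz.
  have Uy : U y by apply: rU; rewrite /fball /=; lra.
  have Uz : U z by apply: rU; rewrite /fball /=; have := dist_triangle x y z; lra.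
  apply: le_trans (ler_norm _) _; apply: le_trans (HU _ _ Uy Uz) _.
  by rewrite ler_wpM2r ?dist_ge0 ?ler_norm.
- exact: cK.
by exists d, L; split => // x y Kx; apply: H; exact: KA.
Qed.

Lemma slope_scale_bounded u (K : set X) : loc_lipschitz u -> compact K ->
  exists d L : R, [/\ 0 < d, 0 <= L & forall x, K x -> (slope_scale u d x <= L%:E)%E].
Proof.
move=> Lu /(lipschitz_scale Lu)[d [L [d0 L0 H]]]; exists d, L; split => // x Kx.
apply: ge_ereal_sup => _ [y [yx xy] <-]; rewrite lee_fin.
have xy0 : 0 < dist x y by apply: dist_gt0; rewrite eq_sym.
rewrite ler_pdivrMr// ge_max mulr_ge0 ?(ltW xy0)// andbT; exact: H.
Qed.

End SlopeScale.

Lemma powR_root_sub_le (R : realType) (N b q c : R) : 1 < N -> 0 <= b -> b <= q ->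
  (Num.max (b `^ N^-1 - c) 0) `^ (N - 1) <= (Num.max (q `^ N^-1 - c) 0) `^ (N - 1).
Proof.
move=> N1 b0 bq; have N0 : 0 < N by exact: lt_trans N1.
have h : b `^ N^-1 <= q `^ N^-1.
  apply: ge0_ler_powR; rewrite ?nnegrE ?invr_ge0 ?(ltW N0)//; exact: le_trans bq.
have h2 : Num.max (b `^ N^-1 - c) 0 <= Num.max (q `^ N^-1 - c) 0.
  by apply: le_max2 => //; rewrite lerD2r.
by apply: ge0_ler_powR (h2); rewrite ?nnegrE ?subr_ge0 ?(ltW N1)// le_max lexx orbT.
Qed.

Section Isoperimetry.
Context {R : realType} {n : nat} (X : measured_finsler R n).
Local Notation ball_vol o r := (fine (vol X (fball o r))).
Implicit Types (E : set (borel X)) (u v : X -> R) (o x y : X).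

(* Each level set {v > i/J} contains the e-neighbourhood of {erosion v e > i/J};
   the sum of their volumes differs by at most J times the integral of
   v - erosion v e, up to the volume of the support. *)
Lemma erosion_level_inequality (N k e lam b r : R) o v (G : borel X -> \bar R) :
  1 < N -> forward_complete X -> CD0 X N -> 0 <= k ->
  (\forall r \near +oo, 0 < ball_vol o r /\ k * r <= ball_vol o r `^ N^-1) ->
  0 < e -> 0 <= lam <= 1 -> 0 <= b ->
  measurable_fun setT (v : borel X -> R) -> measurable_fun (fball o r : set (borel X)) G ->
  (forall x, (0 <= G x)%E) -> (forall x, 0 <= v x <= 1) ->
  (forall x, ~ fball o r x -> v x = 0) ->
  (forall x, fball o r x -> ((v x - erosion v e x)%:E <= e%:E * G x)%E) ->
  (forall t : R, 0 <= t < lam -> (b%:E <= vol X [set x | (t < v x)%R])%E) ->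
  ((lam * N * k * (Num.max (b `^ N^-1 - e * k) 0) `^ (N - 1))%:E <=
    \int[vol X]_(x in fball o r) G x)%E.
Proof.
move=> N1 fc cd k0 growth e0 /andP[lam0 lam1] b0 mv mG G0 v01 vS vG vb.
have N0 : 0 < N by exact: lt_trans N1.
have v0 x : 0 <= v x by have /andP[] := v01 x.
have mw := @measurable_erosion R n X v e v0 e0.
set w := erosion v e in vG mw *.
set S := fball o r in mG vS vG *.
have mS : measurable (S : set (borel X)) by exact: fball_borel.
have SV := vol_fballE o r fc; rewrite -/S in SV; set V := fine _ in SV.
have wv x : 0 <= w x <= v x by rewrite (erosion_ge0 v0 e0) (erosion_le_self v0 e0).
have I0 : (0 <= \int[vol X]_(x in S) G x)%E by apply: integral_ge0.
case IE : (\int[vol X]_(x in S) G x)%E I0 => [I| |//] I0; last by rewrite leey.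
set p := _ `^ (N - 1); have p0 : 0 <= p by exact: powR_ge0.
rewrite lee_fin.
(* V does not depend on J: dividing by J + 1 and letting J grow gives the claim, by the Archimedean
   property. *)
suff H J : J.+1%:R * (lam * N * k * p - I) * e <= V.
  rewrite leNgt; apply/negP; rewrite -subr_gt0 => gt0.
  have := mulr_gt0 gt0 e0 => gt1.
  have := archi_boundP (divr_ge0 (fine_ge0 (measure_ge0 (vol X) S)) (ltW gt1)).
  rewrite ltr_pdivrMr// -/V => h; have := H (Num.bound (V / ((lam * N * k * p - I) * e))).
  rewrite -mulrA -natr1; set m := (X in X%:R) in h *; lra.
have lev_open i (f : borel X -> R) : measurable_fun setT f -> measurable [set x | (i%:R < J.+1%:R * f x)%R].
  by move=> mf; apply: measurable_superlevel; exact: measurable_funM.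
have J0 : 0 < J.+1%:R :> R by rewrite ltr0n.
have levE (f : borel X -> R) (i : nat) : (forall x, 0 <= f x <= v x) ->
    [set x | i%:R < J.+1%:R * f x] `<=` S.
  by move=> fv; exact: superlevel_subset fv.
have vv x : 0 <= v x <= v x by rewrite lexx v0.
have finE (f : borel X -> R) (i : nat) : measurable_fun setT f -> (forall x, 0 <= f x <= v x) ->
    vol X [set x | i%:R < J.+1%:R * f x] = (fine (vol X [set x | i%:R < J.+1%:R * f x]))%:E.
  move=> mf fv; rewrite fineK// ge0_fin_numE//; apply: le_lt_trans (ltry V).
  by rewrite -SV le_measure ?inE//; [exact: lev_open|exact: levE].
pose q (i : nat) := fine (vol X [set x | i%:R < J.+1%:R * v x]).
pose a (i : nat) := fine (vol X [set x | i%:R < J.+1%:R * w x]).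
have v1 x : v x <= 1 by have /andP[] := v01 x.
have := @sum_level_sets R _ (borel X) (vol X) v w G S e J.+1 (ltW e0) mS mv mw mG G0 wv v1 vS vG.
under eq_bigr do rewrite finE//.
under [X in (_ <= X + _)%E]eq_bigr do rewrite finE//.
rewrite IE SV !sumEFin -EFinM -!EFinD lee_fin => sum_le.
have {}sum_le : \sum_(i < J.+1) q i <= \sum_(i < J.+1) a i + (J.+1%:R * e * I + V) := sum_le.
(* Levels i / (J + 1) below lam have volume at least b and yield the full increment; for the others
   only monotonicity is used. *)
have aq (i : 'I_J.+1) : (i%:R < lam * J.+1%:R)%R%:R * (N * (e * k) * p) <= q i - a i.
  have a_ge0 : 0 <= a i by exact: fine_ge0.
  have q_ge0 : 0 <= q i by exact: fine_ge0.
  have ek : 0 <= e * k by rewrite mulr_ge0// ltW.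
  have main : N * (e * k) * (Num.max (q i `^ N^-1 - e * k) 0) `^ (N - 1) <= q i - a i.
    have rK (x : R) : 0 <= x -> (x `^ N^-1) `^ N = x.
      by move=> x0; rewrite -powRrM mulVf ?gt_eqF// powRr1.
    rewrite -[X in _ <= X - _](rK (q i))// -[X in _ <= _ - X](rK (a i))//.
    apply: powR_increment => //; rewrite ?powR_ge0//.
    have [ai0|ai0] := ltP 0 (a i); last first.
      by right; rewrite (_ : a i = 0) ?powR0 ?invr_eq0 ?gt_eqF//; apply/eqP; rewrite eq_le ai0.
    left; apply: (@volume_expansion R n X N [set x | i%:R < J.+1%:R * w x]
      [set x | i%:R < J.+1%:R * v x] (a i) (q i) e k o) => //.
    - exact: lev_open.
    - exact: lev_open.
    - have [M BM] := fball_dist_to_bounded o r fc.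
      split; first by exists o, r; exact: levE.
      exists o, (M + 1) => x /(levE w i wv)/BM; rewrite /bball /=; lra.
    - exact: finE.
    - exact: finE.
    move=> x z /= ax /negP; rewrite -leNgt => qz; rewrite leNgt; apply/negP => xz.
    have := lt_le_trans ax (ler_wpM2l (ltW J0) (erosion_le v0 xz)); lra.
  have Nek : 0 <= N * (e * k) by apply: mulr_ge0; [exact: ltW|exact: ek].
  apply: le_trans main; have [ilam|_] := ltP; last first.
    rewrite mul0r; apply: mulr_ge0; [exact: Nek|exact: powR_ge0].
  rewrite -[nat_of_bool true]/1%N mul1r; apply: ler_wpM2l; first exact: Nek.
  apply: powR_root_sub_le; [exact: N1|exact: b0|].
  rewrite -lee_fin -finE; [|exact: mv|exact: vv].
  have -> : [set x | i%:R < J.+1%:R * v x] = [set x | i%:R / J.+1%:R < v x].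
    by apply/seteqP; split => x /=; rewrite ltr_pdivrMr// mulrC.
  apply: vb; apply/andP; split; first by rewrite divr_ge0.
  by rewrite ltr_pdivrMr.
have lamJ : 0 <= lam * J.+1%:R by rewrite mulr_ge0.
have /andP[cnt _] := count_levels J.+1 lamJ.
rewrite (min_idPl _) in cnt; last by rewrite -[leRHS]mul1r ler_wpM2r.
have sum_ge : (\sum_(i < J.+1) (i%:R < lam * J.+1%:R)%R%:R) * (N * (e * k) * p) <=
    \sum_(i < J.+1) q i - \sum_(i < J.+1) a i.
  by rewrite -sumrB mulr_suml; apply: ler_sum => i _; exact: aq.
have c0 : 0 <= N * (e * k) * p by rewrite !mulr_ge0// ltW.
have := ler_wpM2r c0 cnt.
have -> : lam * J.+1%:R * (N * (e * k) * p) = J.+1%:R * (lam * N * k * p) * e by ring.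
rewrite mulrBr mulrBl -[J.+1%:R * I * e]mulrA [I * e]mulrC mulrA; lra.
Qed.

End Isoperimetry.

(** * Truncation of a competitor *)

Section Cutoff.
Context {R : realType} {n : nat} (X : measured_finsler R n).
Hypothesis no_isolated : forall (x : X) A, nbhs x A -> exists2 y, A y & y != x.
Local Notation ball_vol o r := (fine (vol X (fball o r))).
Implicit Types (E : set (borel X)) (u v : X -> R) (o x y : X).

Definition clamp01 (t : R) : R := Num.min (Num.max t 0) 1.

Lemma clamp01_itv t : 0 <= clamp01 t <= 1.
Proof. by rewrite /clamp01 le_min le_max lexx ler01 orbT ge_min lexx orbT. Qed.

Lemma clamp01_sub_le a b : clamp01 a - clamp01 b <= Num.max (a - b) 0.
Proof.
rewrite /clamp01 le_max; apply/orP.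
have [h1|h1] := leP a 0; have [h2|h2] := leP b 0; rewrite ?(min_idPl (@ler01 R));
  have [h3|h3] := leP a 1; have [h4|h4] := leP b 1; by [left; lra|right; lra].
Qed.

Lemma clamp01_ge1 t : 1 <= t -> clamp01 t = 1.
Proof. by move=> h; rewrite /clamp01 (max_idPl _) ?(min_idPr _)//; lra. Qed.

Lemma clamp01_le0 t : t <= 0 -> clamp01 t = 0.
Proof. by move=> h; rewrite /clamp01 (max_idPr h) (min_idPl _). Qed.

Lemma clamp01_le_norm t : clamp01 t <= `|t|.
Proof.
rewrite /clamp01 ge_min ge_max normr_ge0 ler_norm//.
Qed.

Lemma measurable_clamp01 d (T : measurableType d) (f : T -> R) :
  measurable_fun setT f -> measurable_fun setT (fun t : T => clamp01 (f t)).
Proof.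
by move=> mf; apply: measurable_minr => //; exact: measurable_maxr.
Qed.

(** The second factor is 1 on the ball of radius r + 1 and 0 outside that of radius r + 2. The unit
    margin around a set E in the ball of radius r leaves room for erosions of radius at most 1. *)
Definition cutoff u o (r : R) (x : X) : R := clamp01 (u x) * clamp01 (r + 2 - dist o x).

Lemma cutoff_itv u o r x : 0 <= cutoff u o r x <= 1.
Proof.
have /andP[h1 h2] := clamp01_itv (u x); have /andP[h3 h4] := clamp01_itv (r + 2 - dist o x).
by rewrite /cutoff mulr_ge0// mulr_ile1.
Qed.

Lemma cutoff_eq0 u o r x : ~ fball o (r + 2) x -> cutoff u o r x = 0.
Proof.
rewrite /fball /= => /negP; rewrite -leNgt => h.
by rewrite /cutoff (@clamp01_le0 (r + 2 - _)) ?mulr0// subr_le0.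
Qed.

Lemma continuous_measurable_borel u : continuous u -> measurable_fun setT (u : borel X -> R).
Proof.
move=> cu; apply: measurable_fun_lt => r; apply: open_borel.
exact: (open_comp (fun x _ => cu x) (open_lt (y := r))).
Qed.

Lemma measurable_cutoff u o r : continuous u -> measurable_fun setT (cutoff u o r : borel X -> R).
Proof.
move=> cu; apply: measurable_funM; apply: measurable_clamp01.
  exact: continuous_measurable_borel.
by apply: measurable_funB => //; exact: measurable_dist_from.
Qed.

(** If x is in E, the spatial factor is 1 at x and y and only u varies. Off E that factor may drop
    by e, but it multiplies the truncation of u, at most |u| = |u - 1_E|, whose integral is
    small. *)
Lemma cutoff_sub_le u o r E e x y : E `<=` fball o r -> dist x y <= e -> e <= 1 ->
  cutoff u o r x - cutoff u o r y <= Num.max (u x - u y) 0 + e * `|u x - \1_E x|.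
Proof.
move=> Er xy e1; have tri := dist_triangle o x y; have xy0 := dist_ge0 x y.
rewrite /cutoff; set a := clamp01 (u x); set b := clamp01 (u y).
set p := clamp01 (r + 2 - dist o x); set q := clamp01 _.
have h : a - b <= Num.max (u x - u y) 0 := clamp01_sub_le _ _.
have /andP[a0 a1] : 0 <= a <= 1 := clamp01_itv _.
have /andP[q0 q1] : 0 <= q <= 1 := clamp01_itv _.
have -> : a * p - b * q = (a - b) * q + a * (p - q) by ring.
apply: lerD.
  have m0 : 0 <= Num.max (u x - u y) 0 by rewrite le_max lexx orbT.
  by apply: le_trans (ler_wpM2r q0 h) _; rewrite -[leRHS]mulr1 ler_wpM2l.
have [xE|xE] := pselect (E x).
  have := Er x xE; rewrite /fball /= => ox.
  have -> : p = 1 by apply: clamp01_ge1; lra.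
  have -> : q = 1 by apply: clamp01_ge1; lra.
  by rewrite subrr mulr0 mulr_ge0// (le_trans xy0).
rewrite indicE memNset// subr0.
have e0 : 0 <= e by exact: le_trans xy.
have pq : p - q <= e.
  apply: le_trans (clamp01_sub_le _ _) _; rewrite ge_max e0 andbT; lra.
apply: le_trans (ler_wpM2l a0 pq) _; rewrite mulrC ler_wpM2l//.
exact: clamp01_le_norm.
Qed.

(** The level inequality is applied with G the slope at scale d plus |u - 1_E|, the latter paying
    for the spatial cutoff with a total of at most eta. *)
Lemma isoperimetric_at_scale (N k lam beta d eta m r : R) o E u (K : set X) :
  1 < N -> forward_complete X -> CD0 X N -> 0 <= k ->
  (\forall s \near +oo, 0 < ball_vol o s /\ k * s <= ball_vol o s `^ N^-1) ->
  0 < lam < 1 -> 0 <= beta -> 0 < d -> loc_lipschitz u -> measurable E ->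
  E `<=` fball o r -> vol X E = m%:E -> compact K -> fball o (r + 2) `<=` K ->
  (\int[vol X]_(x in K) `|u x - \1_E x|%:E <= eta%:E)%E ->
  beta `^ N < m - eta / (1 - lam) ->
  ((lam * N * k * beta `^ (N - 1))%:E <=
    \int[vol X]_(x in fball o (r + 2)) slope_scale u d x + eta%:E)%E.
Proof.
move=> N1 fc cd k0 growth /andP[lam0 lam1] beta0 d0 Lu mE Er Em cK SK int_le hb.
have N0 : 0 < N by exact: lt_trans N1.
have cu := loc_lipschitz_continuous Lu.
have t0 : 0 < 1 - lam by rewrite subr_gt0.
pose b := m - eta / (1 - lam).
have b0 : 0 <= b by apply: ltW; apply: le_lt_trans hb; exact: powR_ge0.
have bb : beta < b `^ N^-1 by exact: powR_inv_ltl.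
(* The last condition on e gives b^(1/N) - e k >= beta, which removes e from the final bound. *)
have [e [e0 e1 ed ek]] : exists e : R, [/\ 0 < e, e <= 1, e <= d & e * k <= b `^ N^-1 - beta].
  have k1 : 0 < k + 1 by rewrite ltr_wpDl.
  have bb0 : 0 < b `^ N^-1 - beta by rewrite subr_gt0.
  exists (Num.min (Num.min 1 d) ((b `^ N^-1 - beta) / (k + 1))); split.
  - by rewrite !lt_min ltr01 d0 divr_gt0.
  - by rewrite !ge_min lexx.
  - by rewrite !ge_min lexx !orbT.
  apply: (@le_trans _ _ ((b `^ N^-1 - beta) / (k + 1) * k)).
    by apply: ler_wpM2r => //; rewrite ge_min lexx orbT.
  by rewrite mulrAC ler_pdivrMr// ler_wpM2l ?(ltW bb0)//; lra.
pose v := cutoff u o r.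
pose D (x : borel X) : \bar R := `|u x - \1_E x|%:E.
pose G (x : borel X) : \bar R := (slope_scale u d x + D x)%E.
have D0 x : (0 <= D x)%E by rewrite lee_fin.
have ss0 x : (0 <= slope_scale u d x)%E by exact: slope_scale_ge0.
have mss : measurable_fun setT (slope_scale u d : borel X -> \bar R).
  exact: measurable_slope_scale.
have mu' := continuous_measurable_borel cu.
have mD : measurable_fun setT D.
  apply/measurable_EFinP; apply: (measurableT_comp (@normr_measurable R setT)).
  by apply: measurable_funB => //; exact: measurable_indic.
have mG : measurable_fun setT G by exact: emeasurable_funD.
have mK := compact_borel cK.
have mv := measurable_cutoff o r cu.
have mS : measurable (fball o (r + 2) : set (borel X)) by exact: fball_borel.
have D_le (A : set (borel X)) : measurable A -> A `<=` K -> (\int[vol X]_(x in A) D x <= eta%:E)%E.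
  move=> mA AK; apply: le_trans int_le; apply: ge0_subset_integral => //.
  exact: measurable_funTS.
have H1 x : fball o (r + 2) x -> ((v x - erosion v e x)%:E <= e%:E * G x)%E.
  move=> _; rewrite /G; case gE : (slope_scale u d x) (ss0 x) => [g| |//] g0; last first.
    by rewrite addye// gt0_muley ?lte_fin// leey.
  rewrite -EFinD -EFinM lee_fin lerBlDr -lerBlDl; apply: le_erosion => // y xy.
  rewrite lerBlDl -lerBlDr; apply: le_trans (cutoff_sub_le _ Er (ltW xy) e1) _.
  rewrite mulrDr lerD2r.
  have := slope_scale_descent no_isolated u d0 (lt_le_trans xy ed).
  rewrite gE -EFinM lee_fin => /le_trans; apply; apply: ler_wpM2r; last exact: ltW.
  by rewrite -lee_fin.
have H2 (t : R) : 0 <= t < lam -> (b%:E <= vol X [set x | (t < v x)%R])%E.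
  move=> /andP[_ tlam].
  have mlev : measurable [set x : borel X | t < v x].
    exact: measurable_superlevel mv.
  (* Markov's inequality: on E outside [bad] one has u >= lam > t, and [bad] has volume at most eta
     / (1 - lam). Hence the value of b. *)
  pose bad := E `&` [set x : borel X | 1 - lam < `|u x - \1_E x|].
  have mbad : measurable bad.
    by apply: measurableI => //; apply: measurable_superlevel; apply/measurable_EFinP.
  have badK : bad `<=` K by move=> x [/Er ox _]; apply: SK; move: ox; rewrite /fball /=; lra.
  have bad_le : (vol X bad <= (eta / (1 - lam))%:E)%E.
    rewrite -(@lee_pmul2l _ (1 - lam)%:E)//.
    rewrite -EFinM [X in (_ <= X%:E)%E]mulrC divfK ?gt_eqF//.
    apply: le_trans (D_le _ mbad badK); rewrite -integral_cst//.
    apply: le_integral_nonneg => x; first by move=> _; rewrite lee_fin ltW.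
    by move=> [_] /ltW; rewrite lee_fin.
  rewrite /b EFinB leeBlDr// -Em.
  apply: le_trans (leeD2l _ bad_le).
  apply: le_trans (measureU2 _ _ _); [|exact: mlev|exact: mbad].
  apply: le_measure; rewrite ?inE//; first exact: measurableU.
  move=> x xE; have [h|h] := ltP t (v x); [by left|right; split => //=].
  rewrite indicE mem_set// ltNge; apply/negP => h'.
  have ux : lam <= u x by have := ler_norm (1 - u x); rewrite distrC; lra.
  have := Er x xE; rewrite /fball /= => ox.
  move: h; rewrite /v /cutoff (@clamp01_ge1 (r + 2 - _)); last by lra.
  rewrite mulr1 leNgt => /negP; apply; rewrite /clamp01 lt_min lt_max; apply/andP; split.
    by apply/orP; left; lra.
  by lra.
have lam01 : 0 <= lam <= 1 by rewrite !ltW.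
have mGS : measurable_fun (fball o (r + 2) : set (borel X)) G by exact: measurable_funTS.
have G0 x : (0 <= G x)%E by exact: adde_ge0.
have main := erosion_level_inequality N1 fc cd k0 growth e0 lam01 b0 mv mGS G0
  (cutoff_itv u o r) (@cutoff_eq0 u o r) H1 H2.
apply: le_trans (le_trans main _); last first.
  rewrite ge0_integralD//; [|exact: measurable_funTS..].
  by apply: leeD2l; exact: D_le.
rewrite lee_fin; apply: ler_wpM2l; first by rewrite !mulr_ge0// ltW.
apply: ge0_ler_powR; rewrite ?nnegrE ?subr_ge0 ?(ltW N1) ?le_max ?lexx ?orbT//.
by apply/orP; left; lra.
Qed.

End Cutoff.

(** * Passage to the limit in the scale and in the competitors *)

Section IsoperimetricInequality.
Context {R : realType} {n : nat} (X : measured_finsler R n).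
Local Notation ball_vol o r := (fine (vol X (fball o r))).
Implicit Types (E : set (borel X)) (u v : X -> R) (o x y : X).

Lemma AVR_growth_rate (N : R) o : 0 < N -> (0 < AVR N o)%E ->
  exists2 k : R, 0 < k & ((k `^ N / omega N)%:E < AVR N o)%E.
Proof.
move=> N0 A0; have w0 := omega_gt0 A0.
have [v v0 vA] : exists2 v : R, 0 < v & (v%:E < AVR N o)%E.
  case: (AVR N o) A0 => [a a0| _|//]; last by exists 1; rewrite // ltry.
  rewrite lte_fin in a0; exists (a / 2); first by rewrite divr_gt0.
  by rewrite lte_fin ltr_pdivrMr// mulr_natr mulr2n ltrDl.
exists ((omega N * v) `^ N^-1); first by apply: powR_gt0; exact: mulr_gt0.
have wv0 : 0 <= omega N * v by rewrite mulr_ge0// ltW.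
by rewrite -powRrM mulVf ?gt_eqF// powRr1// mulrC mulrA mulVf ?gt_eqF// mul1r.
Qed.

(* Otherwise X would be a single point by connectedness, and have finite volume. *)
Lemma no_isolated_point (N : R) o : 0 < N -> forward_complete X -> (0 < AVR N o)%E ->
  forall x (A : set X), nbhs x A -> exists2 y, A y & y != x.
Proof.
move=> N0 fc A0 x A xA; apply: contrapT => nH.
have Ax y : A y -> y = x.
  by move=> Ay; apply: contrapT => /eqP yx; apply: nH; exists y.
have AE : A = [set x].
  by apply/seteqP; split => y; [exact: Ax|move=> ->; exact: nbhs_singleton].
have oA : open [set x] by rewrite openE => y -> /=; rewrite -AE.
have cA : closed [set x].
  apply: compact_closed; [exact: manifold_hausdorff|exact: compact_set1].
have XE : [set x] = setT.
  apply: (@manifold_connected _ _ X); first by exists x.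
    by exists [set x] => //; rewrite setTI.
  by exists [set x] => //; rewrite setTI.
have [k k0 kA] := AVR_growth_rate N0 A0.
have growth := ball_vol_lower N0 fc A0 (ltW k0) kA.
have xfin : (vol X [set x] < +oo)%E by apply: vol_compact; exact: compact_set1.
pose V := fine (vol X [set x]).
have ball_le r : ball_vol o r <= V.
  apply: fine_le; rewrite ?ge0_fin_numE ?vol_fball//.
  apply: le_measure; rewrite ?inE; [exact: fball_borel| |].
    by apply: open_borel.
  by rewrite XE.
have [r [rV [fr kr]]] : exists r, V `^ N^-1 / k < r /\
    (0 < ball_vol o r /\ k * r <= ball_vol o r `^ N^-1).
  have h : \forall r \near +oo, V `^ N^-1 / k < r by apply: nbhs_pinfty_gt; exact: num_real.
  near +oo_R => r; exists r; split; near: r; [exact: h|exact: growth].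
move: rV; rewrite ltr_pdivrMr// mulrC ltNge => /negP; apply.
apply: le_trans kr _.
by apply: ge0_ler_powR; rewrite ?nnegrE ?invr_ge0 ?(ltW N0) ?fine_ge0 ?ball_le.
Unshelve. all: by end_near. Qed.

Section NoIsolated.
Hypothesis no_isolated : forall (x : X) A, nbhs x A -> exists2 y, A y & y != x.

(** By monotonicity in the scale the infimum is the pointwise limit. Boundedness on K holds from a
    certain scale on, whence the shift by [k0] before dominated convergence. *)
Lemma cvg_integral_slope_scale u (K S : set (borel X)) : loc_lipschitz u -> compact (K : set X) ->
  measurable S -> S `<=` K ->
  (\int[vol X]_(x in S) slope_scale u k.+1%:R^-1 x @[k --> \oo] -->
   \int[vol X]_(x in S) ereal_inf [set slope_scale u k.+1%:R^-1 x | k in setT])%E.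
Proof.
move=> Lu cK mS SK.
have [d [L [d0 L0 HL]]] := slope_scale_bounded Lu cK.
have [k0 k0d] := inv_nat_small d0.
have ms k : measurable_fun S (slope_scale u k.+1%:R^-1 : borel X -> \bar R).
  by apply: measurable_funTS; apply: measurable_slope_scale.
have pw (x : borel X) : slope_scale u k.+1%:R^-1 x @[k --> \oo] -->
    ereal_inf [set slope_scale u k.+1%:R^-1 x | k in setT].
  apply: ereal_nonincreasing_cvgn => i j ij; apply: slope_scale_mono.
  by rewrite lef_pV2 ?posrE// ler_nat.
rewrite -(cvg_shiftn k0) /=.
have := @dominated_convergence _ (borel X) R (vol X) S mS
  (fun k x => slope_scale u (k + k0).+1%:R^-1 x)
  (fun x => ereal_inf [set slope_scale u k.+1%:R^-1 x | k in setT]) (cst L%:E).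
case=> //.
- move=> _; apply: (@emeasurable_fun_cvg _ _ R S (fun k x => slope_scale u k.+1%:R^-1 x)) => //.
- apply: aeW => x _; have := pw x; by rewrite -(cvg_shiftn k0).
- apply/integrableP; split => //.
  under eq_integral do rewrite /= ger0_norm//.
  rewrite integral_cst// lte_mul_pinfty ?lee_fin//.
  apply: le_lt_trans (vol_compact cK).
  by apply: le_measure; rewrite ?inE//; exact: compact_borel.
apply: aeW => x k Sx; rewrite gee0_abs ?slope_scale_ge0//.
apply: le_trans (HL x (SK x Sx)); apply: slope_scale_mono.
apply: ltW; apply: le_lt_trans k0d.
by rewrite lef_pV2 ?posrE// ler_nat ltnS leq_addl.
Qed.

(** The bound at scale d does not depend on d, so it survives the limit along d = 1 / (j + 1), where
    the integrand lies below the slope. *)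
Lemma isoperimetric_function (N k lam beta eta m r : R) o E u (K : set X) :
  1 < N -> forward_complete X -> CD0 X N -> 0 <= k ->
  (\forall s \near +oo, 0 < ball_vol o s /\ k * s <= ball_vol o s `^ N^-1) ->
  0 < lam < 1 -> 0 <= beta -> loc_lipschitz u -> measurable E ->
  E `<=` fball o r -> vol X E = m%:E -> compact K -> fball o (r + 2) `<=` K ->
  (\int[vol X]_(x in K) `|u x - \1_E x|%:E <= eta%:E)%E ->
  beta `^ N < m - eta / (1 - lam) ->
  ((lam * N * k * beta `^ (N - 1))%:E <= \int[vol X]_x slope u x + eta%:E)%E.
Proof.
move=> N1 fc cd k0 growth lam01 beta0 Lu mE Er Em cK SK int_le hb.
have mS := fball_borel o (r + 2).
have := cvg_integral_slope_scale Lu cK mS SK.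
set I := integral _ _ _ => cvgI.
have H : ((lam * N * k * beta `^ (N - 1) - eta)%:E <= I)%E.
  apply: (cvge_ge _ cvgI); apply: nearW => j; rewrite EFinB leeBlDr//.
  have d0 : 0 < j.+1%:R^-1 :> R by [].
  exact: (isoperimetric_at_scale no_isolated N1 fc cd k0 growth lam01 beta0 d0 Lu mE Er Em cK SK int_le hb).
rewrite -leeBlDr// -EFinB; apply: le_trans H _.
apply: (@le_trans _ _ (\int[vol X]_(x in fball o (r + 2)) slope u x)%E).
  apply: le_integral_nonneg => x _; last exact: slope_scale_le_slope.
  by apply/ereal_infP => _ [j _ <-]; exact: slope_scale_ge0.
rewrite [leLHS]integral_mkcond; apply: le_integral_nonneg => x _.
  by rewrite patchE; case: ifP => // _; exact: slope_ge0.
by rewrite patchE; case: ifP => // _; exact: slope_ge0.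
Qed.

End NoIsolated.

Lemma le_limn_einf (f : nat -> \bar R) (a : \bar R) :
  (\forall k \near \oo, (a <= f k)%E) -> (a <= limn_einf f)%E.
Proof.
move=> H; rewrite /limn_einf /limn_esup -/(limf_einf f \oo) limf_einfE.
apply: (@le_trans _ _ (ereal_inf (f @` [set k | (a <= f k)%E]))).
  by apply/ereal_infP => _ [k ak <-].
by apply: ereal_sup_ubound; exists [set k | (a <= f k)%E].
Qed.

Lemma isoperimetric_constantE (N v : R) o : 0 < N -> (0 < AVR N o)%E -> AVR N o = v%:E ->
  ((N * omega N `^ N^-1)%:E * (AVR N o `^ N^-1))%E = (N * (omega N * v) `^ N^-1)%:E.
Proof.
move=> N0 A0 Av; have w0 := omega_gt0 A0; rewrite Av lte_fin in A0.
by rewrite Av poweR_EFin -EFinM powRM ?(ltW w0) ?(ltW A0)// mulrA.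
Qed.

Lemma small_defect (lam c m e : R) : lam < 1 -> c < 1 -> 0 < m -> 0 < e ->
  exists eta, [/\ 0 < eta, eta <= e & c * m < m - eta / (1 - lam)].
Proof.
move=> lam1 c1 m0 e0.
pose gap := (1 - lam) * ((1 - c) * m) / 2.
have gap0 : 0 < gap by rewrite divr_gt0// !mulr_gt0// subr_gt0.
exists (Num.min e gap); split; first by rewrite lt_min e0.
  by rewrite ge_min lexx.
have h : Num.min e gap / (1 - lam) <= (1 - c) * m / 2.
  rewrite ler_pdivrMr ?subr_gt0//; apply: (@le_trans _ _ gap).
    by rewrite ge_min lexx orbT.
  by rewrite /gap; apply: eq_lexx; ring.
have h' : 0 < (1 - c) * m by rewrite mulr_gt0// subr_gt0.
by move: h; set q := _ / (1 - lam); lra.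
Qed.

Lemma isoperimetric (N : R) o : 1 < N -> forward_complete X -> CD0 X N -> (0 < AVR N o)%E ->
  isoperimetric_inequality X N ((N * omega N `^ N^-1)%:E * (AVR N o `^ N^-1))%E.
Proof.
move=> N1 fc cd A0; have N0 : 0 < N by exact: lt_trans N1.
have mulE (a b c d f : R) : a * (a * b) * (c * d * f) = a * c * (a * d) * (b * f) by ring.
have no_isolated := no_isolated_point N0 fc A0.
have [v Av] : exists v : R, AVR N o = v%:E.
  have := AVR_lty N1 fc cd A0; case: (AVR N o) A0 => [v| |]//; by exists v.
rewrite (isoperimetric_constantE N0 A0 Av) => E mE bE.
have w0 := omega_gt0 A0.
have v0 : 0 < v by rewrite -lte_fin -Av.
have wv0 : 0 < omega N * v by exact: mulr_gt0.
set kappa := (omega N * v) `^ N^-1; have kappa0 : 0 < kappa by exact: powR_gt0.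
have kappaN : kappa `^ N = omega N * v.
  by rewrite /kappa -powRrM mulVf ?gt_eqF// powRr1// ltW.
have [M M0 EM] := dist_bounded_from_to o bE.
pose r := M + 1.
have Er : E `<=` fball o r by move=> x /EM[h _]; rewrite /fball /r /=; lra.
have [K cK SK] := fball_precompact o (r + 2) fc.
have Em : vol X E = (fine (vol X E))%:E.
  rewrite fineK// ge0_fin_numE//; apply: le_lt_trans (vol_fball o r fc).
  by apply: le_measure; rewrite ?inE//; exact: fball_borel.
set m := fine _ in Em; have m_ge0 : 0 <= m by rewrite fine_ge0.
apply/ereal_infP => _ [u [Lu cvu] <-].
have int_ge0 k : (0 <= \int[vol X]_x slope (u k) x)%E.
  by apply: integral_ge0 => x _; exact: slope_ge0.
rewrite Em poweR_EFin -EFinM.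
have [m0|m0] := ltP 0 m; last first.
  rewrite (_ : m = 0) ?powR0 ?mulr0; last by apply/eqP; rewrite eq_le m0.
    by apply: le_limn_einf; exact: nearW.
  by rewrite gt_eqF// divr_gt0// subr_gt0.
set m' := m `^ N^-1; have m'0 : 0 < m' by exact: powR_gt0.
have m'N : m' `^ N = m by rewrite /m' -powRrM mulVf ?gt_eqF// powRr1.
have -> : m `^ ((N - 1) / N) = m' `^ (N - 1) by rewrite /m' -powRrM mulrC.
apply/lee_mul01Pr; first by rewrite lee_fin !mulr_ge0 ?powR_ge0// ltW.
move=> c /andP[c0 c1].
have NN : 0 < N + 1 by rewrite addr_gt0.
(* A factor lam is lost three times: on the range of levels, on the growth rate, and on the root m'
   of the mass, which enters with power N - 1. The total loss is lam^(N + 1) = c. *)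
pose lam := c `^ (N + 1)^-1.
have lam0 : 0 < lam by exact: powR_gt0.
have lamN : lam `^ (N + 1) = c by rewrite /lam -powRrM mulVf ?gt_eqF// powRr1// ltW.
have lt1 (p : R) : 0 < p -> forall t, 0 < t < 1 -> t `^ p < 1.
  move=> p0 t /andP[t0 t1]; have e1 : 1 `^ p = 1 :> R by rewrite powR1.
  by rewrite -[ltRHS]e1; apply: gt0_ltr_powR; rewrite ?nnegrE// ltW.
have lam1 : lam < 1 by apply: lt1; rewrite ?invr_gt0// c0.
have lamN1 : lam `^ N < 1 by apply: lt1; rewrite // lam0.
have -> : (c%:E * (N * kappa * m' `^ (N - 1))%:E)%E =
    (lam * N * (lam * kappa) * (lam * m') `^ (N - 1))%:E.
  rewrite -EFinM; congr (_%:E).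
  rewrite powRM ?(ltW lam0) ?(ltW m'0)// -lamN.
  have -> : lam `^ (N + 1) = lam * (lam * lam `^ (N - 1)).
    by rewrite mulr_powRB1 ?(ltW lam0)// powRD ?(gt_eqF lam0) ?implybT// powRr1 ?(ltW lam0)// mulrC.
  exact: mulE.
have growth := @ball_vol_lower R n X N (lam * kappa) o N0 fc A0 (ltW (mulr_gt0 lam0 kappa0)).
have {}growth : \forall s \near +oo, 0 < ball_vol o s /\ lam * kappa * s <= ball_vol o s `^ N^-1.
  apply: growth; rewrite Av lte_fin powRM ?(ltW lam0) ?(ltW kappa0)// kappaN.
  by rewrite mulrCA mulrAC divff ?gt_eqF// mul1r -[ltRHS]mul1r ltr_pM2r.
apply/lee_addgt0Pr => e e0.
have [eta [eta0 eta_e]] := small_defect lam1 lamN1 m0 e0.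
rewrite -{1}m'N -powRM ?(ltW lam0) ?(ltW m'0)// => gap_lt.
rewrite -leeBlDr//; apply: le_limn_einf.
have : \forall k \near \oo, (\int[vol X]_(x in K) `|u k x - \1_E x|%:E < eta%:E)%E.
  have eta0' : (0 < eta%:E)%E by rewrite lte_fin.
  have near0 : \forall y \near (0 : \bar R), (y < eta%:E)%E := open_ereal_lt' eta0'.
  exact: (cvg_near (cvu K cK) near0).
apply: filterS => k /ltW int_le.
have lam01 : 0 < lam < 1 by rewrite lam0.
have := isoperimetric_function no_isolated N1 fc cd (ltW (mulr_gt0 lam0 kappa0)) growth lam01
  (ltW (mulr_gt0 lam0 m'0)) (Lu k) mE Er Em cK SK int_le gap_lt.
rewrite leeBlDr// => /le_trans; apply; apply: leeD2l.
by rewrite lee_fin.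
Qed.

End IsoperimetricInequality.

(** * Sharpness *)

Section Sharpness.
Context {R : realType} {n : nat} (X : measured_finsler R n).
Local Notation ball_vol o r := (fine (vol X (fball o r))).
Implicit Types (u v : X -> R) (o x y z : X).

(* Near x, F is comparable to the Euclidean norm in a chart in both directions. *)
Lemma local_reversibility x :
  exists2 V, nbhs x V & exists2 C : R, 0 <= C & forall y z, V y -> V z -> dist z y <= C * dist y z.
Proof.
have [c cx] := cdom_cover x.
have [m [M [m0 M0 HM]]] := finsler_bounds cx.
have [r r0 rA] := fball_nbhs_base HM.
have [C [C0 [V Vx HV]]] := local_reach cx.
have r4 : 0 < r / 4 by rewrite divr_gt0.
exists (V `&` [set y | dist x y < r / 4 /\ dist y x < r / 4]).
  by apply: filterI => //; exact: nbhs_dist_small.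
exists (C * (2 / m)); first by rewrite mulr_ge0 ?divr_ge0// ltW.
move=> y z [Vy [xy yx]] [Vz [xz zx]].
have [->|yz] := eqVneq z y; first by rewrite dist_refl mulr0.
have yz0 : 0 < dist y z by apply: dist_gt0; rewrite eq_sym.
have [_ _ [L HL LC]] := HV z y Vz Vy.
apply: le_trans (reach_dist HL) _; apply: le_trans LC _.
rewrite -mulrA; apply: ler_wpM2l; first exact: ltW.
have [L' HL' ] : exists2 L', reach y z L' & L' < Num.min (2 * dist y z) (3 * (r / 4)).
  apply: dist_reach; rewrite lt_min; apply/andP; split; first lra.
  by have := dist_triangle y x z; lra.
rewrite lt_min => /andP[L'2 L'r].
have [eta [G [a [b [H ab Ha Hb]]]]] := HL'.
have [ya Ga] := Ha a (lexx _); have [zb Gb] := Hb b (lexx _).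
have := @flow_coord_le R n X c m a b eta G m0 H (ltW ab) _.
rewrite ya zb Ga Gb subr0 distrC => /(_ _) K.
apply: le_trans (K _) _.
  move=> w /andP[aw wb].
  have Gw : G w <= L' by rewrite -Gb; exact: flow_nondecreasing H _ _ wb.
  have dw : dist y (eta w) <= G w.
    by have := reach_dist (flow_restrict H aw); rewrite ya Ga subr0.
  have [|cw mM] := rA (eta w).
    by rewrite /fball /=; have := dist_triangle x y (eta w); lra.
  by split => // v; have /andP[] := mM v.
by rewrite mulrAC ler_wpM2r ?invr_ge0 ?(ltW m0)// ltW.
Qed.

Definition ball_cutoff o (r l : R) (x : X) : R := clamp01 (l * (r - dist o x)).

Lemma clamp01_lipschitz (a b : R) : `|clamp01 a - clamp01 b| <= `|a - b|.
Proof.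
have h := clamp01_sub_le a b; have h' := clamp01_sub_le b a.
rewrite ler_norml lerNl opprB; apply/andP; split.
  by apply: le_trans h' _; rewrite ge_max normr_ge0 distrC ler_norm.
by apply: le_trans h _; rewrite ge_max normr_ge0 ler_norm.
Qed.

(** The triangle inequality bounds dist o y - dist o z by dist z y, in the wrong order when y and z
    are exchanged; local reversibility turns it into a multiple of dist y z. *)
Lemma ball_cutoff_loc_lipschitz o r (l : R) : 0 <= l -> loc_lipschitz (ball_cutoff o r l).
Proof.
move=> l0 x; have [V xV [C C0 HV]] := local_reversibility x.
exists V, (l * (1 + C)); split => // y z Vy Vz.
apply: le_trans (clamp01_lipschitz _ _) _.
rewrite -mulrBr normrM ger0_norm// -mulrA; apply: ler_wpM2l => //.
have h1 := dist_triangle o y z; have h2 := dist_triangle o z y.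
have h3 := HV y z Vy Vz; have yz0 := dist_ge0 y z; have zy0 := dist_ge0 z y.
have h4 : 0 <= C * dist y z by rewrite mulr_ge0.
rewrite mulrDl mul1r ler_norml; apply/andP; split; lra.
Qed.

Lemma ball_cutoff_sub_le o r l x y : 0 <= l ->
  ball_cutoff o r l x - ball_cutoff o r l y <= l * dist x y.
Proof.
move=> l0; apply: le_trans (clamp01_sub_le _ _) _.
rewrite ge_max mulr_ge0 ?dist_ge0// andbT -mulrBr ler_wpM2l//.
by have := dist_triangle o x y; lra.
Qed.

Lemma slope_le u x (c : R) (V : set X) : nbhs x V -> 0 <= c ->
  (forall y, V y -> u x - u y <= c * dist x y) -> (slope u x <= c%:E)%E.
Proof.
move=> xV c0 H; rewrite /slope limf_esupE.
apply: le_trans (ereal_inf_lbound _) _.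
  by exists (V `&` [set y | y != x]) => //; apply: filterS xV => y Vy yx; split.
apply: ge_ereal_sup => _ [y [Vy yx] <-]; rewrite lee_fin.
have xy0 : 0 < dist x y by apply: dist_gt0; rewrite eq_sym.
by rewrite ler_pdivrMr// ge_max mulr_ge0 ?(ltW xy0)// andbT H.
Qed.

(** The slope counts descents only. At distance at least r, sphere included, the function is at its
    minimum 0, and in the smaller open ball it is constantly 1; only the shell remains, with slope
    at most l. *)
Lemma ball_cutoff_slope o r l x : 0 < l ->
  (slope (ball_cutoff o r l) x <= (l * \1_(fball o r `\` fball o (r - l^-1)) x)%:E)%E.
Proof.
move=> l0; have [xr|xr] := ltP (dist o x) r; last first.
  apply: (@le_trans _ _ 0%:E); last by rewrite lee_fin mulr_ge0// ltW.
  apply: (@slope_le _ _ _ setT); [exact: filterT|by []|] => y _.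
  rewrite mul0r {1}/ball_cutoff clamp01_le0 ?sub0r ?oppr_le0.
    by have /andP[] := clamp01_itv (l * (r - dist o y)).
  by rewrite mulr_ge0_le0 ?subr_le0// ltW.
have [xl|xl] := ltP (dist o x) (r - l^-1).
  apply: (@le_trans _ _ 0%:E); last by rewrite lee_fin mulr_ge0// ltW.
  have xV : nbhs x (fball o (r - l^-1)).
    by apply: open_nbhs_nbhs; split => //; exact: open_fball.
  apply: (slope_le xV) => // y yV; rewrite mul0r.
  have one z : dist o z < r - l^-1 -> ball_cutoff o r l z = 1.
    by move=> zl; apply: clamp01_ge1; rewrite mulrC -ler_pdivrMr// mul1r; lra.
  by rewrite !one// subrr.
rewrite indicE mem_set ?mulr1; last first.
  by split => //; apply/negP; rewrite -leNgt.
apply: (@slope_le _ _ _ setT); [exact: filterT|exact: ltW|] => y _.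
by apply: ball_cutoff_sub_le; exact: ltW.
Qed.

Lemma integral_ball_cutoff_slope o r l : forward_complete X -> 0 < l ->
  (forall x (A : set X), nbhs x A -> exists2 y, A y & y != x) ->
  (\int[vol X]_x slope (ball_cutoff o r l) x <=
    (l * (ball_vol o r - ball_vol o (r - l^-1)))%:E)%E.
Proof.
move=> fc l0 no_isolated.
have mD : measurable (fball o r `\` fball o (r - l^-1) : set (borel X)).
  by apply: measurableD; exact: fball_borel.
apply: (@le_trans _ _ (\int[vol X]_x (l%:E * (\1_(fball o r `\` fball o (r - l^-1)) x)%:E))%E).
  apply: le_integral_nonneg => x _; first exact: slope_ge0.
  by rewrite -EFinM; exact: ball_cutoff_slope.
rewrite ge0_integralZl_EFin ?(ltW l0)//; last first.
  by apply/measurable_EFinP; exact: measurable_indic.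
rewrite integral_indic// setIT EFinM; apply: lee_wpmul2l; first by rewrite lee_fin ltW.
rewrite measureD; [|exact: fball_borel|exact: fball_borel|exact: vol_fball].
rewrite setIidr; last first.
  by move=> x; rewrite /fball /= => h; apply: lt_le_trans h _; rewrite gerBl invr_ge0 ltW.
by rewrite EFinB -!vol_fballE.
Qed.

Lemma ball_cutoff_cvg_L1loc o r :
  cvg_L1loc (fun k => ball_cutoff o r k.+1%:R) (\1_(fball o r : set X)).
Proof.
move=> K cK; have mK := compact_borel cK.
have mB := fball_borel o r.
pose f k (x : borel X) : \bar R := `|ball_cutoff o r k.+1%:R x - \1_(fball o r) x|%:E.
have mf k : measurable_fun (K : set (borel X)) (f k).
  apply/measurable_EFinP; apply: measurable_funTS.
  apply: (measurableT_comp (@normr_measurable R setT)); apply: measurable_funB.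
    apply: measurable_clamp01; apply: measurable_funM => //.
    by apply: measurable_funB => //; exact: measurable_dist_from.
  exact: measurable_indic.
have pw (x : borel X) : f k x @[k --> \oo] --> (0 : \bar R).
  apply: cvg_near_cst; have [xr|xr] := ltP (dist o x) r; last first.
    apply: nearW => k; rewrite /f /ball_cutoff clamp01_le0.
      by rewrite indicE memNset ?subrr ?normr0// => /=; apply/negP; rewrite -leNgt.
    by rewrite mulr_ge0_le0// subr_le0.
  have rx0 : 0 < r - dist o x by rewrite subr_gt0.
  have [k0 hk0] := inv_nat_small rx0.
  exists k0 => // k /= k0k; rewrite /f /ball_cutoff clamp01_ge1.
    by rewrite indicE mem_set ?subrr ?normr0.
  rewrite mulrC -ler_pdivrMr// mul1r; apply: le_trans (ltW hk0).
  by rewrite lef_pV2 ?posrE// ler_nat ltnS.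
have le1 k x : (f k x <= 1)%E.
  rewrite lee_fin; have /andP[h1 h2] := clamp01_itv (k.+1%:R * (r - dist o x)).
  have [h3 h4] : (0 : R) <= \1_(fball o r) x /\ (\1_(fball o r) x : R) <= 1.
    by split; rewrite indicE; case: (_ \in _); rewrite ?lexx ?ler01.
  by rewrite ler_norml; apply/andP; rewrite /ball_cutoff; split; lra.
have := @dominated_convergence _ (borel X) R (vol X) K mK f (cst 0%E) (cst 1%E) mf.
case=> //.
- by apply: aeW => x _; exact: pw.
- apply/integrableP; split => //.
  under eq_integral do rewrite /= normr1.
  by rewrite integral_cst// mul1e; exact: vol_compact.
- by apply: aeW => x k _; rewrite gee0_abs ?lee_fin//; exact: (le1 k x).
by move=> _ _; rewrite integral0.
Qed.

Lemma lt_limn_einf (f : nat -> \bar R) (a : \bar R) :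
  (a < limn_einf f)%E -> \forall k \near \oo, (a < f k)%E.
Proof.
rewrite /limn_einf /limn_esup -/(limf_einf f \oo) limf_einfE => /ereal_sup_gt[_ [V oV <-] aV].
by apply: filterS oV => k Vk; apply: lt_le_trans aV _; apply: ereal_inf_lbound; exists k.
Qed.

(* The infimum of the s for which the bound holds between s and r is r0. *)
Lemma backward_growth (h : R -> R) (c r0 r : R) : {homo h : s t / s <= t} -> r0 <= r ->
  0 <= c ->
  (forall s delta, r0 < s -> 0 < delta -> exists e, [/\ 0 < e, e <= delta & c * e <= h s - h (s - e)]) ->
  c * (r - r0) <= h r - h r0.
Proof.
move=> hmono r0r c0 H.
pose S := [set s | r0 <= s <= r /\ c * (r - s) <= h r - h s].
have Sr : S r by split; [rewrite r0r lexx|rewrite !subrr mulr0].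
have infS : has_inf S by split; [exists r|exists r0 => s [/andP[]]].
have r0i : r0 <= inf S by apply: lb_le_inf; [exists r|move=> s [/andP[]]].
have ir : inf S <= r by apply: ge_inf => //; exact: infS.2.
have Si : S (inf S).
  split; first by rewrite r0i.
  apply/ler_addgt0Pr => e e0.
  have c1 : 0 < c + 1 by rewrite ltr_wpDl.
  have [s [/andP[rs sr] hs] si] := inf_adherent (divr_gt0 e0 c1) infS.
  have is_ : inf S <= s by apply: ge_inf; [exact: infS.2|split; rewrite ?rs].
  have hm := hmono _ _ is_.
  have h1 : c * (s - inf S) <= e.
    apply: (@le_trans _ _ ((c + 1) * (s - inf S))).
      by rewrite ler_wpM2r ?subr_ge0//; lra.
    by rewrite mulrC -ler_pdivlMr//; lra.
  have -> : c * (r - inf S) = c * (r - s) + c * (s - inf S) by ring.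
  lra.
have [e|r0i'] := eqVneq (inf S) r0; first by have [_] := Si; rewrite e.
have {}r0i' : r0 < inf S by rewrite lt_neqAle eq_sym r0i'.
have d0 : 0 < inf S - r0 by rewrite subr_gt0.
have [e [e0 ed he]] := H _ _ r0i' d0.
have : inf S <= inf S - e.
  apply: ge_inf; first exact: infS.2.
  split; first by apply/andP; split; lra.
  have [_ hi] := Si.
  have -> : c * (r - (inf S - e)) = c * (r - inf S) + c * e by ring.
  lra.
lra.
Qed.

(** Let h be the N-th root of the volume of balls about o. Cutoffs on a shell of width 1 / (j + 1)
    bound the perimeter of a ball by difference quotients of h^N, and the tangent inequality turns a
    constant above N c into backward quotients of h at least c. So h(r) >= c (r - r0), against h(r)
    <= k r with k < c for large r. *)
Lemma isoperimetric_sharp (N : R) o (C : \bar R) : 1 < N -> forward_complete X -> CD0 X N ->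
  (0 < AVR N o)%E ->
  ((N * omega N `^ N^-1)%:E * (AVR N o `^ N^-1) < C)%E -> ~ isoperimetric_inequality X N C.
Proof.
move=> N1 fc cd A0 KC iso; have N0 : 0 < N by exact: lt_trans N1.
have no_isolated := no_isolated_point N0 fc A0.
have w0 := omega_gt0 A0.
have [v Av] : exists v : R, AVR N o = v%:E.
  by have := AVR_lty N1 fc cd A0; case: (AVR N o) A0 => [v| |]//; exists v.
have v0 : 0 < v by rewrite -lte_fin -Av.
move: KC; rewrite (isoperimetric_constantE N0 A0 Av).
set kappa := (omega N * v) `^ N^-1 => KC.
have wv0 : 0 < omega N * v by exact: mulr_gt0.
have kappa0 : 0 < kappa by exact: powR_gt0.
have [c kc cC] : exists2 c : R, kappa < c & ((N * c)%:E < C)%E.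
  case: C KC {iso} => [C| _|//]; last by exists (kappa + 1); rewrite ?ltrDl// ltry.
  rewrite lte_fin => KC; exists ((kappa + C / N) / 2).
    by rewrite ltr_pdivlMr// mulr_natr mulr2n ltrD2l ltr_pdivlMr// mulrC.
  rewrite lte_fin (_ : N * _ = (N * kappa + C) / 2); last by field; rewrite gt_eqF.
  by rewrite ltr_pdivrMr// mulr_natr mulr2n ltrD2r.
have c0 : 0 < c by exact: lt_trans kc.
pose h r := ball_vol o r `^ N^-1.
have f_ge0 r : 0 <= ball_vol o r by rewrite fine_ge0.
have f_mono : {homo (fun r => ball_vol o r) : s t / s <= t}.
  move=> s t st; apply: fine_le; rewrite ?ge0_fin_numE ?vol_fball//.
  apply: le_measure; rewrite ?inE; [exact: fball_borel|exact: fball_borel|].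
  by move=> x; rewrite /fball /= => xs; exact: lt_le_trans st.
have h_ge0 r : 0 <= h r by exact: powR_ge0.
have hN r : h r `^ N = ball_vol o r by rewrite /h -powRrM mulVf ?gt_eqF// powRr1.
have h_mono : {homo h : s t / s <= t}.
  by move=> s t st; apply: ge0_ler_powR; rewrite ?nnegrE ?invr_ge0 ?(ltW N0)//; exact: f_mono.
have [k [kk kc' k0]] : exists k : R, [/\ kappa < k, k < c & 0 < k].
  exists ((kappa + c) / 2); split; [|lra|lra].
  by lra.
have [r0 fr0] : exists r, 0 < ball_vol o r.
  have lower : \forall r \near +oo, 0 < ball_vol o r /\ 0 * r <= ball_vol o r `^ N^-1.
    by apply: ball_vol_lower => //; rewrite powR0 ?gt_eqF// mul0r.
  by have [r []] := filter_ex lower; exists r.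
have step s : r0 < s -> \forall j \near \oo, c * j.+1%:R^-1 <= h s - h (s - j.+1%:R^-1).
  move=> r0s; have fs : 0 < ball_vol o s by apply: lt_le_trans fr0 _; apply: f_mono; exact: ltW.
  have hs : 0 < h s by exact: powR_gt0.
  have bs : dist_bounded (fball o s).
    have [M BM] := fball_dist_to_bounded o s fc.
    split; first by exists o, s.
    by exists o, (M + 1) => x /BM; rewrite /bball /=; lra.
  have := iso (fball o s) (fball_borel o s) bs.
  have -> : (vol X (fball o s) `^ ((N - 1) / N))%E = (h s `^ (N - 1))%:E.
    by rewrite (vol_fballE o s fc) poweR_EFin /h -powRrM mulrC.
  have g0 : 0 < h s `^ (N - 1) by exact: powR_gt0.
  move=> isos.
  have : ((N * c * h s `^ (N - 1))%:E < limn_einf (fun j =>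
      \int[vol X]_x slope (ball_cutoff o s j.+1%:R) x))%E.
    apply: (@lt_le_trans _ _ (C * (h s `^ (N - 1))%:E)%E).
      by rewrite EFinM lte_pmul2r.
    apply: le_trans isos _; apply: ereal_inf_lbound.
    exists (fun j => ball_cutoff o s j.+1%:R) => //; split.
      by move=> j; exact: ball_cutoff_loc_lipschitz.
    exact: ball_cutoff_cvg_L1loc.
  move=> /lt_limn_einf; apply: filterS => j jlt.
  have j0 : 0 < j.+1%:R :> R by [].
  have := lt_le_trans jlt (integral_ball_cutoff_slope o s fc j0 no_isolated).
  rewrite lte_fin -!hN => jlt'.
  have pow_le : h s `^ N - h (s - j.+1%:R^-1) `^ N <=
      N * h s `^ (N - 1) * (h s - h (s - j.+1%:R^-1)).
    by rewrite lerBlDr -lerBlDl -mulrN opprB; exact: powR_tangent (ltW hs).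
  have := ler_wpM2l (ltW j0) pow_le.
  move=> /(lt_le_trans jlt').
  rewrite (_ : j.+1%:R * _ = (N * h s `^ (N - 1)) * (j.+1%:R * (h s - h (s - j.+1%:R^-1)))); last by ring.
  rewrite (_ : N * c * _ = (N * h s `^ (N - 1)) * c); last by ring.
  rewrite ltr_pM2l ?mulr_gt0// => /ltW cl.
  by rewrite ler_pdivrMr// mulrC.
have bound r : r0 <= r -> c * (r - r0) <= h r.
  move=> r0r; apply: le_trans (_ : h r - h r0 <= h r); last by rewrite gerBl.
  apply: backward_growth => //; first exact: ltW.
  move=> s delta r0s d0; have [j0 j0d] := inv_nat_small d0.
  have [j1 _ Hj] := step s r0s.
  exists (maxn j0 j1).+1%:R^-1; split => //; last by apply: Hj; exact: leq_maxr.
  by apply: le_trans (ltW j0d); rewrite lef_pV2 ?posrE// ler_nat ltnS leq_maxl.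
have upper : \forall r \near +oo, ball_vol o r `^ N^-1 <= k * r.
  apply: ball_vol_upper => //; first exact: ltW.
  rewrite Av lte_fin ltr_pdivlMr// mulrC.
  have -> : omega N * v = kappa `^ N by rewrite /kappa -powRrM mulVf ?gt_eqF// powRr1// ltW.
  by apply: gt0_ltr_powR; rewrite ?nnegrE// ltW.
(* Beyond c r0 / (c - k) the line c (r - r0) lies strictly above k r. *)
have far : \forall r \near +oo, Num.max r0 (c * r0 / (c - k)) < r.
  by apply: nbhs_pinfty_gt; exact: num_real.
have [r [hr]] : exists r, h r <= k * r /\ Num.max r0 (c * r0 / (c - k)) < r.
  by have [r] := filter_ex (filterI upper far); exists r.
rewrite gt_max => /andP[r0r]; rewrite ltr_pdivrMr ?subr_gt0// => cr.
have := le_trans (bound r (ltW r0r)) hr; rewrite mulrBr; move: cr; rewrite mulrBr.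
rewrite [r * c]mulrC [r * k]mulrC; lra.
Qed.

End Sharpness.

Theorem theorem1p3 (R : realType) (n : nat) (X : measured_finsler R n)
    (N : R) (o : X) :
  1 < N -> forward_complete X -> CD0 X N -> (0 < AVR N o)%E ->
  let K := ((N * omega N `^ N^-1)%:E * (AVR N o `^ N^-1))%E in
  isoperimetric_inequality X N K /\
  forall C : \bar R, (K < C)%E -> ~ isoperimetric_inequality X N C.
Proof.
move=> N1 fc cd A0 K; split; first exact: isoperimetric.
by move=> C; exact: isoperimetric_sharp.
Qed.
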